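(* Let $t>0$. For an arbitrary finite measure $\mu$ on $\mathbb{R}$, $$\lim_{\varepsilon\to0}\varepsilon^2 \sup_{x\in\mathbb{R}}\log\mathbf{E}_x e^{L_t^\mu(\varepsilon W)}=\frac{t}{2}\sup_{y\in\mathbb{R}} \mu(\{y\})^2 .$$ For an arbitrary $\sigma$-finite measure $\mu$ on $\mathbb{R}$ that satisfies $\sup_{x\in\mathbb{R}}\mu([x-1,x+1])<\infty$, $$\sup_{x\in\mathbb{R}}\limsup_{\varepsilon\to0}\varepsilon^2 \log\mathbf{E}_x e^{L_t^\mu(\varepsilon W)}=\frac{t}{2}\sup_{y\in\mathbb{R}} \mu(\{y\})^2 .$$
   Context: Measures are nonnegative Borel measures on $\mathbb{R}$. $W=\{W_t, t\ge 0\}$ is a real-valued Wiener process. For $\varepsilon>0$, the process $\varepsilon W$ is regarded as a Markov process whose initial value may vary: $\mathbf{P}_x$ denotes the law of $\varepsilon W$ with $\varepsilon W_0=x$ (i.e. of $x+\varepsilon B$ with $B$ a standard Wiener process started at $0$), and $\mathbf{E}_x$ is the expectation with respect to this law. The limits are over $\varepsilon>0$, $\varepsilon\to0$. Weighted local time: let $\mu$ be a $\sigma$-finite measure on $\mathbb{R}$ with $\sup_{x\in\mathbb{R}}\mu([x-1,x+1])<\infty$. The local time $L_t^\mu(\varepsilon W)$ of $\varepsilon W$ with weight $\mu$ is the mean-square limit as $n\to\infty$ (which exists by the general theory of $W$-functionals) of the integral functionals $$L_t^{\mu_n}(\varepsilon W)=\int_0^t k_n(\varepsilon W_s)\,ds,\qquad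 k_n(x)=\frac{\mu_n(dx)}{dx},$$ where $\mu_n$, $n\ge1$, is a sequence of absolutely continuous measures such that $\int_{\mathbb{R}} f\,d\mu_n\to\int_{\mathbb{R}} f\,d\mu$ for all continuous $f$ with compact support, and $\sup_{n\ge1}\sup_{x\in\mathbb{R}}\mu_n([x-1,x+1])<\infty$. Its characteristic is $$\mathbf{E}_x L_t^\mu(\varepsilon W)=\int_0^t\int_{\mathbb{R}}\frac{1}{\sqrt{2\pi s\varepsilon^2}}e^{-\frac{(y-x)^2}{2s\varepsilon^2}}\mu(dy)\,ds .$$ *)

(* Defs.v *)
From HB Require Import structures.
From mathcomp Require Import all_boot all_order all_algebra.
From mathcomp Require Import all_classical all_reals all_analysis.

Set Implicit Arguments.
Unset Strict Implicit.
Unset Printing Implicit Defensive.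

Import Order.TTheory GRing.Theory Num.Theory.
Import numFieldNormedType.Exports.

Local Open Scope classical_set_scope.
Local Open Scope ring_scope.

Definition independent_family d (Omega : measurableType d) (R : realType)
    (P : probability Omega R) (n : nat) (X : 'I_n -> Omega -> R) : Prop :=
  forall (J : {set 'I_n}) (A : 'I_n -> set R),
    (forall i, measurable (A i)) ->
    P (\bigcap_(i in [set` J]) (X i @^-1` A i)) =
    (\big[*%E/1]_(i in J) P (X i @^-1` A i))%E.

(* Only the times s >= 0 matter: B s is unconstrained for s < 0. *)
Record wiener_process d (Omega : measurableType d) (R : realType)
    (P : probability Omega R) (B : R -> {RV P >-> R}) : Prop := WienerProcess {
  wiener_start : {ae P, forall w, B 0 w = 0} ;
  wiener_indep : forall (n : nat) (s : nat -> R),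
    0 <= s 0%N -> nondecreasing_seq s ->
    independent_family P (fun (i : 'I_n) w => B (s i.+1) w - B (s i) w) ;
  wiener_gauss : forall (r s : R) (A : set R), 0 <= r -> r < s -> measurable A ->
    P ((fun w => B s w - B r w) @^-1` A) = normal_prob 0 (Num.sqrt (s - r)) A ;
  wiener_continuous : forall w, {within `[0, +oo[, continuous (fun s => B s w)} }.

Arguments wiener_process {d Omega R} P B.

Definition locally_bounded_measure (R : realType)
    (mu : {measure set R -> \bar R}) : Prop :=
  (ereal_sup (range (fun x : R => mu `[(x - 1)%R, (x + 1)%R]%classic)) < +oo)%E.

(* mu_ n has density k n, the mu_ n are uniformly locally bounded and they
   converge vaguely to mu. *)
Record approximating_measures (R : realType) (mu : {measure set R -> \bar R})
    (mu_ : nat -> {measure set R -> \bar R}) (k : nat -> R -> R) : Prop :=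
  ApproximatingMeasures {
  approx_density_measurable : forall n, measurable_fun [set: R] (k n) ;
  approx_density_ge0 : forall n x, 0 <= k n x ;
  approx_density : forall n (A : set R), measurable A ->
    mu_ n A = (\int[lebesgue_measure]_(x in A) (k n x)%:E)%E ;
  approx_bounded : (ereal_sup (range (fun n : nat =>
    ereal_sup (range (fun x : R => mu_ n `[(x - 1)%R, (x + 1)%R]%classic)))) < +oo)%E ;
  approx_vague : forall f : R -> R, continuous f ->
    compact (closure [set x | f x != 0]) ->
    (\int[mu_ n]_x (f x)%:E)%E @[n --> \oo] --> (\int[mu]_x (f x)%:E)%E }.

(* The functional \int_0^t k(X_s) ds; it may be infinite on a null event. *)
Definition integral_functional (T : Type) (R : realType) (X : R -> T -> R)
    (k : R -> R) (t : R) (w : T) : \bar R :=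
  (\int[lebesgue_measure]_(s in `[0%R, t]%classic) (k (X s w))%:E)%E.

(* L is a version of the local time at time t, with weight mu, of the process
   X; as a mean-square limit it is determined only up to a P-null event.  The
   limit does not depend on the approximating sequence, so it is enough to ask
   for one. *)
Definition is_local_time d (Omega : measurableType d) (R : realType)
    (P : probability Omega R) (X : R -> Omega -> R)
    (mu : {measure set R -> \bar R}) (t : R) (L : {RV P >-> R}) : Prop :=
  exists mu_ k, approximating_measures mu mu_ k /\
    Lnorm P 2%:E (fun w => integral_functional X (k n) t w - (L w)%:E)%E
      @[n --> \oo] --> 0%E.

Arguments is_local_time {d Omega R} P X mu t L.

(* L e x is the local time under P_x: the process e W started at x is
   realized as x + e B. *)
Definition local_time_family d (Omega : measurableType d) (R : realType)
    (P : probability Omega R) (B : R -> {RV P >-> R})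
    (mu : {measure set R -> \bar R}) (t : R)
    (L : R -> R -> {RV P >-> R}) : Prop :=
  forall e x : R, 0 < e ->
    is_local_time P (fun s w => x + e * B s w) mu t (L e x).

Arguments local_time_family {d Omega R} P B mu t L.

Definition log_exp_moment d (Omega : measurableType d) (R : realType)
    (P : probability Omega R) (L : R -> R -> {RV P >-> R}) (e x : R) : \bar R :=
  lne ('E_P[fun w => expR (L e x w)])%E.

Arguments log_exp_moment {d Omega R} P L e x.

(* Main.v *)
(* For k >= 0 let A = \int_0^t k(x + e B_s) ds.  By the Markov property
   E A^(m+1) / (m+1)! <= exp(l t) q^m G(x), where G is the Green function of k at
   rate l and q = sup G.  With l = c / e^2 the resolvent kernel is at most
   1 / sqrt(2 c) and decays like exp(- sqrt(c) |w| / e^2), so q < 1 for small e as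
   soon as every ball of a fixed small radius has mass less than sqrt(2 c); then
   E exp A = O(exp(c t / e^2)).  The part of k at distance at least R0 from x is
   split off by (a + b)^m <= (p a)^m + (p' b)^m with conjugate exponents p, p' and
   contributes O(1) for R0 large, so the small balls matter only near x: this
   makes the bound uniform in x for finite mu and valid for fixed x in general.
   Conversely, for an atom of mass a at y, keeping only the mass near y bounds
   E_y A^(2j) / (2j)! from below by (a^2 t / (2 e^2))^j / j!, because the kernel
   (2 pi e^2 r)^(-1/2) has the constant 1 / (2 e^2) as convolution square; hence
   E_y exp L >= exp(a^2 t / (2 e^2)) for every e.  All moment bounds pass to the
   local time by mean-square approximation. *)

Require Import Defs.
From HB Require Import structures.
From mathcomp Require Import all_boot all_order all_algebra.
From mathcomp Require Import all_classical all_reals all_analysis.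
From mathcomp Require Import measurable_realfun ring lra.

Import Order.TTheory GRing.Theory Num.Theory.
Import numFieldNormedType.Exports.

Set Implicit Arguments.
Unset Strict Implicit.
Unset Printing Implicit Defensive.

Local Open Scope classical_set_scope.
Local Open Scope ring_scope.

(** * Tonelli's theorem over the Lebesgue measure *)

(** The process has one fixed starting point, so no family of laws is available to iterate over. The
    Markov property is used at deterministic times, in integrated form, and the moment recursion
    peels off the latest time: each step produces the Green function at the current position, hence
    the supremum [q], and only the earliest time contributes [green x]. This asymmetry is what
    handles remote mass, whose Green function is small at [x] but merely below 1 elsewhere.

    Upper and lower bounds meet because both come from the arcsine integral: the critical mass sqrt
    (2 c) equals an atom of mass a exactly when c = a^2 / 2, and then c t / e^2 = a^2 t / (2 e^2).

    The obstacle is that vague convergence transfers small-ball bounds to [mu_ n] only for centres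
    in a compact set. Farther out nothing but the uniform local bound is known, and [mu_ n] may
    concentrate there. So even for a finite [mu] the approximating densities must be cut before the
    limit is taken. *)

Lemma ge0_le_integralT d (T : measurableType d) (R : realType)
    (m : {measure set T -> \bar R}) (f g : T -> \bar R) :
  measurable_fun setT f -> measurable_fun setT g -> (forall x, 0 <= f x)%E ->
  (forall x, f x <= g x)%E -> (\int[m]_x f x <= \int[m]_x g x)%E.
Proof.
move=> mf mg f0 fg; apply: ge0_le_integral => // x _.
Qed.

Lemma ge0_integralZlT d (T : measurableType d) (R : realType)
    (m : {measure set T -> \bar R}) (c : \bar R) (f : T -> \bar R) :
  measurable_fun setT f -> (forall x, 0 <= f x)%E -> (0 <= c)%E ->
  (\int[m]_x (c * f x) = c * \int[m]_x f x)%E.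
Proof. by move=> mf f0 c0; rewrite ge0_integralZl. Qed.

Section Tonelli.
Context d1 d2 (T1 : measurableType d1) (T2 : measurableType d2) (R : realType).
Variable m1 : {sigma_finite_measure set T1 -> \bar R}.
Variable m2 : {sigma_finite_measure set T2 -> \bar R}.
Variable f : T1 -> T2 -> \bar R.
Hypothesis mf : measurable_fun setT (fun p : T1 * T2 => f p.1 p.2).
Hypothesis f0 : forall x y, (0 <= f x y)%E.

Lemma tonelli : (\int[m1]_x \int[m2]_y f x y = \int[m2]_y \int[m1]_x f x y)%E.
Proof. exact: (@fubini_tonelli _ _ T1 T2 R m1 m2 (fun p => f p.1 p.2) mf (fun p => f0 p.1 p.2)). Qed.

Lemma measurable_integral_snd :
  measurable_fun setT (fun x => \int[m2]_y f x y)%E.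
Proof. exact: (@measurable_fun_fubini_tonelli_F _ _ T1 T2 R m2 (fun p => f p.1 p.2) mf (fun p => f0 p.1 p.2)). Qed.

Lemma measurable_integral_fst :
  measurable_fun setT (fun y => \int[m1]_x f x y)%E.
Proof. exact: (@measurable_fun_fubini_tonelli_G _ _ T1 T2 R m1 (fun p => f p.1 p.2) mf (fun p => f0 p.1 p.2)). Qed.

End Tonelli.

Section TonelliLebesgue.
Context d (T : measurableType d) (R : realType).
Variable m : {sigma_finite_measure set T -> \bar R}.
Local Notation mu := (@lebesgue_measure R).
Variable f : R -> T -> \bar R.
Hypothesis mf : measurable_fun setT (fun p : R * T => f p.1 p.2).
Hypothesis f0 : forall x y, (0 <= f x y)%E.

Let mf' : measurable_fun setT (fun p : measurableTypeR R * T => f p.1 p.2).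
Proof. exact: mf. Qed.

(** Lebesgue measure lives on [measurableTypeR R]; the statement is repeated over plain [R] so that
    later proofs need no conversion. *)
Lemma tonelli_lebesgue :
  (\int[mu]_u \int[m]_w f u w = \int[m]_w \int[mu]_u f u w)%E.
Proof. exact: (@tonelli _ _ (measurableTypeR R) T R mu m f mf' f0). Qed.

Lemma measurable_integral_lebesgue :
  measurable_fun setT (fun w => \int[mu]_u f u w)%E.
Proof. exact: (@measurable_integral_fst _ _ (measurableTypeR R) T R mu f mf' f0). Qed.

Lemma measurable_integral_time : measurable_fun setT (fun u => \int[m]_w f u w)%E.
Proof. exact: (@measurable_integral_snd _ _ (measurableTypeR R) T R m f mf' f0). Qed.

End TonelliLebesgue.

Section TonelliPlane.
Context (R : realType).
Local Notation mu := (@lebesgue_measure R).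
Variable f : R -> R -> \bar R.
Hypothesis mf : measurable_fun setT (fun p : R * R => f p.1 p.2).
Hypothesis f0 : forall x y, (0 <= f x y)%E.

Let mf' : measurable_fun setT (fun p : R * measurableTypeR R => f p.1 p.2).
Proof. exact: mf. Qed.

Lemma tonelli_plane :
  (\int[mu]_u \int[mu]_v f u v = \int[mu]_v \int[mu]_u f u v)%E.
Proof. exact: (@tonelli_lebesgue _ (measurableTypeR R) R mu f mf' f0). Qed.

Lemma measurable_integral_planel : measurable_fun setT (fun v => \int[mu]_u f u v)%E.
Proof. exact: (@measurable_integral_lebesgue _ R R f mf f0). Qed.

Lemma measurable_integral_planer : measurable_fun setT (fun u => \int[mu]_v f u v)%E.
Proof. exact: (@measurable_integral_time _ (measurableTypeR R) R mu f mf' f0). Qed.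

End TonelliPlane.

(** * Affine changes of variable *)

Section LebesgueAffine.
Context (R : realType).
Local Notation mu := (@lebesgue_measure R).

(** The image of Lebesgue measure under the affine map, multiplied by [b], gives every interval ]u,
    v] its length, so it is Lebesgue measure by uniqueness. *)
Lemma lebesgue_measure_affine (a b : R) (A : set R) : 0 < b -> measurable A ->
  mu ((fun x => a + b * x) @^-1` A) = (b^-1%:E * mu A)%E.
Proof.
move=> b0 mA.
have mg : measurable_fun setT ((fun x => a + b * x) : measurableTypeR R -> measurableTypeR R).
  by apply: measurable_funD => //; exact: measurable_funM.
pose g : {mfun measurableTypeR R >-> measurableTypeR R} :=
  HB.pack ((fun x => a + b * x) : _ -> _) (isMeasurableFun.Build _ _ _ _ _ mg).
pose bb : {nonneg R} := NngNum (ltW b0).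
have := @lebesgue_measure_unique R (mscale bb (pushforward mu g)) _ A mA.
rewrite /mscale/= /pushforward /= => ->.
  by rewrite muleA -EFinM mulVf ?gt_eqF// mul1e.
move=> _ [[u v]] _ <-; rewrite /mscale/= /pushforward/=.
have -> : (fun x => a + b * x) @^-1` `]u, v] = `](u - a) / b, (v - a) / b]%classic.
  apply/seteqP; split => x /=; rewrite !in_itv/= ltr_pdivrMr// ler_pdivlMr// (mulrC x);
  by move=> /andP[? ?]; apply/andP; split; lra.
rewrite !lebesgue_measure_itv/= !lte_fin ltr_pdivrMr// divfK ?gt_eqF// ltrD2r.
case: ifP => _; last by rewrite mule0.
rewrite -!EFinB -EFinM; congr EFin; field; exact: lt0r_neq0.
Qed.

Lemma integral_affine (f : R -> \bar R) (a b : R) : 0 < b ->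
  measurable_fun setT f -> (forall x, 0 <= f x)%E ->
  (\int[mu]_x f (a + b * x)%R = b^-1%:E * \int[mu]_x f x)%E.
Proof.
move=> b0 mf f0.
have mg : measurable_fun setT ((fun x => a + b * x) : measurableTypeR R -> measurableTypeR R).
  by apply: measurable_funD => //; exact: measurable_funM.
pose g : {mfun measurableTypeR R >-> measurableTypeR R} :=
  HB.pack ((fun x => a + b * x) : _ -> _) (isMeasurableFun.Build _ _ _ _ _ mg).
have bi : 0 <= b^-1 by rewrite invr_ge0 ltW.
have := @ge0_integral_pushforward _ _ _ _ R _ mg mu setT f measurableT mf (fun y _ => f0 y).
rewrite preimage_setT => <-.
rewrite -(ge0_integral_mscale mu measurableT (NngNum bi) mf)//.
apply: eq_measure_integral => A mA _.
by rewrite /mscale/= /pushforward; exact: lebesgue_measure_affine.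
Qed.

Lemma lebesgue_integralZl (c : \bar R) (f : R -> \bar R) : measurable_fun setT f ->
  (forall x, 0 <= f x)%E -> (0 <= c)%E ->
  (\int[mu]_x (c * f x) = c * \int[mu]_x f x)%E.
Proof. by move=> mf f0 c0; rewrite ge0_integralZl. Qed.

Lemma le_lebesgue_integral (f g : R -> \bar R) :
  measurable_fun setT f -> measurable_fun setT g -> (forall x, 0 <= f x)%E ->
  (forall x, f x <= g x)%E -> (\int[mu]_x f x <= \int[mu]_x g x)%E.
Proof. by move=> mf mg f0 fg; exact: ge0_le_integralT. Qed.

Lemma integral_shift (f : R -> \bar R) (a : R) :
  measurable_fun setT f -> (forall x, 0 <= f x)%E ->
  (\int[mu]_x f (x + a)%R = \int[mu]_x f x)%E.
Proof.
move=> mf f0; have := @integral_affine f a 1 ltr01 mf f0.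
rewrite invr1 mul1e => <-; apply: eq_integral => x _.
by rewrite mul1r addrC.
Qed.

End LebesgueAffine.

(** * Integration against a measure given by a density *)

Section Density.
Context d (T : measurableType d) (R : realType).
Variables (nu mu : {measure set T -> \bar R}) (g : T -> R).
Hypotheses (mg : measurable_fun setT g) (g0 : forall x, 0 <= g x).
Hypothesis nuE : forall A, measurable A -> nu A = (\int[mu]_(x in A) (g x)%:E)%E.
Import HBNNSimple.

(** Linear in [f] and true for indicators by [nuE], hence true for simple functions; monotone
    convergence on both sides does the rest. It serves to write Gaussian expectations as Lebesgue
    integrals. *)
Lemma ge0_integral_density (f : T -> \bar R) :
  measurable_fun setT f -> (forall x, 0 <= f x)%E ->
  (\int[nu]_x f x = \int[mu]_x (f x * (g x)%:E))%E.
Proof.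
move=> mf f0; pose h := nnsfun_approx measurableT mf.
have mEg : measurable_fun setT (EFin \o g) by exact/measurable_EFinP.
have -> : (\int[nu]_x f x = lim (\int[nu]_x (EFin \o h n) x @[n --> \oo]))%E.
  have fE x : f x = lim ((EFin \o h n) x @[n --> \oo]).
    by apply/esym/cvg_lim => //; exact: cvg_nnsfun_approx.
  under eq_integral => x _ do rewrite fE.
  apply: monotone_convergence => //.
  - by move=> n; exact/measurable_EFinP.
  - by move=> n x _ //=; rewrite lee_fin.
  - by move=> x _ a b ab; rewrite lee_fin; exact/lefP/nd_nnsfun_approx.
have -> : (\int[mu]_x (f x * (g x)%:E) =
    lim (\int[mu]_x ((EFin \o h n) x * (g x)%:E) @[n --> \oo]))%E.
  have fg x : (f x * (g x)%:E = lim (((EFin \o h n) x * (g x)%:E)%E @[n --> \oo]))%E.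
    by apply/esym/cvg_lim => //; apply: cvgeZr => //; exact: cvg_nnsfun_approx.
  under eq_integral => x _ do rewrite fg.
  apply: monotone_convergence => //.
  - by move=> n; apply/emeasurable_funM => //; exact/measurable_EFinP.
  - by move=> n x _ /=; rewrite mule_ge0 ?lee_fin.
  - by move=> x _ a b ab/=; rewrite lee_wpmul2r ?lee_fin//; exact/lefP/nd_nnsfun_approx.
apply/congr_lim/funext => n /=.
transitivity (\int[nu]_x
   (\sum_(y \in range (h n)) (y * \1_(h n @^-1` [set y]) x)%:E))%E.
  by apply: eq_integral => t tE; rewrite /= fimfunE -fsumEFin.
have indich m r : measurable_fun setT (fun x => (r * \1_(h m @^-1` [set r]) x)%:E).
  by apply/measurable_EFinP; exact: measurable_funM.
rewrite ge0_integral_fsum//; last by move=> m y Ey; exact: nnfun_muleindic_ge0.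
transitivity (\int[mu]_x (\sum_(y \in range (h n))
    (y * \1_(h n @^-1` [set y]) x)%:E * (g x)%:E))%E; last first.
  apply: eq_integral => x xE.
  rewrite -ge0_mule_fsuml => [|y]; last exact: nnfun_muleindic_ge0.
  by rewrite fsumEFin // -(fimfunE _ x).
rewrite ge0_integral_fsum//; last 2 first.
  - by move=> y; apply: emeasurable_funM.
  - by move=> m y Ey; rewrite mule_ge0 ?lee_fin ?g0// -lee_fin nnfun_muleindic_ge0.
apply: eq_fsbigr => r rhn.
rewrite integralZl_indic_nnsfun//.
under [RHS]eq_integral do rewrite EFinM -muleA.
have r0 : 0 <= r.
  by move: rhn; rewrite inE /= => -[x _ <-].
rewrite [RHS]ge0_integralZl//; last 2 first.
- by apply: emeasurable_funM => //; exact/measurable_EFinP/measurable_indic.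
- by move=> x _; rewrite mule_ge0 ?lee_fin.
congr (_ * _)%E; rewrite integral_indic// setIT nuE//.
by rewrite integral_mkcond; apply: eq_integral => x _; rewrite patchE indicE;
  case: ifPn => _; rewrite ?mul1e ?mul0e.
Qed.

End Density.

Section Independence.
Context d (Omega : measurableType d) (R : realType) (P : probability Omega R).

(** [C |-> P (C & D)] and [C |-> P D * P C] are finite measures that agree on the pi-system [G],
    hence on the sigma-algebra it generates. *)
Lemma independent_of_generated (G : set (set Omega)) (D : set Omega) :
  G `<=` measurable -> setI_closed G -> G setT -> measurable D ->
  (forall C, G C -> P (C `&` D) = P C * P D)%E ->
  forall C, <<s G >> C -> (P (C `&` D) = P C * P D)%E.
Proof.
move=> Gm GI GT mD GD C sC.
have PD0 : 0 <= fine (P D) by rewrite fine_ge0.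
have PDE : P D = (fine (P D))%:E by rewrite fineK// fin_num_measure.
rewrite [RHS]muleC PDE.
apply: (@g_sigma_algebra_measure_unique _ R Omega G Gm (fun=> setT) (fun=> GT) _
  (mrestr P mD) (mscale (NngNum PD0) P) GI _ _ C sC).
- by rewrite bigcup_const//; exists 0%N.
- by move=> A GA; rewrite [LHS](GD A GA) muleC; congr (_ * _)%E.
- move=> _; apply: le_lt_trans (probability_le1 P _) (ltry 1).
  exact: measurableI.
Qed.

End Independence.

(** * The Markov property *)

Section WienerPast.
Context d (Omega : measurableType d) (R : realType) (P : probability Omega R).
Variables (B : R -> {RV P >-> R}) (hB : wiener_process P B).

(* B is unconstrained at negative times, whence the truncation of the time. *)
Definition wpath (u : R) (w : Omega) : R := B (Num.max u 0) w - B 0 w.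

Lemma measurable_wpath u : measurable_fun setT (wpath u).
Proof. exact: measurable_funB. Qed.

Lemma wpath_max u : wpath (Num.max u 0) = wpath u.
Proof. by rewrite /wpath -maxA maxxx. Qed.

(** Valid at every sample point, whereas [B 0 w = 0] holds only almost surely: this is what
    subtracting [B 0] achieves. *)
Lemma wpath0 w : wpath 0 w = 0.
Proof. by rewrite /wpath maxxx subrr. Qed.

Lemma wpathB r s w : 0 <= r -> 0 <= s -> wpath s w - wpath r w = B s w - B r w.
Proof. by move=> r0 s0; rewrite /wpath !max_l//; ring. Qed.

(** Continuity of [B] is known only within the closed half-line; the truncation maps the whole line
    continuously into it. *)
Lemma continuous_wpath w : continuous (wpath ^~ w).
Proof.
move=> u; apply: cvgB; last exact: cvg_cst.
have /subspace_continuousP := @wiener_continuous _ _ _ _ _ hB w.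
move=> /(_ (Num.max u 0)); rewrite /= in_itv/= andbT le_max lexx orbT => /(_ isT).
move=> H A hA.
have mc : Num.max u' 0 @[u' --> u] --> Num.max u 0.
  rewrite maxr_absE subr0 addr0.
  under eq_fun do rewrite maxr_absE subr0 addr0.
  by apply: cvgM; [apply: cvgD; [exact: cvg_id|exact: cvg_norm]|exact: cvg_cst].
have h2 : \forall y \near u, `[0, +oo[%classic (Num.max y 0) -> A (B (Num.max y 0) w).
  exact: mc _ (H A hA).
suff : \forall y \near u, A (B (Num.max y 0) w) by [].
apply: filterS h2 => y; apply.
by rewrite /= in_itv/= andbT le_max lexx orbT.
Qed.

Definition increment (s : nat -> R) (i : nat) (w : Omega) : R :=
  B (s i.+1) w - B (s i) w.

Lemma measurable_increment s i : measurable_fun setT (increment s i).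
Proof. exact: measurable_funB. Qed.

Lemma measurable_increment_preimage s i A : measurable A ->
  measurable (increment s i @^-1` A).
Proof. by move=> mA; rewrite -[X in measurable X]setTI; exact: measurable_increment. Qed.

Lemma increment_indep (s : nat -> R) n (A : nat -> set R) :
  0 <= s 0%N -> nondecreasing_seq s -> (forall i, measurable (A i)) ->
  (P (\bigcap_(i < n.+1) (increment s i @^-1` A i)) =
  P (\bigcap_(i < n) (increment s i @^-1` A i)) * P (increment s n @^-1` A n))%E.
Proof.
move=> s0 ns mA.
have H m : (P (\bigcap_(i < m) (increment s i @^-1` A i)) =
    \prod_(i < m) P (increment s i @^-1` A i))%E.
  have := @wiener_indep _ _ _ _ _ hB m s s0 ns [set: 'I_m]%SET (fun i => A i) (fun i => mA i).
  rewrite (eq_bigl xpredT); last by move=> i; rewrite inE.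
  move=> <-; congr (P _); apply/seteqP; split => w /= hw.
    by move=> i _; exact: (hw i (ltn_ord i)).
  by move=> i im; apply: (hw (Ordinal im)); rewrite /= inE.
by rewrite H big_ord_recr/= -H.
Qed.

Definition increment_events (s : nat -> R) (n : nat) : set (set Omega) :=
  [set C | exists2 A : nat -> set R, (forall i, measurable (A i)) &
    C = \bigcap_(i < n) (increment s i @^-1` A i)].

Lemma increment_independent s n C A : 0 <= s 0%N -> nondecreasing_seq s ->
  measurable A -> <<s increment_events s n >> C ->
  (P (C `&` increment s n @^-1` A) = P C * P (increment s n @^-1` A))%E.
Proof.
move=> s0 ns mA; apply: independent_of_generated.
- move=> _ [D mD ->]; apply: bigcap_measurableType => // i _.
  exact: measurable_increment_preimage.
- move=> _ _ [D1 mD1 ->] [D2 mD2 ->].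
  exists (fun i => D1 i `&` D2 i); first by move=> i; exact: measurableI.
  by rewrite -bigcapI; apply: eq_bigcapr => i _; rewrite preimage_setI.
- exists (fun=> setT) => //; apply/esym; rewrite -subTset => w _ i _ //.
- exact: measurable_increment_preimage.
- move=> _ [D mD ->].
  have := @increment_indep s n (fun i => if i == n then A else D i) s0 ns.
  rewrite eqxx.
  have E : \bigcap_(i < n) (increment s i @^-1` (if i == n then A else D i)) =
           \bigcap_(i < n) (increment s i @^-1` D i).
    by apply: eq_bigcapr => i /= im; rewrite (ltn_eqF im).
  rewrite E => <-; last by move=> i; case: ifP.
  congr (P _); apply/seteqP; split => w /=.
    move=> [h1 h2] i; rewrite /= ltnS leq_eqVlt; case: eqVneq => [-> _ //|_ /= im].
    exact: h1.
  move=> h; split; last by have /= := h n (ltnSn n); rewrite eqxx.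
  by move=> i im; have /= := h i (ltnW im); rewrite (ltn_eqF im).
Qed.

(** Finite intersections instead of single preimages, so that the generators form a pi-system.
    Negative times are harmless because [wpath] truncates them. *)
Definition past (v : R) : set (set Omega) :=
  [set C | exists n (u : nat -> R) (A : nat -> set R),
    [/\ forall i, u i <= v, forall i, measurable (A i) &
      C = \bigcap_(i < n) (wpath (u i) @^-1` A i)]].

(** A past event involves finitely many times. Sorted and completed by 0, [v] and [s], they form a
    grid in which the event depends on the first increments only, while the increment from [v] to
    [s] comes next. *)
Lemma past_independent v s C A : 0 <= v -> v <= s -> measurable A ->
  <<s past v >> C ->
  (P (C `&` (fun w => wpath s w - wpath v w)%R @^-1` A) =
   P C * P ((fun w => wpath s w - wpath v w)%R @^-1` A))%E.
Proof.
move=> v0 vs mA; have s0 := le_trans v0 vs.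
apply: independent_of_generated.
- move=> _ [n [u [D [_ mD ->]]]]; apply: bigcap_measurableType => // i _.
  by rewrite -[X in measurable X]setTI; exact: measurable_wpath.
- move=> _ _ [n1 [u1 [D1 [h1 mD1 ->]]]] [n2 [u2 [D2 [h2 mD2 ->]]]].
  exists (n1 + n2)%N, (fun i => if (i < n1)%N then u1 i else u2 (i - n1)%N),
   (fun i => if (i < n1)%N then D1 i else D2 (i - n1)%N); split.
  + by move=> i; case: ifP.
  + by move=> i; case: ifP.
  + apply/seteqP; split => w /=.
      move=> [g1 g2] i /= im; case: ifPn => h; first exact: g1.
      by apply: g2; rewrite /= -leqNgt in h *; rewrite ltn_subLR.
    move=> g; split => i /= im.
      by have := g i; rewrite /= im; apply; exact: ltn_addr.
    have := g (n1 + i)%N; rewrite /= ltn_add2l (ltnNge _ n1) leq_addr/= addKn; exact.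
- exists 0%N, (fun=> v), (fun=> setT); split => //.
  by apply/esym; rewrite -subTset => w _ i.
- rewrite -[X in measurable X]setTI.
  by apply: measurable_funB => //; exact: measurable_wpath.
move=> _ [n [u [D [hu mD ->]]]].
(* The times of the event, truncated at 0 as in [wpath] and put in increasing order. *)
pose l := sort <=%R [seq Num.max (u i) 0 | i <- iota 0 n].
have lsz : size l = n by rewrite size_sort size_map size_iota.
have lmem x : x \in l -> 0 <= x <= v.
  rewrite mem_sort => /mapP[i _ ->]; rewrite le_max lexx orbT/=.
  by rewrite ge_max hu.
(* The grid: 0 at index 0, the sorted times at 1, ..., n, then [v] at n + 1 and [s] from n + 2 on.
   Increment number n + 1 is the one from [v] to [s]. *)
pose t i := if i is j.+1 then
  if (j < n)%N then nth v l j else if j == n then v else s else 0.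
have tn : t n.+1 = v by rewrite /t ltnn eqxx.
have tn1 : t n.+2 = s by rewrite /t ltnNge leqnSn/= gtn_eqF.
have lnth j : (j < n)%N -> 0 <= nth v l j <= v.
  by move=> jn; apply: lmem; rewrite mem_nth// lsz.
have nt : nondecreasing_seq t.
  apply/nondecreasing_seqP => -[|j] /=.
    by case: ifPn => [/lnth/andP[]//|_]; case: ifP.
  case: (ltngtP j.+1 n) => jn.
  - apply: (sorted_leq_nth (@le_trans _ R) (@lexx _ R)).
    + exact: sort_le_sorted.
    + by rewrite inE lsz (ltnW jn).
    + by rewrite inE lsz.
    + exact: leqnSn.
  - by case: ifP.
  - by have /andP[] := lnth j ltac:(by rewrite -jn).
have tge j : 0 <= t j by apply: (nt 0%N).
pose G := increment_events t n.+1.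
(* The path vanishes at [t 0 = 0], so its value at a grid point is a sum of earlier increments. *)
have mt j : (j <= n.+1)%N ->
    measurable_fun (setT : set (g_sigma_algebraType G)) (wpath (t j)).
  elim: j => [_|j IH jn].
    rewrite [X in measurable_fun _ X](_ : _ = cst 0) //.
    by apply/funext => w; rewrite wpath0.
  rewrite [X in measurable_fun _ X](_ : _ = (wpath (t j) \+ increment t j)).
    apply: measurable_funD; first by apply: IH; exact: ltnW.
    move=> _ Y mY; rewrite setTI; apply: sub_sigma_algebra.
    exists (fun i => if i == j then Y else setT); first by move=> i; case: ifP.
    apply/seteqP; split => w /=.
      by move=> h i _ /=; case: eqVneq => // ->.
    by move=> /(_ j jn) /=; rewrite eqxx.
  by apply/funext => w /=; rewrite /increment -wpathB//; ring.
have GC : <<s G >> (\bigcap_(i < n) (wpath (u i) @^-1` D i)).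
  suff : measurable ((\bigcap_(i < n) (wpath (u i) @^-1` D i)) : set (g_sigma_algebraType G)) by [].
  apply: bigcap_measurableType => // i /= im.
  have : Num.max (u i) 0 \in l.
    by rewrite mem_sort; apply/mapP; exists i => //; rewrite mem_iota.
  move=> /(nthP v)[j]; rewrite lsz => jn E.
  have := mt j.+1 (leqW jn); rewrite /t jn E wpath_max => /(_ measurableT _ (mD i)).
  by rewrite setTI.
have := increment_independent (tge 0%N) nt mA GC.
rewrite (_ : increment t n.+1 = (fun w => wpath s w - wpath v w))//.
by apply/funext => w; rewrite /increment tn tn1 wpathB.
Qed.

End WienerPast.

(** * Joint measurability in time and sample point *)

Section Caratheodory.
Context d (T : measurableType d) (R : realType).

Let grid n (u : R) : R := (Num.truncn (n.+1%:R * Num.max u 0))%:R / n.+1%:R.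

Let cvg_grid (u : R) : grid n u @[n --> \oo] --> Num.max u 0.
Proof.
apply/cvgrPdist_le => e e0; near=> n.
have n0 : 0 < n.+1%:R :> R by rewrite ltr0n.
have m0 : 0 <= n.+1%:R * Num.max u 0 by rewrite mulr_ge0// le_max lexx orbT.
have /andP[h1 h2] := truncn_itv m0.
have -> : Num.max u 0 - grid n u =
    (n.+1%:R * Num.max u 0 - (Num.truncn (n.+1%:R * Num.max u 0))%:R) / n.+1%:R.
  by rewrite /grid mulrBl mulrAC divff ?gt_eqF// mul1r.
rewrite normrM normfV (gtr0_norm n0) ler_pdivrMr//.
have /le_trans : `|n.+1%:R * Num.max u 0 -
    (Num.truncn (n.+1%:R * Num.max u 0))%:R| <= 1.
  by rewrite ger0_norm ?subr_ge0// lerBlDl natr1 ltW.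
apply; rewrite -ler_pdivrMr// div1r ltW//.
by near: n; exact: (near_infty_natSinv_lt (PosNum e0)).
Unshelve. all: by end_near. Qed.

(* The process is the pointwise limit of its discretizations at times floor(n u)/n. *)
Lemma measurable_continuous_process (Y : R -> T -> R) :
  (forall u, measurable_fun setT (Y u)) -> (forall w, continuous (Y ^~ w)) ->
  measurable_fun setT (fun p : R * T => Y (Num.max p.1 0) p.2).
Proof.
move=> mY cY.
apply: (@measurable_fun_cvg _ (R * T)%type R setT (fun n p => Y (grid n p.1) p.2)); last first.
  move=> [u w] _ /=; exact: (@cvg_comp _ _ _ _ _ _ _ _ (@cvg_grid u) (cY w (Num.max u 0))).
move=> n _ S mS; rewrite setTI.
have n0 : 0 < n.+1%:R :> R by rewrite ltr0n.
(* The discretized process uses countably many times, so a preimage is a countable union of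
   rectangles with time side [D i]. *)
pose D (i : nat) := [set u : R | Num.truncn (n.+1%:R * Num.max u 0) = i].
have -> : (fun p : R * T => Y (grid n p.1) p.2) @^-1` S =
    \bigcup_i (D i `*` (Y (i%:R / n.+1%:R) @^-1` S)).
  apply/seteqP; split => [[u w] /= h|[u w] [i _ [/= <-]]//].
  by exists (Num.truncn (n.+1%:R * Num.max u 0)).
apply: bigcupT_measurable => i; apply: measurableX; last first.
  by rewrite -[X in measurable X]setTI; exact: mY.
have mh : measurable_fun setT (fun u : R => n.+1%:R * Num.max u 0).
  by apply: measurable_funM => //; exact: measurable_maxr.
have -> : D i = (fun u : R => n.+1%:R * Num.max u 0) @^-1` `[i%:R, i.+1%:R[.
  apply/seteqP; split => u /=; rewrite /D /= in_itv/=.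
    by move=> <-; apply: truncn_itv; rewrite mulr_ge0// le_max lexx orbT.
  by move=> h; apply: truncn_def.
by rewrite -[X in measurable X]setTI; apply: mh.
Qed.

End Caratheodory.

Lemma measurable_expe d (T : measurableType d) (R : realType) (f : T -> \bar R) n :
  measurable_fun setT f -> measurable_fun setT (fun x => f x ^+ n)%E.
Proof.
move=> mf; elim: n => [|n IH].
  rewrite [X in measurable_fun _ X](_ : _ = cst 1%E) //.
rewrite [X in measurable_fun _ X](_ : _ = (fun x => f x * f x ^+ n)%E).
  exact: emeasurable_funM.
by apply/funext => x; rewrite expeS.
Qed.

(** * Powers of a cumulative integral *)

Section CumulativeIntegral.
Context (R : realType).
Local Notation mu := (@lebesgue_measure R).
Variables (g : R -> R).
Hypotheses (mg : measurable_fun setT g) (g0 : forall u, 0 <= g u).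

Lemma eq_integral_off (c : R) (f h : R -> \bar R) :
  measurable_fun setT f -> measurable_fun setT h ->
  (forall x, x != c -> f x = h x) -> (\int[mu]_x f x = \int[mu]_x h x)%E.
Proof.
move=> mf mh fh.
have mD : measurable (setT `\ c) by exact: measurableD.
rewrite -(@integral_setD1 R f c setT)//; last exact: measurable_funTS.
rewrite -(@integral_setD1 R h c setT)//; last exact: measurable_funTS.
by apply: eq_integral => x; rewrite inE /= => -[_ /eqP xc]; exact: fh.
Qed.

(** The integral starts at minus infinity; the integrand [occ] used later vanishes at negative
    times. The value may be infinite, so no integrability of [g] has to be carried along. *)
Definition cumul (v : R) : \bar R := (\int[mu]_u (if (u < v)%R then g u else 0%R)%:E)%E.

Lemma cumul_ge0 v : (0 <= cumul v)%E.
Proof. by apply: integral_ge0 => u _; rewrite lee_fin; case: ifP. Qed.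

Let mcut : measurable_fun setT (fun p : R * R => (if (p.2 < p.1)%R then g p.2 else 0%R)%:E : \bar R).
Proof.
apply/measurable_EFinP; apply: measurable_fun_ifT => //.
  exact: measurable_fun_ltr.
exact: measurableT_comp.
Qed.

Lemma measurable_cumul : measurable_fun setT cumul.
Proof.
apply: (@measurable_integral_planer R (fun v u => (if u < v then g u else 0)%:E)) => //.
by move=> x y; rewrite lee_fin; case: ifP.
Qed.

Lemma cumul_split w v : w < v ->
  (cumul v = cumul w + \int[mu]_u (if (w < u < v)%R then g u else 0%R)%:E)%E.
Proof.
move=> wv; rewrite /cumul -ge0_integralD//; last 4 first.
- by move=> u _; rewrite lee_fin; case: ifP.
- apply/measurable_EFinP; apply: measurable_fun_ifT => //.
  exact: measurable_fun_ltr.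
- by move=> u _; rewrite lee_fin; case: ifP.
- apply/measurable_EFinP; apply: measurable_fun_ifT => //.
  by apply: measurable_and; exact: measurable_fun_ltr.
apply: (@eq_integral_off w).
- by apply/measurable_EFinP; apply: measurable_fun_ifT => //;
    exact: measurable_fun_ltr.
- apply: emeasurable_funD; apply/measurable_EFinP; apply: measurable_fun_ifT => //.
    exact: measurable_fun_ltr.
  by apply: measurable_and; exact: measurable_fun_ltr.
- move=> u uw; rewrite -EFinD; congr EFin.
  case: (ltgtP u w) uw => //= [uw|wu] _; first by rewrite (lt_trans uw wv) addr0.
  by rewrite add0r.
Qed.

(** The chain rule for the power m + 1 of the cumulative integral, proved by Tonelli instead of
    differentiation, so that it also holds for infinite values. *)
Lemma cumul_expe m v :
  (cumul v ^+ m.+1 = (m.+1%:R)%:E *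
    \int[mu]_u ((if (u < v)%R then g u else 0%R)%:E * cumul u ^+ m))%E.
Proof.
have h0 u v' : (0 <= (if (u < v')%R then g u else 0%R)%:E :> \bar R)%E.
  by rewrite lee_fin; case: ifP.
have mh v' : measurable_fun setT (fun u : R => (if (u < v')%R then g u else 0%R)%:E : \bar R).
  apply/measurable_EFinP; apply: measurable_fun_ifT => //.
  exact: measurable_fun_ltr.
elim: m v => [|m IH] v.
  by rewrite mul1e [LHS](_ : _ = cumul v)//; apply: eq_integral => u _; rewrite expe0 mule1.
have mI v' n : measurable_fun setT
    (fun u : R => (if (u < v')%R then g u else 0%R)%:E * cumul u ^+ n)%E.
  by apply: emeasurable_funM => //; apply: measurable_expe; exact: measurable_cumul.
have I0 v' n u : (0 <= (if (u < v')%R then g u else 0%R)%:E * cumul u ^+ n)%E.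
  by rewrite mule_ge0// expe_ge0// cumul_ge0.
set I1 := (\int[mu]_u ((if (u < v)%R then g u else 0%R)%:E * cumul u ^+ m.+1))%E.
set J := (\int[mu]_w ((if (w < v)%R then g w else 0%R)%:E * cumul w ^+ m *
    (\int[mu]_u (if (w < u < v)%R then g u else 0%R)%:E)))%E.
(* Expanding the power inside [I1] by the induction hypothesis and exchanging the two integrals
   leaves, for each [w], the mass of [g] between [w] and [v]. *)
have I1E : I1 = (m.+1%:R%:E * J)%E.
  rewrite /I1 /J.
  under eq_integral do rewrite IH muleCA.
  rewrite ge0_integralZl//; last 2 first.
  - apply: emeasurable_funM; first exact: mh.
    apply: (@measurable_integral_planer R
      (fun u w => (if (w < u)%R then g w else 0%R)%:E * cumul w ^+ m)%E) => //.
    apply: emeasurable_funM; first exact: mcut.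
    apply: measurable_expe; apply: measurableT_comp => //.
    exact: measurable_cumul.
  - by move=> u _; rewrite mule_ge0// integral_ge0.
  congr (_ * _)%E.
  transitivity (\int[mu]_u \int[mu]_w ((if (u < v)%R then g u else 0%R)%:E *
    ((if (w < u)%R then g w else 0%R)%:E * cumul w ^+ m)))%E.
    apply: eq_integral => u _; rewrite ge0_integralZl//; exact: mI.
  rewrite (@tonelli_plane R (fun u w => (if (u < v)%R then g u else 0%R)%:E *
    ((if (w < u)%R then g w else 0%R)%:E * cumul w ^+ m))%E); last 2 first.
  - apply: emeasurable_funM; first exact: (measurableT_comp (mh v)).
    apply: emeasurable_funM; first exact: mcut.
    by apply: measurable_expe; exact: (measurableT_comp measurable_cumul).
  - by move=> x y; rewrite mule_ge0.
  apply: eq_integral => w _.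
  rewrite -ge0_integralZl//; last 2 first.
  - apply/measurable_EFinP; apply: measurable_fun_ifT => //.
    by apply: measurable_and; exact: measurable_fun_ltr.
  - by move=> x _; rewrite lee_fin; case: ifP.
  apply: eq_integral => u _.
  case: (ltP u v) => uv; case: (ltP w u) => wu; rewrite /= ?(mul0e, mule0)//.
  by rewrite (lt_trans wu uv) muleC.
(* One factor [cumul v] is split at [w] into [cumul w], which gives [I1], and the mass between [w]
   and [v], which gives [J]. With [I1E] the total is (m + 1) I1 + I1. *)
have -> : (cumul v ^+ m.+2 = m.+1%:R%:E * (I1 + J))%E.
  rewrite expeS IH muleCA; congr (_ * _)%E.
  have C0 := cumul_ge0 v.
  rewrite -ge0_integralZl//; last exact: mI.
  have E1 w : (0 <= \int[mu]_u (if (w < u < v)%R then g u else 0%R)%:E)%E.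
    by apply: integral_ge0 => u _; rewrite lee_fin; case: ifP.
  rewrite /I1 /J -ge0_integralD//; last 3 first.
  - exact: mI.
  - by move=> w _; rewrite mule_ge0.
  - apply: emeasurable_funM; first exact: mI.
    apply: (@measurable_integral_planer R
      (fun w u => (if (w < u < v)%R then g u else 0%R)%:E)) => //.
      apply/measurable_EFinP; apply: measurable_fun_ifT => //.
        by apply: measurable_and; apply: measurable_fun_ltr => //; exact: measurableT_comp.
      exact: measurableT_comp.
    by move=> x y; rewrite lee_fin; case: ifP.
  apply: eq_integral => w _.
  case: ifPn => wv; last by rewrite !mul0e mule0 adde0.
  rewrite (cumul_split wv) ge0_muleDl ?cumul_ge0//.
  by rewrite expeS muleCA [in X in (_ + X)%E]muleC.
transitivity (m.+2%:R%:E * I1)%E; last by [].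
have -> : (m.+2%:R%:E * I1 = m.+1%:R%:E * I1 + I1)%E.
  by rewrite -natr1 EFinD ge0_muleDl ?lee_fin// mul1e.
rewrite ge0_muleDr; last 2 first.
- by rewrite /I1 integral_ge0.
- rewrite /J integral_ge0// => w _; rewrite mule_ge0//.
  by apply: integral_ge0 => u _; rewrite lee_fin; case: ifP.
by rewrite -I1E.
Qed.

End CumulativeIntegral.

(** * The Gaussian transition density *)

Section GaussKernel.
Context (R : realType).
Local Notation mu := (@lebesgue_measure R).

(* The transition density of x + e B; it vanishes for r <= 0, so that the
   convolutions in time below run over the whole line. *)
Definition gaussk (e r w : R) : R :=
  if 0 < r then
    (e ^+ 2 * r * pi *+ 2) `^ (- 2^-1) * expR (- w ^+ 2 * r `^ (-1) / (e ^+ 2 *+ 2))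
  else 0.

Lemma gaussk_ge0 e r w : 0 <= gaussk e r w.
Proof. by rewrite /gaussk; case: ifP => // _; rewrite mulr_ge0 ?powR_ge0 ?expR_ge0. Qed.

Lemma measurable_gaussk d (T : measurableType d) e (f g : T -> R) :
  measurable_fun setT f -> measurable_fun setT g ->
  measurable_fun setT (fun p => gaussk e (f p) (g p)).
Proof.
move=> mf mg; apply: measurable_fun_ifT => //; first exact: measurable_fun_ltr.
apply: measurable_funM.
  apply: (measurableT_comp (measurable_powR _)).
  apply: (measurableT_comp (natmul_measurable _)).
  by apply: measurable_funM => //; exact: measurable_funM.
apply: (measurableT_comp (@measurable_expR R)).
apply: measurable_funM => //; apply: measurable_funM.
  by apply: measurable_funN; exact: measurable_funX.
exact: (measurableT_comp (measurable_powR _)).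
Qed.

Lemma gaussk_normal e r w : 0 < e -> 0 < r ->
  gaussk e r w = normal_pdf 0 (e * Num.sqrt r) w.
Proof.
move=> e0 r0; have er : 0 < e * Num.sqrt r by rewrite mulr_gt0// sqrtr_gt0.
rewrite normal_pdfE ?gt_eqF// /gaussk r0 /normal_peak /normal_fun subr0.
rewrite exprMn sqr_sqrtr ?ltW// powRN powR12_sqrt; last first.
  by rewrite mulrn_wge0// !mulr_ge0 ?pi_ge0 ?ltW// exprn_gt0.
congr (_ * expR _); rewrite powR_inv1 ?ltW//.
by rewrite -mulr_natr; field; rewrite ?gt_eqF.
Qed.

Lemma gaussk_scale e r (w : R) : 0 < e -> 0 < r ->
  gaussk e r (e * w) = e^-1 * normal_pdf 0 (Num.sqrt r) w.
Proof.
move=> e0 r0; rewrite gaussk_normal// !normal_pdfE ?gt_eqF ?mulr_gt0 ?sqrtr_gt0//.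
rewrite /normal_peak /normal_fun !subr0 mulrA; congr (_ * expR _).
  rewrite exprMn -mulrA -mulrnAr sqrtrM ?exprn_ge0 ?ltW// sqrtr_sqr gtr0_norm//.
  by rewrite invfM.
by field; rewrite !gt_eqF ?sqrtr_gt0.
Qed.

End GaussKernel.

Section Markov.
Context d (Omega : measurableType d) (R : realType) (P : probability Omega R).
Variables (B : R -> {RV P >-> R}) (hB : wiener_process P B).
Local Notation mu := (@lebesgue_measure R).
Variables (x e : R) (e0 : 0 < e).

(** Built on [wpath], so it starts at [x] everywhere and is continuous on the whole time line; it
    agrees almost surely with [x + e * B u w] at times u >= 0. *)
Definition wpos (u : R) (w : Omega) : R := x + e * wpath B u w.

Lemma measurable_wpos u : measurable_fun setT (wpos u).
Proof.
by apply: measurable_funD => //; apply: measurable_funM => //; exact: measurable_wpath.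
Qed.

Lemma measurable_wpath_past v u : u <= v ->
  measurable_fun (setT : set (g_sigma_algebraType (past B v))) (wpath B u).
Proof.
move=> uv _ A mA; rewrite setTI; apply: sub_sigma_algebra.
exists 1%N, (fun=> u), (fun=> A); split => //.
by apply/seteqP; split => w /= h; [move=> i _|exact: (h 0%N)].
Qed.

Lemma measurable_wpos_past v u : u <= v ->
  measurable_fun (setT : set (g_sigma_algebraType (past B v))) (wpos u).
Proof.
move=> uv; apply: measurable_funD => //; apply: measurable_funM => //.
exact: measurable_wpath_past.
Qed.

Lemma sub_past v C : <<s past B v >> C -> measurable C.
Proof.
apply: smallest_sub; first exact: sigma_algebra_measurable.
move=> _ [n [u [A [_ mA ->]]]]; apply: bigcap_measurableType => // i _.
by rewrite -[X in measurable X]setTI; exact: measurable_wpath.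
Qed.

(** The joint law of the past and the next increment is a product, by independence; Tonelli
    integrates the increment out first. *)
Lemma markov_noise v s (H : g_sigma_algebraType (past B v) * measurableTypeR R -> \bar R) :
  0 <= v -> v < s -> measurable_fun setT H -> (forall p, 0 <= H p)%E ->
  (\int[P]_w H (w, wpath B s w - wpath B v w)%R =
   \int[P]_w \int[mu]_z (H (w, z) * (normal_pdf 0 (Num.sqrt (s - v)) z)%:E))%E.
Proof.
move=> v0 vs mH H0.
pose F : measurableType _ := g_sigma_algebraType (past B v).
pose Y w := wpath B s w - wpath B v w.
have mY : measurable_fun setT Y by apply: measurable_funB; exact: measurable_wpath.
have mid : measurable_fun setT (id : Omega -> F).
  by move=> _ A mA; rewrite setTI; exact: (@sub_past v).
(* The identity into the coarser sigma-algebra: its distribution is the restriction of [P] to the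
   past. *)
pose idF : {mfun Omega >-> F} := HB.pack (id : Omega -> F) (isMeasurableFun.Build _ _ _ _ _ mid).
have mpr : measurable_fun setT ((fun w => (w, Y w)) : Omega -> F * measurableTypeR R).
  exact: measurable_fun_pair.
pose pr : {mfun Omega >-> (F * measurableTypeR R)%type} :=
  HB.pack ((fun w => (w, Y w)) : Omega -> F * measurableTypeR R)
  (isMeasurableFun.Build _ _ _ _ _ mpr).
pose N := normal_prob (0 : R) (Num.sqrt (s - v)).
(* A product measure is determined by its values on rectangles, where the equality is
   [past_independent]. *)
have QE A : measurable A -> ((distribution P idF) \x N)%E A = distribution P pr A.
  apply: product_measure_unique => C D mC mD.
  rewrite /distribution/= /pushforward/=.
  have := @past_independent _ _ _ _ _ hB v s C D v0 (ltW vs) mD mC.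
  have s0 : 0 <= s := le_trans v0 (ltW vs).
  rewrite (_ : (fun w => wpath B s w - wpath B v w) @^-1` D =
    (fun w => B s w - B v w) @^-1` D); last first.
    by apply/seteqP; split => w /=; rewrite wpathB.
  rewrite (wiener_gauss hB v0 vs mD) => <-; congr (P _).
  by apply/seteqP; split => w /=; rewrite /Y wpathB.
have := @ge0_integral_distribution _ _ Omega _ R P pr H mH H0.
rewrite /comp /= => <-.
transitivity (\int[((distribution P idF) \x N)%E]_p H p)%E.
  by apply: eq_measure_integral => A mA _; exact/esym/QE.
rewrite fubini_tonelli1//.
rewrite ge0_integral_distribution//=; last 2 first.
- by apply: measurable_fun_fubini_tonelli_F.
- by move=> w; apply: integral_ge0.
apply: eq_integral => w _; rewrite /fubini_F/=.
apply: (@ge0_integral_density _ (measurableTypeR R) R N mu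
  (normal_pdf 0 (Num.sqrt (s - v))) (measurable_normal_pdf _ _)
  (normal_pdf_ge0 _ _)) => //.
exact: measurableT_comp.
Qed.

(** Testing against past-measurable [G] replaces conditional expectations. The new position is the
    old one plus [e] times an independent Gaussian increment, and an affine substitution turns the
    law of that increment into [gaussk]. *)
Lemma markov v s (G : Omega -> \bar R) (h : R -> \bar R) : 0 <= v -> v < s ->
  measurable_fun (setT : set (g_sigma_algebraType (past B v))) G ->
  (forall w, 0 <= G w)%E -> measurable_fun setT h -> (forall z, 0 <= h z)%E ->
  (\int[P]_w (G w * h (wpos s w)) =
   \int[P]_w (G w * \int[mu]_z (h z * (gaussk e (s - v) (z - wpos v w))%:E)))%E.
Proof.
move=> v0 vs mG G0 mh h0.
pose H (p : g_sigma_algebraType (past B v) * measurableTypeR R) : \bar R :=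
  (G p.1 * h (wpos v p.1 + e * p.2)%R)%E.
have mh' : measurable_fun setT (h : measurableTypeR R -> \bar R) by [].
have mH : measurable_fun setT H.
  apply: emeasurable_funM; first exact: measurableT_comp.
  apply: (measurableT_comp mh).
  apply: measurable_funD; first by apply: (measurableT_comp (measurable_wpos_past (lexx v))).
  by apply: measurable_funM.
have H0 p : (0 <= H p)%E by rewrite mule_ge0.
have := markov_noise v0 vs mH H0; rewrite /H /=.
transitivity (\int[P]_w (G w * h (wpos v w + e * (wpath B s w - wpath B v w))%R))%E.
  by apply: eq_integral => w _; congr (_ * h _)%E; rewrite /wpos; ring.
rewrite H1.
apply: eq_integral => w _.
have vs0 : 0 < s - v by rewrite subr_gt0.
have m1 : measurable_fun setT (fun z : R => h z * (gaussk e (s - v) (z - wpos v w))%:E)%E.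
  apply: emeasurable_funM => //; apply/measurable_EFinP.
  by apply: measurable_gaussk => //; exact: measurable_funB.
have k0 z : (0 <= h z * (gaussk e (s - v) (z - wpos v w))%:E)%E.
  by rewrite mule_ge0// lee_fin gaussk_ge0.
(* Substitution z = X_v + e y; its Jacobian cancels the factor [e^-1] of [gaussk_scale]. *)
have := @integral_affine R _ (wpos v w) e e0 m1 k0.
set I := (\int[mu]_z (h z * _))%E => IE.
have -> : I = (e%:E * (e^-1%:E * I))%E by rewrite muleA -EFinM divff ?gt_eqF// mul1e.
have m2 : measurable_fun setT (fun z : measurableTypeR R =>
    (h (wpos v w + e * z)%R * (gaussk e (s - v) (wpos v w + e * z - wpos v w)%R)%:E)%E).
  have ms : measurable_fun setT (fun z : R => wpos v w + e * z).
    by apply: measurable_funD => //; exact: measurable_funM.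
  exact: (measurableT_comp m1 ms).
have ee0 : (0 <= e%:E)%E by rewrite lee_fin ltW.
rewrite -IE -[in RHS]ge0_integralZl//.
rewrite -[in RHS]ge0_integralZl//; last 2 first.
- by apply: emeasurable_funM.
- by move=> z _; rewrite mule_ge0// k0.
apply: eq_integral => z _.
rewrite -muleA; congr (_ * _)%E.
rewrite muleCA; congr (_ * _)%E.
rewrite addrAC subrr add0r gaussk_scale// -EFinM mulrA divff ?gt_eqF//.
by rewrite mul1r.
Qed.

Lemma wpos_law s (h : R -> \bar R) : 0 < s ->
  measurable_fun setT h -> (forall z, 0 <= h z)%E ->
  (\int[P]_w (h (wpos s w)) = \int[mu]_z (h z * (gaussk e s (z - x))%:E))%E.
Proof.
move=> s0 mh h0.
have := @markov 0 s (cst 1%E) h (lexx 0) s0 _ _ mh h0.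
under eq_integral do rewrite mul1e.
move=> ->//.
under eq_integral do rewrite mul1e /wpos wpath0 mulr0 addr0 subr0.
rewrite integral_cst// -[RHS]mule1; congr (_ * _)%E.
exact: probability_setT.
Qed.

End Markov.

(** * Moments of additive functionals *)

Section AdditiveFunctional.
Context d (Omega : measurableType d) (R : realType) (P : probability Omega R).
Variables (B : R -> {RV P >-> R}) (hB : wiener_process P B).
Local Notation mu := (@lebesgue_measure R).
Variables (x e : R) (e0 : 0 < e).
Variables (k : R -> R) (mk : measurable_fun setT k) (k0 : forall z, 0 <= k z).

Local Notation X := (wpos B x e).

(* addf v w is the functional \int_0^v k(x + e (B_u - B_0)) du, in [0, +oo];
   rho m v is its weighted moment E[k(X_v) (addf v)^m], from which moment_addf
   recovers E[(addf t)^(m+1)]. *)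
Definition occ (u : R) (w : Omega) : R := if 0 <= u then k (X u w) else 0.

Definition addf (v : R) (w : Omega) : \bar R := cumul (occ ^~ w) v.

Definition rho (m : nat) (v : R) : \bar R :=
  (\int[P]_w ((occ v w)%:E * addf v w ^+ m))%E.

(** The transition semigroup applied to [k]. Since [gaussk] vanishes at nonpositive times,
    [trans (v - u)] itself cuts off the times u >= v. *)
Definition trans (r y : R) : \bar R :=
  (\int[mu]_z ((k z)%:E * (gaussk e r (z - y))%:E))%E.

Lemma occ_ge0 u w : 0 <= occ u w.
Proof. by rewrite /occ; case: ifP. Qed.

Lemma addf_ge0 v w : (0 <= addf v w)%E.
Proof. by apply: cumul_ge0 => u; exact: occ_ge0. Qed.

Lemma wpos_max u w : X (Num.max u 0) w = X u w.
Proof. by rewrite /wpos wpath_max. Qed.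

Lemma measurable_wpos_joint : measurable_fun setT (fun p : R * Omega => X p.1 p.2).
Proof.
rewrite [X in measurable_fun _ X](_ : _ = (fun p : R * Omega => X (Num.max p.1 0) p.2)).
  apply: measurable_continuous_process.
    by move=> u; exact: measurable_wpos.
  move=> w u; apply: cvgD; first exact: cvg_cst.
  by apply: cvgM; [exact: cvg_cst|exact: (continuous_wpath hB)].
by apply/funext => p; rewrite wpos_max.
Qed.

Lemma measurable_occ : measurable_fun setT (fun p : R * Omega => occ p.1 p.2).
Proof.
apply: measurable_fun_ifT => //; first exact: measurable_fun_ler.
exact: (measurableT_comp mk measurable_wpos_joint).
Qed.

(** Progressive measurability: clamping the time at [v] makes the process measurable for the past of
    [v] at all times without changing it before [v]. *)
Lemma measurable_occ_past v : measurable_fun setT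
  (fun p : R * g_sigma_algebraType (past B v) => if p.1 < v then occ p.1 p.2 else 0).
Proof.
have mX : measurable_fun setT (fun p : R * g_sigma_algebraType (past B v) =>
    X (Num.min (Num.max p.1 0) v) p.2).
  apply: (@measurable_continuous_process _ (g_sigma_algebraType (past B v)) R
    (fun u w => X (Num.min u v) w)).
    by move=> u; apply: measurable_wpos_past; rewrite ge_min lexx orbT.
  move=> w u; apply: cvgD; first exact: cvg_cst.
  apply: cvgM; first exact: cvg_cst.
  have mc : Num.min u' v @[u' --> u] --> Num.min u v.
    rewrite minr_absE; under eq_fun do rewrite minr_absE.
    apply: cvgM; last exact: cvg_cst.
    apply: cvgB; first by apply: cvgD; [exact: cvg_id|exact: cvg_cst].
    by apply: cvg_norm; apply: cvgB; [exact: cvg_id|exact: cvg_cst].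
  exact: (@cvg_comp _ _ _ _ _ _ _ _ mc (continuous_wpath hB (w:=w) (x := Num.min u v))).
rewrite [X in measurable_fun _ X](_ : _ = (fun p : R * g_sigma_algebraType (past B v) =>
    if p.1 < v then (if 0 <= p.1 then k (X (Num.min (Num.max p.1 0) v) p.2) else 0) else 0)).
  apply: measurable_fun_ifT => //; first exact: measurable_fun_ltr.
  apply: measurable_fun_ifT => //; first exact: measurable_fun_ler.
  exact: (measurableT_comp mk mX).
apply/funext => -[u w] /=; case: ifPn => // uv; rewrite /occ; case: ifPn => // u0.
by rewrite max_l// min_l// ltW.
Qed.

(** Adaptedness allows powers of [addf v] as test variables in [markov]. *)
Lemma measurable_addf_past v :
  measurable_fun (setT : set (g_sigma_algebraType (past B v))) (addf v).
Proof.
apply: (@measurable_integral_lebesgue _ (g_sigma_algebraType (past B v)) R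
  (fun u w => (if u < v then occ u w else 0)%:E)).
  apply/measurable_EFinP; exact: measurable_occ_past.
by move=> u w; rewrite lee_fin; case: ifP => // _; exact: occ_ge0.
Qed.

Lemma measurable_addf : measurable_fun setT (fun p : R * Omega => addf p.1 p.2).
Proof.
apply: (@measurable_integral_lebesgue _ (R * Omega)%type R
  (fun u p => (if u < p.1 then occ u p.2 else 0)%:E)).
  apply/measurable_EFinP; apply: measurable_fun_ifT => //.
    by apply: measurable_fun_ltr => //; exact: measurableT_comp.
  have mp : measurable_fun setT (fun q : R * (R * Omega) => (q.1, q.2.2)).
    by apply: measurable_fun_pair => //; exact: measurableT_comp.
  exact: (measurableT_comp measurable_occ mp).
by move=> u p; rewrite lee_fin; case: ifP => // _; exact: occ_ge0.
Qed.

Lemma measurable_addfE v : measurable_fun setT (addf v).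
Proof.
have mp : measurable_fun setT (fun w : Omega => (v, w)) by exact: measurable_fun_pair.
exact: (measurableT_comp measurable_addf mp).
Qed.

Lemma measurable_trans : measurable_fun setT (fun p : R * R => trans p.1 p.2).
Proof.
apply: (@measurable_integral_lebesgue _ (R * R)%type R
  (fun z p => (k z)%:E * (gaussk e p.1 (z - p.2))%:E)%E).
  apply: emeasurable_funM; apply/measurable_EFinP.
    exact: (measurableT_comp mk).
  apply: measurable_gaussk; first exact: measurableT_comp.
  by apply: measurable_funB => //; exact: measurableT_comp.
by move=> u p; rewrite mule_ge0// lee_fin// gaussk_ge0.
Qed.

Lemma trans_ge0 r y : (0 <= trans r y)%E.
Proof. by apply: integral_ge0 => z _; rewrite mule_ge0// lee_fin// gaussk_ge0. Qed.

Lemma trans_le0 r y : r <= 0 -> trans r y = 0%E.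
Proof.
move=> r0; rewrite /trans integral0_eq// => z _.
by rewrite /gaussk ltNge r0 mule0.
Qed.

Lemma measurable_occE u : measurable_fun setT (occ u).
Proof.
have mp : measurable_fun setT (fun w : Omega => (u, w)) by exact: measurable_fun_pair.
exact: (measurableT_comp measurable_occ mp).
Qed.

Lemma rho_ge0 m v : (0 <= rho m v)%E.
Proof.
by apply: integral_ge0 => w _; rewrite mule_ge0 ?lee_fin ?occ_ge0// expe_ge0// addf_ge0.
Qed.

Let m_oa m : measurable_fun setT (fun p : R * Omega => (occ p.1 p.2)%:E * addf p.1 p.2 ^+ m)%E.
Proof.
apply: emeasurable_funM; first by apply/measurable_EFinP; exact: measurable_occ.
by apply: measurable_expe; exact: measurable_addf.
Qed.

Let oa_ge0 m u w : (0 <= (occ u w)%:E * addf u w ^+ m)%E.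
Proof. by rewrite mule_ge0 ?lee_fin ?occ_ge0// expe_ge0// addf_ge0. Qed.

Lemma measurable_rho m : measurable_fun setT (rho m).
Proof.
exact: (@measurable_integral_time _ Omega R P
  (fun u w => (occ u w)%:E * addf u w ^+ m)%E).
Qed.

(** [cumul_expe] along each path, then Tonelli; [u] is the latest of the m + 1 times. *)
Lemma moment_addf t m : (\int[P]_w (addf t w ^+ m.+1) =
  m.+1%:R%:E * \int[mu]_u (if (u < t)%R then rho m u else 0))%E.
Proof.
pose f u w := ((if u < t then occ u w else 0)%:E * addf u w ^+ m)%E.
have f0 u w : (0 <= f u w)%E.
  by rewrite /f; case: ifP => _; rewrite ?mul0e.
have mf : measurable_fun setT (fun p : R * Omega => f p.1 p.2).
  rewrite [X in measurable_fun _ X](_ : _ = (fun p : R * Omega =>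
    if (p.1 < t)%R then (occ p.1 p.2)%:E * addf p.1 p.2 ^+ m else 0)%E).
    by apply: measurable_fun_ifT => //; exact: measurable_fun_ltr.
  by apply/funext => p; rewrite /f; case: ifP; rewrite ?mul0e.
transitivity (\int[P]_w (m.+1%:R%:E * \int[mu]_u f u w))%E.
  apply: eq_integral => w _; apply: cumul_expe; last by move=> u; exact: occ_ge0.
  have mp : measurable_fun setT (fun u : R => (u, w)) by exact: measurable_fun_pair.
  exact: (measurableT_comp measurable_occ mp).
rewrite ge0_integralZl//; last 2 first.
- exact: measurable_integral_lebesgue.
- by move=> w _; exact: integral_ge0.
congr (_ * _)%E; rewrite -tonelli_lebesgue//; apply: eq_integral => u _.
by rewrite /f; case: ifP => // _; under eq_integral do rewrite mul0e; rewrite integral0.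
Qed.

(** It fails at v = 0, where the position is [x] exactly while [trans 0 x] is 0. *)
Lemma rho0E v : 0 < v -> rho 0 v = trans v x.
Proof.
move=> v0; have mEk : measurable_fun setT (EFin \o k) by exact/measurable_EFinP.
rewrite /rho; under eq_integral do rewrite expe0 mule1 /occ ltW//.
have := @wpos_law _ _ _ _ _ hB x e e0 v (EFin \o k) v0 mEk.
apply => z; exact: k0.
Qed.

(** The power of [addf v] is opened by [cumul_expe], with [u] the latest time before [v]; the Markov
    property at [u] then replaces [k (X v)] by its conditional mean. This is a convolution in
    time. *)
Lemma rhoSE m v : (rho m.+1 v = m.+1%:R%:E *
  \int[mu]_u \int[P]_w ((occ u w)%:E * addf u w ^+ m * trans (v - u) (X u w)))%E.
Proof.
have mEk : measurable_fun setT (EFin \o k) by exact/measurable_EFinP.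
pose f u w := ((if u < v then occ u w else 0)%:E * addf u w ^+ m)%E.
have f0 u w : (0 <= f u w)%E.
  by rewrite /f; case: ifP => _; rewrite ?mul0e.
have mf : measurable_fun setT (fun p : R * Omega => f p.1 p.2).
  rewrite [X in measurable_fun _ X](_ : _ = (fun p : R * Omega =>
    if (p.1 < v)%R then (occ p.1 p.2)%:E * addf p.1 p.2 ^+ m else 0)%E).
    by apply: measurable_fun_ifT => //; exact: measurable_fun_ltr.
  by apply/funext => p; rewrite /f; case: ifP; rewrite ?mul0e.
have mfw w : measurable_fun setT (fun u => f u w).
  have mp : measurable_fun setT (fun u : R => (u, w)) by exact: measurable_fun_pair.
  exact: (measurableT_comp mf mp).
have ov0 w : (0 <= (occ v w)%:E)%E by rewrite lee_fin occ_ge0.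
transitivity (\int[P]_w (m.+1%:R%:E * \int[mu]_u ((occ v w)%:E * f u w)))%E.
  apply: eq_integral => w _; rewrite ge0_integralZl//; last exact: mfw.
  rewrite muleCA; congr (_ * _)%E.
  apply: cumul_expe; last by move=> u; exact: occ_ge0.
  have mp : measurable_fun setT (fun u : R => (u, w)) by exact: measurable_fun_pair.
  exact: (measurableT_comp measurable_occ mp).
have mg : measurable_fun setT (fun p : R * Omega => (occ v p.2)%:E * f p.1 p.2)%E.
  apply: emeasurable_funM => //; apply/measurable_EFinP.
  exact: (measurableT_comp (measurable_occE v)).
have g0 u w : (0 <= (occ v w)%:E * f u w)%E by rewrite mule_ge0.
rewrite ge0_integralZl//; last 2 first.
- exact: (@measurable_integral_lebesgue _ Omega R (fun u w => (occ v w)%:E * f u w)%E mg g0).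
- by move=> w _; exact: integral_ge0.
congr (_ * _)%E.
rewrite -(@tonelli_lebesgue _ Omega R P (fun u w => (occ v w)%:E * f u w)%E mg g0).
apply: eq_integral => u _; rewrite /f.
(* For u >= v the left side is cut by the indicator and the right side by [trans_le0]. *)
case: (ltP u v) => uv; last first.
  under eq_integral do rewrite mul0e mule0.
  under [RHS]eq_integral do rewrite trans_le0 ?subr_le0// mule0.
  by [].
have [u0|u0] := leP 0 u; last first.
  have ou w : occ u w = 0 by rewrite /occ leNgt u0.
  under eq_integral do rewrite ou mul0e mule0.
  by under [RHS]eq_integral do rewrite ou mul0e mul0e.
under eq_integral => w _ do rewrite /occ (le_trans u0 (ltW uv)) -/(occ u w) muleC.
have mG : measurable_fun (setT : set (g_sigma_algebraType (past B u)))
    (fun w => (occ u w)%:E * addf u w ^+ m)%E.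
  apply: emeasurable_funM; last by apply: measurable_expe; exact: measurable_addf_past.
  apply/measurable_EFinP; rewrite /occ u0.
  by apply: (measurableT_comp mk); exact: measurable_wpos_past.
have := @markov _ _ _ _ _ hB x e e0 u v _ (EFin \o k) u0 uv mG (oa_ge0 m u) mEk.
apply => z; exact: k0.
Qed.

End AdditiveFunctional.

(** * Recursive moment bounds *)

Section MomentBounds.
Context d (Omega : measurableType d) (R : realType) (P : probability Omega R).
Variables (B : R -> {RV P >-> R}) (hB : wiener_process P B).
Local Notation mu := (@lebesgue_measure R).
Variables (x e : R) (e0 : 0 < e).
Variables (k : R -> R) (mk : measurable_fun setT k) (k0 : forall z, 0 <= k z).

Local Notation X := (wpos B x e).
Local Notation occ := (occ B x e k).
Local Notation addf := (addf B x e k).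
Local Notation rho := (rho B x e k).
Local Notation trans := (trans e k).

Section Upper.
Variables (l q : R).
Hypothesis l0 : 0 <= l.

Definition green (y : R) : \bar R := (\int[mu]_r ((expR (- (l * r)))%:E * trans r y))%E.

Lemma measurable_green_integrand (v y : R) :
  measurable_fun setT (fun r : R => (expR (- (l * r)))%:E * trans (r - v) y)%E.
Proof.
apply: emeasurable_funM.
  apply/measurable_EFinP; apply: (measurableT_comp (@measurable_expR R)).
  by apply: measurable_funN; exact: measurable_funM.
have mp : measurable_fun setT (fun r : R => (r - v, y)).
  by apply: measurable_fun_pair => //; exact: measurable_funB.
exact: (measurableT_comp (@measurable_trans R e k mk k0) mp).
Qed.

Lemma green_shift v y : (\int[mu]_r ((expR (- (l * r)))%:E * trans (r - v) y) =
  (expR (- (l * v)))%:E * green y)%E.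
Proof.
have m0 : measurable_fun setT (fun r : R => (expR (- (l * r)))%:E * trans r y)%E.
  rewrite [X in measurable_fun _ X](_ : _ =
    (fun r : R => (expR (- (l * r)))%:E * trans (r - 0)%R y)%E).
    exact: measurable_green_integrand.
  by apply/funext => r; rewrite subr0.
have p0 (r : R) : (0 <= (expR (- (l * r)))%:E * trans r y)%E.
  by rewrite mule_ge0 ?lee_fin ?expR_ge0// trans_ge0.
rewrite -(integral_shift v (measurable_green_integrand v y)); last first.
  by move=> r; rewrite mule_ge0 ?lee_fin ?expR_ge0// trans_ge0.
rewrite /green -lebesgue_integralZl//.
apply: eq_integral => r _; rewrite addrK muleA -EFinM -expRD.
by congr ((expR _)%:E * _)%E; ring.
Qed.

Hypothesis green_le : forall y, (green y <= q%:E)%E.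

Let lap m : \bar R := (\int[mu]_v ((expR (- (l * v)))%:E * rho m v))%E.

Let mexp : measurable_fun setT (fun v : R => (expR (- (l * v)))%:E : \bar R).
Proof.
apply/measurable_EFinP; apply: (measurableT_comp (@measurable_expR R)).
by apply: measurable_funN; exact: measurable_funM.
Qed.

Let lap0 : lap 0 = green x.
Proof.
apply: (@eq_integral_off _ 0).
- by apply: emeasurable_funM => //; exact: measurable_rho.
- rewrite [X in measurable_fun _ X](_ : _ =
    (fun r : R => (expR (- (l * r)))%:E * trans (r - 0)%R x)%E).
    exact: measurable_green_integrand.
  by apply/funext => r; rewrite subr0.
move=> v; case: (ltgtP v 0) => // v0 _; last by rewrite rho0E.
rewrite trans_le0 ?ltW// /rho.
under eq_integral do rewrite /occ leNgt v0 mul0e.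
by rewrite integral0.
Qed.

(** The Laplace transform in time turns the convolution [rhoSE] into multiplication by the Green
    function at [X u], which is at most [q] wherever the process is. *)
Let lapS m : (lap m.+1 <= m.+1%:R%:E * (q%:E * lap m))%E.
Proof.
pose f v u w := ((expR (- (l * v)))%:E *
  ((occ u w)%:E * addf u w ^+ m * trans (v - u) (X u w)))%E.
have oa0 u w : (0 <= (occ u w)%:E * addf u w ^+ m)%E.
  by rewrite mule_ge0 ?lee_fin ?occ_ge0// expe_ge0// addf_ge0.
have f0 v u w : (0 <= f v u w)%E.
  by rewrite !mule_ge0 ?lee_fin ?expR_ge0 ?occ_ge0 ?expe_ge0 ?addf_ge0 ?trans_ge0.
have m_oa u : measurable_fun setT (fun w => (occ u w)%:E * addf u w ^+ m)%E.
  apply: emeasurable_funM; first by apply/measurable_EFinP; exact: measurable_occE.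
  by apply: measurable_expe; exact: measurable_addfE.
have mf : measurable_fun setT (fun p : R * R * Omega => f p.1.1 p.1.2 p.2).
  have mp : measurable_fun setT (fun p : R * R * Omega => (p.1.2, p.2)).
    by apply: measurable_fun_pair => //; exact: measurableT_comp.
  apply: emeasurable_funM.
    exact: (measurableT_comp mexp (measurableT_comp measurable_fst measurable_fst)).
  apply: emeasurable_funM.
    apply: emeasurable_funM.
      apply/measurable_EFinP.
      exact: (measurableT_comp (measurable_occ hB x e mk) mp).
    apply: measurable_expe.
    exact: (measurableT_comp (measurable_addf hB x e mk k0) mp).
  have mp2 : measurable_fun setT (fun p : R * R * Omega => (p.1.1 - p.1.2, X p.1.2 p.2)).
    apply: measurable_fun_pair; first by apply: measurable_funB; exact: measurableT_comp.
    exact: (measurableT_comp (measurable_wpos_joint hB x e) mp).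
  exact: (measurableT_comp (@measurable_trans R e k mk k0) mp2).
have mfv v : measurable_fun setT (fun p : R * Omega => f v p.1 p.2).
  have mp : measurable_fun setT (fun p : R * Omega => (v, p.1, p.2)).
    by apply: measurable_fun_pair => //; exact: measurable_fun_pair.
  exact: (measurableT_comp mf mp).
have mfvu v u : measurable_fun setT (fun w : Omega => f v u w).
  have mp : measurable_fun setT (fun w : Omega => (u, w)) by exact: measurable_fun_pair.
  exact: (measurableT_comp (mfv v) mp).
have mfu u : measurable_fun setT (fun p : R * Omega => f p.1 u p.2).
  have mp : measurable_fun setT (fun p : R * Omega => (p.1, u, p.2)).
    by apply: measurable_fun_pair => //; exact: measurable_fun_pair.
  exact: (measurableT_comp mf mp).
pose F v u := (\int[P]_w f v u w)%E.
have F0 v u : (0 <= F v u)%E by apply: integral_ge0.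
have mF : measurable_fun setT (fun p : R * R => F p.1 p.2).
  exact: (@measurable_integral_snd _ _ (R * R)%type Omega R P (fun p w => f p.1 p.2 w)).
have mFv v : measurable_fun setT (F v).
  have mp : measurable_fun setT (fun u : R => (v, u)) by exact: measurable_fun_pair.
  exact: (measurableT_comp mF mp).
have lapE : lap m.+1 = (m.+1%:R%:E * \int[mu]_v \int[mu]_u F v u)%E.
  have mFF := @measurable_integral_planer R F mF F0.
  have FF0 v : (0 <= \int[mu]_u F v u)%E by exact: integral_ge0.
  have m0 : (0 <= (m.+1%:R)%:E :> \bar R)%E by rewrite lee_fin.
  rewrite -(lebesgue_integralZl mFF FF0 m0).
  apply: eq_integral => v _; rewrite rhoSE// muleCA; congr (_ * _)%E.
  pose h u w := ((occ u w)%:E * addf u w ^+ m * trans (v - u) (X u w))%E.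
  have h0 u w : (0 <= h u w)%E by rewrite mule_ge0// trans_ge0.
  have mh : measurable_fun setT (fun p : R * Omega => h p.1 p.2).
    have m1 := mfv v.
    have m2 : measurable_fun setT (fun p : R * Omega =>
        (expR (l * v))%:E * f v p.1 p.2)%E by exact: emeasurable_funM.
    rewrite [X in measurable_fun _ X](_ : _ = (fun p : R * Omega =>
        (expR (l * v))%:E * f v p.1 p.2)%E)//.
    by apply/funext => p; rewrite /f [RHS]muleA -EFinM -expRD subrr expR0 mul1e.
  have mhu u : measurable_fun setT (h u).
    have mp : measurable_fun setT (fun w : Omega => (u, w)) by exact: measurable_fun_pair.
    exact: (measurableT_comp mh mp).
  have mH : measurable_fun setT (fun u => \int[P]_w h u w)%E.
    exact: (@measurable_integral_time _ Omega R P h).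
  have H0 u : (0 <= \int[P]_w h u w)%E by apply: integral_ge0 => w _; exact: h0.
  have E0 : (0 <= (expR (- (l * v)))%:E :> \bar R)%E by rewrite lee_fin expR_ge0.
  rewrite -(lebesgue_integralZl mH H0 E0).
  apply: eq_integral => u _; rewrite /F /f ge0_integralZl//.
  - exact: mhu.
  - by move=> w _; exact: h0.
rewrite lapE lee_wpmul2l ?lee_fin//.
rewrite (tonelli_plane mF F0).
have q0 : (0 <= q%:E)%E.
  apply: le_trans (green_le x); apply: integral_ge0 => r _.
  by rewrite mule_ge0 ?lee_fin ?expR_ge0// trans_ge0.
have mrho : measurable_fun setT (fun v => (expR (- (l * v)))%:E * rho m v)%E.
  by apply: emeasurable_funM => //; exact: measurable_rho.
have rho1 v : (0 <= (expR (- (l * v)))%:E * rho m v)%E.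
  by rewrite mule_ge0 ?lee_fin ?expR_ge0// rho_ge0.
rewrite /lap -lebesgue_integralZl//.
apply: le_lebesgue_integral.
- exact: (@measurable_integral_planel R F mF F0).
- exact: emeasurable_funM.
- by move=> u; apply: integral_ge0 => v _; exact: F0.
move=> u; rewrite /F (tonelli_lebesgue P (mfu u))//.
rewrite /rho muleCA -ge0_integralZlT//.
rewrite -ge0_integralZlT//; last 2 first.
- exact: emeasurable_funM.
- by move=> w; rewrite mule_ge0.
apply: ge0_le_integralT.
- exact: (@measurable_integral_lebesgue _ Omega R (fun v w => f v u w)).
- by apply: emeasurable_funM => //; exact: emeasurable_funM.
- by move=> w; apply: integral_ge0 => v _; exact: f0.
move=> w; rewrite /f.
(* Only [trans] depends on [v] besides the exponential; its shifted Laplace transform is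
   [green_shift]. *)
have -> : (\int[mu]_v ((expR (- (l * v)))%:E * ((occ u w)%:E * addf u w ^+ m *
    trans (v - u) (X u w))) =
  (occ u w)%:E * addf u w ^+ m * ((expR (- (l * u)))%:E * green (X u w)))%E.
  rewrite -green_shift -lebesgue_integralZl//.
  - by apply: eq_integral => v _; rewrite muleCA.
  - exact: measurable_green_integrand.
  - by move=> v; rewrite mule_ge0 ?lee_fin ?expR_ge0// trans_ge0.
rewrite muleCA lee_wpmul2l ?lee_fin ?expR_ge0//.
by rewrite muleC lee_wpmul2r.
Qed.

Lemma addf_moment_le t m : (\int[P]_w (addf t w ^+ m.+1) <=
  (m.+1`!%:R * expR (l * t) * q ^+ m)%:E * green x)%E.
Proof.
have q0 : (0 <= q%:E)%E.
  apply: le_trans (green_le x); apply: integral_ge0 => r _.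
  by rewrite mule_ge0 ?lee_fin ?expR_ge0// trans_ge0.
have lapm : (lap m <= (m`!%:R * q ^+ m)%:E * green x)%E.
  elim: m => [|m IH]; first by rewrite lap0 mulr1 mul1e.
  apply: le_trans (lapS m) _; rewrite muleA -EFinM.
  apply: (le_trans (lee_wpmul2l _ IH)); first by rewrite lee_fin mulr_ge0// -lee_fin.
  rewrite muleA -EFinM factS natrM exprS.
  by rewrite (_ : _ * q * (_ * _) = m.+1%:R * m`!%:R * (q * q ^+ m))//; ring.
rewrite (moment_addf hB)// factS natrM.
have rho1 v : (0 <= (expR (- (l * v)))%:E * rho m v)%E.
  by rewrite mule_ge0 ?lee_fin ?expR_ge0// rho_ge0.
(* The indicator of u < t is at most exp (l (t - u)), since l >= 0. *)
have cut : (\int[mu]_u (if (u < t)%R then rho m u else 0) <=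
    (expR (l * t))%:E * lap m)%E.
  rewrite -lebesgue_integralZl//; last first.
    by apply: emeasurable_funM => //; exact: measurable_rho.
  apply: le_lebesgue_integral.
  - apply: measurable_fun_ifT => //; first exact: measurable_fun_ltr.
    exact: measurable_rho.
  - apply: emeasurable_funM => //; apply: emeasurable_funM => //.
    exact: measurable_rho.
  - by move=> u; case: ifP => // _; exact: rho_ge0.
  move=> u; case: ifPn => ut; last by rewrite mule_ge0// lee_fin expR_ge0.
  rewrite muleA -EFinM -expRD -[leLHS]mul1e lee_wpmul2r ?rho_ge0//.
  rewrite lee_fin -expR0 ler_expR -mulrBr mulr_ge0// subr_ge0; exact: ltW.
apply: (@le_trans _ _ (m.+1%:R%:E * ((expR (l * t))%:E *
  ((m`!%:R * q ^+ m)%:E * green x)))%E).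
  rewrite lee_wpmul2l ?lee_fin//; apply: le_trans cut _.
  by rewrite lee_wpmul2l ?lee_fin ?expR_ge0.
rewrite !muleA -!EFinM.
rewrite le_eqVlt; apply/orP; left; apply/eqP; congr (_%:E * _)%E; ring.
Qed.

End Upper.

Section Lower.
Variables (delta N : R).
Hypothesis N0 : 0 <= N.
Hypothesis ksupp : forall z, k z != 0 -> `|z - x| <= delta.
Hypothesis kmass : (N%:E <= \int[mu]_z (k z)%:E)%E.

Local Notation b := (fun r : R => gaussk e r (2 * delta)).

Lemma gaussk_le r w v : `|w| <= v -> gaussk e r v <= gaussk e r w.
Proof.
move=> wv; rewrite /gaussk; case: ifPn => // r0.
rewrite ler_wpM2l ?powR_ge0// ler_expR ler_wpM2r ?invr_ge0 ?mulrn_wge0 ?sqr_ge0//.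
rewrite ler_wpM2r ?powR_ge0// lerN2 -(real_normK (num_real w)) lerXn2r// nnegrE.
exact: le_trans wv.
Qed.

(** Both [y] and the support of [k] lie within [delta] of [x], so all relevant distances are at most
    [2 * delta], and the kernel decreases with distance. *)
Lemma trans_lower r y : `|y - x| <= delta -> ((b r * N)%:E <= trans r y)%E.
Proof.
move=> yx; rewrite EFinM.
have b0 : (0 <= (b r)%:E)%E by rewrite lee_fin gaussk_ge0.
apply: le_trans (lee_wpmul2l b0 kmass) _.
rewrite -lebesgue_integralZl//; last exact/measurable_EFinP.
apply: le_lebesgue_integral.
- by apply: emeasurable_funM => //; exact/measurable_EFinP.
- apply: emeasurable_funM; first exact/measurable_EFinP.
  by apply/measurable_EFinP; apply: measurable_gaussk => //; exact: measurable_funB.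
- by move=> z; rewrite mule_ge0// lee_fin.
move=> z; rewrite muleC; have [->|kz] := eqVneq (k z) 0; first by rewrite !mul0e.
rewrite lee_wpmul2l ?lee_fin//; apply: gaussk_le.
have -> : z - y = (z - x) - (y - x) by ring.
by rewrite (le_trans (ler_normB _ _))// mulr_natl mulr2n lerD// ksupp.
Qed.

End Lower.
End MomentBounds.

(** * Iterated convolutions of the kernel at zero *)

Section IteratedConvolution.
Context (R : realType).
Local Notation mu := (@lebesgue_measure R).

(** Convolution of m + 1 copies of [f]. The integral over the whole line is the usual one over
    [0, v] when [f] vanishes at nonpositive times, as [gaussk] does. *)
Fixpoint iconv (f : R -> R) (m : nat) (v : R) : \bar R :=
  if m is n.+1 then (\int[mu]_u (iconv f n u * (f (v - u))%:E))%E else (f v)%:E.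

Variables (f : R -> R) (mf : measurable_fun setT f) (f0 : forall r, 0 <= f r).

Lemma iconv_ge0 m v : (0 <= iconv f m v)%E.
Proof.
elim: m v => [|m IH] v /=; first by rewrite lee_fin.
by apply: integral_ge0 => u _; rewrite mule_ge0// lee_fin.
Qed.

Let mf_shift : measurable_fun setT (fun p : R * R => f (p.2 - p.1)).
Proof. by apply: (measurableT_comp mf); exact: measurable_funB. Qed.

Lemma measurable_iconv m : measurable_fun setT (iconv f m).
Proof.
elim: m => [|m IH] /=; first exact/measurable_EFinP.
apply: (@measurable_integral_planel R (fun u v => iconv f m u * (f (v - u))%:E)%E).
  apply: emeasurable_funM; first exact: (measurableT_comp IH).
  exact/measurable_EFinP.
by move=> u v; rewrite mule_ge0 ?iconv_ge0// lee_fin.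
Qed.

(** Associativity: two factors are added at once, because for the Gaussian kernel the convolution
    square is elementary while the kernel is not. *)
Lemma iconv_two m v :
  iconv f m.+2 v = (\int[mu]_u (iconv f m u * iconv f 1 (v - u)))%E.
Proof.
rewrite /=.
pose g s u := (iconv f m u * (f (s - u))%:E * (f (v - s))%:E)%E.
have g0 s u : (0 <= g s u)%E by rewrite !mule_ge0 ?iconv_ge0// lee_fin.
have mg : measurable_fun setT (fun p : R * R => g p.1 p.2).
  apply: emeasurable_funM.
    apply: emeasurable_funM; first exact: (measurableT_comp (measurable_iconv m)).
    apply/measurable_EFinP; apply: (measurableT_comp mf).
    exact: measurable_funB.
  apply/measurable_EFinP; apply: (measurableT_comp mf).
  exact: measurable_funB.
have mI s : measurable_fun setT (fun u : R => iconv f m u * (f (s - u))%:E)%E.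
  apply: emeasurable_funM; first exact: measurable_iconv.
  by apply/measurable_EFinP; apply: (measurableT_comp mf); exact: measurable_funB.
have I0 s u : (0 <= iconv f m u * (f (s - u))%:E)%E.
  by rewrite mule_ge0 ?iconv_ge0// lee_fin.
transitivity (\int[mu]_s \int[mu]_u g s u)%E.
  apply: eq_integral => s _; rewrite /g muleC -lebesgue_integralZl//.
    by apply: eq_integral => u _; rewrite muleC.
  by rewrite lee_fin.
rewrite (tonelli_plane mg g0); apply: eq_integral => u _.
have mh : measurable_fun setT (fun s : R => (f s)%:E * (f (v - u - s))%:E)%E.
  apply: emeasurable_funM; first exact/measurable_EFinP.
  by apply/measurable_EFinP; apply: (measurableT_comp mf); exact: measurable_funB.
have h0 (s : R) : (0 <= (f s)%:E * (f (v - u - s))%:E)%E.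
  by rewrite mule_ge0// lee_fin.
rewrite -(integral_shift (- u) mh h0) -lebesgue_integralZl//.
- by apply: eq_integral => s _; rewrite /g -muleA opprD opprK addrACA addNr addr0.
- apply: (measurableT_comp mh).
  exact: measurable_funD.
- exact: iconv_ge0.
Qed.

End IteratedConvolution.

Section LowerBound.
Context d (Omega : measurableType d) (R : realType) (P : probability Omega R).
Variables (B : R -> {RV P >-> R}) (hB : wiener_process P B).
Local Notation mu := (@lebesgue_measure R).
Variables (x e : R) (e0 : 0 < e).
Variables (k : R -> R) (mk : measurable_fun setT k) (k0 : forall z, 0 <= k z).
Variables (delta N : R).
Hypotheses (delta0 : 0 <= delta) (N0 : 0 <= N).
Hypothesis ksupp : forall z, k z != 0 -> `|z - x| <= delta.
Hypothesis kmass : (N%:E <= \int[mu]_z (k z)%:E)%E.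

Local Notation X := (wpos B x e).
Local Notation occ := (occ B x e k).
Local Notation addf := (addf B x e k).
Local Notation rho := (rho B x e k).
Local Notation b := (fun r : R => gaussk e r (2 * delta)).

Let mb : measurable_fun setT b.
Proof. exact: measurable_gaussk. Qed.

Let b0 r : 0 <= b r.
Proof. exact: gaussk_ge0. Qed.

(** Along [rhoSE] the process sits in the support of [k] at every counted time, so each transition
    is bounded below by a kernel that no longer depends on the position. *)
Lemma rho_lower m v : ((m`!%:R * N ^+ m.+1)%:E * iconv b m v <= rho m v)%E.
Proof.
have mI n u : measurable_fun setT (fun s : R => iconv b n s * (b (u - s))%:E)%E.
  apply: emeasurable_funM; first exact: measurable_iconv.
  by apply/measurable_EFinP; apply: (measurableT_comp mb); exact: measurable_funB.
elim: m v => [|m IH] v.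
  rewrite fact0 mul1r expr1 /= -EFinM.
  have [v0|v0] := ltP 0 v; last first.
    by rewrite {1}/gaussk ltNge v0 mulr0 rho_ge0.
  rewrite rho0E// mulrC; apply: (@trans_lower _ x e k mk k0 delta N ksupp kmass).
  by rewrite subrr normr0.
have c0 : 0 <= m.+1`!%:R * N ^+ m.+2 by rewrite mulr_ge0// exprn_ge0.
rewrite rhoSE//=.
have -> : (m.+1`!%:R * N ^+ m.+2) = m.+1%:R * (N * (m`!%:R * N ^+ m.+1)).
  by rewrite factS natrM (exprS _ m.+1); ring.
rewrite EFinM -muleA lee_wpmul2l ?lee_fin//.
have c1 : 0 <= N * (m`!%:R * N ^+ m.+1) by rewrite !mulr_ge0// exprn_ge0.
rewrite -lebesgue_integralZl//; last first.
  by move=> u; rewrite mule_ge0 ?lee_fin ?iconv_ge0.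
have oa0 u w : (0 <= (occ u w)%:E * addf u w ^+ m)%E.
  by rewrite mule_ge0 ?lee_fin ?occ_ge0// expe_ge0// addf_ge0.
have moa : measurable_fun setT (fun p : R * Omega => (occ p.1 p.2)%:E * addf p.1 p.2 ^+ m)%E.
  apply: emeasurable_funM; first by apply/measurable_EFinP; exact: measurable_occ.
  by apply: measurable_expe; exact: measurable_addf.
have mh : measurable_fun setT (fun p : R * Omega =>
    (occ p.1 p.2)%:E * addf p.1 p.2 ^+ m * trans e k (v - p.1) (X p.1 p.2))%E.
  apply: emeasurable_funM => //.
  have mp2 : measurable_fun setT (fun p : R * Omega => (v - p.1, X p.1 p.2)).
    apply: measurable_fun_pair; first exact: measurable_funB.
    exact: measurable_wpos_joint.
  exact: (measurableT_comp (@measurable_trans R e k mk k0) mp2).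
have h0 u w : (0 <= (occ u w)%:E * addf u w ^+ m * trans e k (v - u) (X u w))%E.
  by rewrite mule_ge0// trans_ge0.
apply: le_lebesgue_integral.
- exact: emeasurable_funM.
- exact: (@measurable_integral_time _ Omega R P
    (fun u w => (occ u w)%:E * addf u w ^+ m * trans e k (v - u) (X u w))%E).
- by move=> u; rewrite !mule_ge0 ?lee_fin ?iconv_ge0.
move=> u.
apply: (@le_trans _ _ ((b (v - u) * N)%:E * rho m u)%E).
  rewrite (_ : _ * (_ * _) = (b (v - u) * N)%:E *
     ((m`!%:R * N ^+ m.+1)%:E * iconv b m u))%E.
    by rewrite lee_wpmul2l// lee_fin mulr_ge0.
  rewrite (muleC (iconv _ _ _)) !muleA -!EFinM.
  by congr (_%:E * _)%E; ring.
have mou : measurable_fun setT (fun w => (occ u w)%:E * addf u w ^+ m)%E.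
  have mp : measurable_fun setT (fun w : Omega => (u, w)) by exact: measurable_fun_pair.
  exact: (measurableT_comp moa mp).
rewrite /rho -ge0_integralZlT//; last by rewrite lee_fin mulr_ge0.
apply: ge0_le_integralT.
- exact: emeasurable_funM.
- have mp : measurable_fun setT (fun w : Omega => (u, w)) by exact: measurable_fun_pair.
  exact: (measurableT_comp mh mp).
- by move=> w; rewrite mule_ge0// lee_fin mulr_ge0.
(* Either both sides vanish, or [X u] lies in the support of [k] and [trans_lower] applies. *)
move=> w; have [ou|ou] := eqVneq (occ u w) 0.
  by rewrite ou !mul0e mule0.
rewrite muleC lee_wpmul2l//; apply: (@trans_lower _ x e k mk k0 delta N ksupp kmass).
by move: ou; rewrite /occ; case: ifPn => [_ /ksupp//|]; rewrite eqxx.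
Qed.

Lemma addf_moment_ge t m : ((m.+1`!%:R * N ^+ m.+1)%:E *
  \int[mu]_u (if (u < t)%R then iconv b m u else 0) <= \int[P]_w (addf t w ^+ m.+1))%E.
Proof.
rewrite (moment_addf hB)// factS natrM -mulrA EFinM -muleA lee_wpmul2l ?lee_fin//.
have mc : measurable_fun setT (fun u : R => if (u < t)%R then iconv b m u else 0%E).
  apply: measurable_fun_ifT => //; first exact: measurable_fun_ltr.
  exact: measurable_iconv.
have c0 u : (0 <= (if (u < t)%R then iconv b m u else 0))%E.
  by case: ifP => // _; exact: iconv_ge0.
have d0 : (0 <= (m`!%:R * N ^+ m.+1)%:E :> \bar R)%E.
  by rewrite lee_fin mulr_ge0// exprn_ge0.
rewrite -lebesgue_integralZl//; apply: le_lebesgue_integral.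
- exact: emeasurable_funM.
- apply: measurable_fun_ifT => //; first exact: measurable_fun_ltr.
  exact: measurable_rho.
- by move=> u; rewrite mule_ge0.
by move=> u; case: ifP => _; rewrite ?mule0//; exact: rho_lower.
Qed.

End LowerBound.

(** * The arcsine integral *)

Section Arcsine.
Context (R : realType).
Local Notation mu := (@lebesgue_measure R).
Variables (v : R) (v0 : 0 < v).

Let g (u : R) : R := (Num.sqrt (u * (v - u)))^-1.
Let F (u : R) : R := acos (1 - (2 / v) * u).

Let dF u : 0 < u < v -> is_derive u 1 F (g u).
Proof.
move=> /andP[u0 uv].
have I1 : -1 < 1 - 2 / v * u < 1.
  have h : 0 < 2 / v * u < 2.
    by rewrite mulrAC divr_gt0 ?mulr_gt0//= ltr_pdivrMr// ltr_pM2l.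
  by move: h => /andP[h1 h2]; apply/andP; split; lra.
have d1 : is_derive u 1 (fun u : R => 1 - 2 / v * u) (- (2 / v)).
  apply: is_derive_eq; rewrite add0r mul1r /GRing.scale/= mulr1//.
have d2 := is_derive1_acos I1.
have d3 := @is_derive1_comp R acos (fun u : R => 1 - 2 / v * u) u _ _ d2 d1.
rewrite (_ : g u = - (Num.sqrt (1 - (1 - 2 / v * u) ^+ 2))^-1 * - (2 / v))//.
apply/esym; rewrite /g mulrNN.
have -> : 1 - (1 - 2 / v * u) ^+ 2 = (2 / v) ^+ 2 * (u * (v - u)).
  by field; rewrite gt_eqF.
have v2 : 0 < 2 / v by rewrite divr_gt0.
rewrite sqrtrM ?sqr_ge0// sqrtr_sqr gtr0_norm// invfM mulrAC mulVf ?mul1r//.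
by rewrite gt_eqF.
Qed.

Lemma measurable_invr_sqrt (h : R -> R) : measurable_fun setT h ->
  measurable_fun setT (fun u => (Num.sqrt (h u))^-1).
Proof.
move=> mh.
rewrite [X in measurable_fun _ X](_ : _ =
    (fun u => if 0 < h u then (h u) `^ (- 2^-1) else 0)).
  apply: measurable_fun_ifT => //; first exact: measurable_fun_ltr.
  exact: (measurableT_comp (measurable_powR _)).
apply/funext => u; case: ltP => h0; first by rewrite powRN powR12_sqrt ?ltW.
by rewrite ler0_sqrtr// invr0.
Qed.

Let gc (u : R) : 0 < u < v -> {for u, continuous g}.
Proof.
move=> /andP[u0 uv]; apply: cvgV; first by rewrite gt_eqF// sqrtr_gt0 mulr_gt0// subr_gt0.
apply: (@cvg_comp _ _ _ _ (@Num.sqrt R)); last exact: sqrt_continuous.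
apply: cvgM; first exact: cvg_id.
by apply: cvgB; [exact: cvg_cst|exact: cvg_id].
Qed.

(** [F] is an antiderivative, from the substitution u = v (1 - cos s) / 2. The integrand blows up at
    both ends, so the fundamental theorem is applied on an exhaustion by compact intervals. *)
Lemma arcsine_integral :
  (\int[mu]_(u in `]0%R, v[) ((Num.sqrt (u * (v - u)))^-1)%:E = pi%:E)%E.
Proof.
pose eta n : R := n.+2%:R^-1.
have eta0 n : 0 < eta n by rewrite invr_gt0.
have eta1 n : eta n < pi / 2.
  by apply: lt_le_trans (pihalf_ge1 R); rewrite invf_lt1// ltr1n.
have etapi n : eta n \in `[0, pi].
  by rewrite in_itv/= ltW//=; have := eta1 n; have := @pi_gt0 R; lra.
pose c n := cos (eta n).
have c01 n : 0 < c n < 1.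
  rewrite cos_gt0_pihalf ?eta1 ?andbT ?(lt_trans _ (eta0 n)) ?oppr_lt0 ?divr_gt0 ?pi_gt0//=.
  by rewrite -cos0 ltr_cos// in_itv/= lexx pi_ge0.
(* The endpoints are images of angles: [F (a n) = eta n] and [F (b n) = pi - eta n], so the integral
   over [U n] is exactly [pi - 2 * eta n]. *)
pose a n := v * (1 - c n) / 2.
pose b n := v * (1 + c n) / 2.
have a0 n : 0 < a n.
  by rewrite divr_gt0// mulr_gt0// subr_gt0; case/andP: (c01 n).
have bv n : b n < v.
  by rewrite /b ltr_pdivrMr// ltr_pM2l//; case/andP: (c01 n) => _; lra.
have ab n : a n < b n.
  by rewrite /a /b ltr_pM2r// ltr_pM2l//; case/andP: (c01 n); lra.
have ndc : nondecreasing_seq c.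
  move=> m n mn; rewrite /c leNgt ltr_cos// -leNgt /eta lef_pV2 ?posrE//.
  by rewrite ler_nat ltnS.
have cvg_eta : eta n @[n --> \oo] --> (0 : R).
  by have := @cvg_harmonic R; rewrite -(cvg_shiftS _).
have c1 : c n @[n --> \oo] --> (1 : R).
  rewrite -cos0; apply: (@cvg_comp _ _ _ eta cos); last exact: continuous_cos.
  exact: cvg_eta.
pose U n := `[a n, b n]%classic.
have UE : \bigcup_n U n = `]0%R, v[%classic.
  apply/seteqP; split => u /=.
    move=> [n _]; rewrite /U /= !in_itv/= => /andP[h1 h2].
    by rewrite (lt_le_trans (a0 n) h1) (le_lt_trans h2 (bv n)).
  rewrite in_itv/= => /andP[u0 uv].
  pose r := Num.min u (v - u).
  have r0 : 0 < r by rewrite lt_min u0 subr_gt0.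
  have : \forall n \near \oo, 1 - (2 * r / v) < c n.
    move/cvgrPdist_lt : c1 => /(_ (2 * r / v)) [|N _ hN].
      by rewrite divr_gt0// mulr_gt0.
    exists N => // n /hN /=; rewrite ltr_norml => /andP[_]; lra.
  move=> [N _ /(_ N (leqnn N))] /= hN.
  exists N => //; rewrite /U /= in_itv/=.
  have h1 : v * (1 - c N) < 2 * r.
    by rewrite mulrC -ltr_pdivlMr//; lra.
  have ru : r <= u by rewrite ge_min lexx.
  have rv : r <= v - u by rewrite ge_min lexx orbT.
  by rewrite /a /b; apply/andP; split; lra.
have ndU : nondecreasing_seq U.
  move=> m n mn; rewrite /U; apply/subsetPset/subset_itv; rewrite bnd_simp /a /b.
    by rewrite ler_pM2r// ler_pM2l// lerD2l lerN2 ndc.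
  by rewrite ler_pM2r// ler_pM2l// lerD2l ndc.
have mg : measurable_fun setT (EFin \o g).
  apply/measurable_EFinP; apply: measurable_invr_sqrt.
  by apply: measurable_funM => //; exact: measurable_funB.
have mg' : measurable_fun (setT : set (measurableTypeR R)) (EFin \o g) by exact: mg.
have mU n : measurable (U n : set (measurableTypeR R)) by exact: measurable_itv.
have g0 n u : U n u -> (0 <= (EFin \o g) u)%E.
  by move=> _; rewrite lee_fin invr_ge0 sqrtr_ge0.
have cvgU := @ge0_nondecreasing_set_cvg_integral _ (measurableTypeR R) R U (EFin \o g) mu ndU
  mU (fun n => measurable_funTS mg') g0.
rewrite UE in cvgU.
have IU n : (\int[mu]_(u in U n) (EFin \o g) u = (pi - 2 * eta n)%:E)%E.
  rewrite /U (@continuous_FTC2 R g F)//.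
  - rewrite -EFinB; congr EFin; rewrite /F /a /b.
    rewrite (_ : 1 - 2 / v * (v * (1 + c n) / 2) = - c n); last by field; rewrite gt_eqF.
    rewrite (_ : 1 - 2 / v * (v * (1 - c n) / 2) = c n); last by field; rewrite gt_eqF.
    rewrite acosN; last by case/andP: (c01 n) => ? ?; apply/andP; split; lra.
    by rewrite /c cosK//; ring.
  - apply: continuous_in_subspaceT => u; rewrite inE /= in_itv/= => /andP[h1 h2].
    by apply: gc; rewrite (lt_le_trans (a0 n) h1) (le_lt_trans h2 (bv n)).
  - have dc u : 0 < u < v -> {for u, continuous F}.
      move=> /dF h; apply: differentiable_continuous; apply/derivable1_diffP.
      by case: h.
    split.
    + move=> u; rewrite in_itv/= => /andP[h1 h2].
      suff : is_derive u 1 F (g u) by case.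
      by apply: dF; rewrite (lt_trans (a0 n) h1) (lt_trans h2 (bv n)).
    + apply: cvg_at_right_filter; apply: dc.
      by rewrite a0 (lt_trans (ab n)).
    + apply: cvg_at_left_filter; apply: dc.
      by rewrite bv (lt_trans (a0 n)).
  - move=> u; rewrite in_itv/= => /andP[h1 h2]; rewrite derive1E.
    suff : is_derive u 1 F (g u) by case.
    by apply: dF; rewrite (lt_trans (a0 n) h1) (lt_trans h2 (bv n)).
apply: (cvg_unique _ cvgU) => //.
rewrite [X in X @ _](_ : _ = (fun n => (pi - 2 * eta n)%:E)); last first.
  by apply/funext => n; exact: IU.
apply: cvg_EFin; first by apply: nearW.
rewrite [X in _ --> X](_ : _ = pi - 2 * 0); last by rewrite mulr0 subr0.
apply: cvgB; first exact: cvg_cst.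
by apply: cvgM; [exact: cvg_cst|exact: cvg_eta].
Qed.

End Arcsine.

Section GaussConvolution.
Context (R : realType).
Local Notation mu := (@lebesgue_measure R).
Variables (e : R) (e0 : 0 < e).

Local Notation b := (fun r : R => gaussk e r 0).

Let mb : measurable_fun setT b.
Proof. exact: measurable_gaussk. Qed.

Let b0 r : 0 <= b r.
Proof. exact: gaussk_ge0. Qed.

Lemma gaussk0E r : 0 < r -> gaussk e r 0 = (e * Num.sqrt (2 * pi))^-1 * (Num.sqrt r)^-1.
Proof.
move=> r0; rewrite /gaussk r0 expr0n oppr0 !mul0r expR0 mulr1 powRN powR12_sqrt; last first.
  by rewrite mulrn_wge0// !mulr_ge0 ?sqr_ge0 ?ltW ?pi_gt0.
rewrite -invfM; congr (_^-1).
rewrite (_ : e ^+ 2 * r * pi *+ 2 = e ^+ 2 * (2 * pi * r)); last by rewrite -mulr_natr; ring.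
rewrite sqrtrM ?sqr_ge0// sqrtr_sqr gtr0_norm// -[RHS]mulrA; congr (_ * _).
by rewrite sqrtrM// mulr_ge0// pi_ge0.
Qed.

Lemma gaussk0_le0 r w : r <= 0 -> gaussk e r w = 0.
Proof. by move=> r0; rewrite /gaussk ltNge r0. Qed.

(** The two normalizations multiply to 1 / (2 pi e^2), and the arcsine integral contributes pi for
    every v > 0. *)
Lemma iconv_gaussk1 v : iconv b 1 v = (if 0 < v then (2 * e ^+ 2)^-1 else 0)%:E.
Proof.
rewrite /=; case: ltP => [v0|v0]; last first.
  rewrite integral0_eq// => u _; case: (ltP 0 u) => u0.
    by rewrite (gaussk0_le0 _ (r := v - u)) ?mule0// subr_le0 (le_trans v0) ?ltW.
  by rewrite gaussk0_le0// mul0e.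
have mg : measurable_fun setT (fun u : R => (Num.sqrt (u * (v - u)))^-1).
  by apply: measurable_invr_sqrt; apply: measurable_funM => //; exact: measurable_funB.
transitivity (\int[mu]_(u in `]0%R, v[)
    (((2 * pi * e ^+ 2)^-1)%:E * ((Num.sqrt (u * (v - u)))^-1)%:E))%E.
  rewrite [RHS]integral_mkcond; apply: eq_integral => u _; rewrite patchE.
  case: ifPn => uv.
    move: uv; rewrite inE /= in_itv/= => /andP[u0 uv].
    have vu : 0 < v - u by rewrite subr_gt0.
    rewrite !gaussk0E// -!EFinM; congr EFin.
    rewrite [Num.sqrt (u * _)]sqrtrM ?ltW// [(_ * Num.sqrt (v - u))^-1]invfM mulrACA; congr (_ * _).
    rewrite -invfM; congr (_^-1); rewrite mulrACA -(expr2 (Num.sqrt _)).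
    by rewrite sqr_sqrtr ?mulr_ge0 ?pi_ge0//; ring.
  move: uv; rewrite notin_setE /= in_itv/= => /negP; rewrite negb_and -!leNgt.
  case/orP => h; first by rewrite gaussk0_le0// mul0e.
  by rewrite (gaussk0_le0 _ (r := v - u)) ?mule0// subr_le0.
have mgI : measurable_fun (`]0%R, v[%classic : set (measurableTypeR R))
    (fun u : R => ((Num.sqrt (u * (v - u)))^-1)%:E).
  by apply/measurable_EFinP; apply: measurable_funTS; exact: mg.
have c0 : (0 <= ((2 * pi * e ^+ 2)^-1)%:E :> \bar R)%E.
  by rewrite lee_fin invr_ge0 mulr_ge0 ?sqr_ge0// mulr_ge0 ?pi_ge0.
rewrite ge0_integralZl//.
rewrite arcsine_integral// -EFinM; congr EFin.
have := gt_eqF (pi_gt0 R); move: (pi : R) => p /negbT p0.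
by field; rewrite p0 (gt_eqF e0).
Qed.

Let ind (u : R) : R := if 0 < u then 1 else 0.

Let mind : measurable_fun setT ind.
Proof. by apply: measurable_fun_ifT => //; exact: measurable_fun_ltr. Qed.

Let cumul_ind v : cumul ind v = (if 0 < v then v else 0)%:E.
Proof.
rewrite /cumul; case: ltP => v0; last first.
  rewrite integral0_eq// => u _; case: ifPn => // uv.
  by rewrite /ind ltNge (le_trans (ltW uv) v0).
transitivity (\int[mu]_(u in `]0%R, v[) (cst 1 u))%E.
  rewrite [RHS]integral_mkcond; apply: eq_integral => u _; rewrite patchE mem_setE in_itv/=.
  by rewrite /ind andbC; case: (u < v); case: (0 < u).
rewrite integral_cst//= mul1e lebesgue_measure_itv/= lte_fin v0.
by rewrite oppr0 adde0.
Qed.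

(** [cumul_expe] for the indicator of the positive half-line, whose cumulative integral is the
    identity there. *)
Lemma integral_expr t m : 0 < t ->
  (\int[mu]_u (if (u < t)%R then (if 0 < u then u ^+ m else 0)%:E else 0) =
   (t ^+ m.+1 / m.+1%:R)%:E)%E.
Proof.
move=> t0; have i0 u : 0 <= ind u by rewrite /ind; case: ifP.
have := cumul_expe mind i0 m t.
rewrite cumul_ind t0 -EFin_expe.
set I := (\int[mu]_u _)%E => H.
have -> : (\int[mu]_u (if (u < t)%R then (if 0 < u then u ^+ m else 0)%:E else 0))%E = I.
  apply: eq_integral => u _; rewrite cumul_ind /ind.
  by case: ifP => _; case: ifP => _; rewrite ?mul0e// mul1e -EFin_expe.
have m0 : m.+1%:R != 0 :> R by rewrite pnatr_eq0.
by rewrite mulrC EFinM H muleA -EFinM mulVf// mul1e.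
Qed.

(** Index 2j + 1 means 2j + 2 factors, that is j + 1 copies of the constant convolution square. *)
Lemma iconv_gaussk_odd j v : iconv b j.*2.+1 v =
  (if 0 < v then (2 * e ^+ 2) ^- j.+1 * v ^+ j / j`!%:R else 0)%:E.
Proof.
elim: j v => [|j IH] v.
  by rewrite iconv_gaussk1 expr0 mulr1 divr1 expr1.
rewrite doubleS iconv_two//.
pose c : R := (2 * e ^+ 2) ^- j.+1 / j`!%:R * (2 * e ^+ 2)^-1.
have e20 : 0 <= 2 * e ^+ 2 by rewrite mulr_ge0 ?sqr_ge0.
have c0 : 0 <= c.
  by rewrite /c ?mulr_ge0 ?invr_ge0 ?exprn_ge0.
transitivity (\int[mu]_u (c%:E * (if (u < v)%R then (if 0 < u then u ^+ j else 0)%:E else 0)))%E.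
  apply: eq_integral => u _; rewrite IH iconv_gaussk1 subr_gt0.
  case: ifP => _; case: ifP => _; rewrite ?mule0 ?mul0e// -!EFinM; congr EFin.
  by rewrite /c; ring.
rewrite lebesgue_integralZl//; last 2 first.
- apply: measurable_fun_ifT => //; first exact: measurable_fun_ltr.
  apply/measurable_EFinP; apply: measurable_fun_ifT => //; exact: measurable_fun_ltr.
- move=> u; case: ifP => // _; rewrite lee_fin; case: ifP => // u0.
  by rewrite exprn_ge0// ltW.
case: ltP => v0; last first.
  rewrite integral0_eq ?mule0// => u _; case: ifPn => // uv.
  by rewrite ltNge (le_trans (ltW uv) v0).
rewrite integral_expr// -EFinM; congr EFin; rewrite /c factS natrM.
have f0 : j`!%:R != 0 :> R by rewrite pnatr_eq0 -lt0n fact_gt0.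
have m0 : j.+1%:R != 0 :> R by rewrite pnatr_eq0.
rewrite [(2 * e ^+ 2) ^+ j.+2]exprS.
by field; rewrite f0 nat1r m0 (gt_eqF e0) andbT expf_neq0// gt_eqF ?mulr_gt0 ?exprn_gt0.
Qed.

(** These are terms of an exponential series; after multiplication by N^(2j+2) the argument becomes
    N^2 t / (2 e^2). *)
Lemma integral_iconv_gaussk t j : 0 < t ->
  (\int[mu]_u (if (u < t)%R then iconv b j.*2.+1 u else 0) =
  ((t / (2 * e ^+ 2)) ^+ j.+1 / j.+1`!%:R)%:E)%E.
Proof.
move=> t0; pose c : R := (2 * e ^+ 2) ^- j.+1 / j`!%:R.
have e20 : 0 <= 2 * e ^+ 2 by rewrite mulr_ge0 ?sqr_ge0.
have c0 : 0 <= c.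
  by rewrite /c ?mulr_ge0 ?invr_ge0 ?exprn_ge0.
transitivity (\int[mu]_u (c%:E * (if (u < t)%R then (if 0 < u then u ^+ j else 0)%:E else 0)))%E.
  apply: eq_integral => u _; rewrite iconv_gaussk_odd.
  case: ifP => _; rewrite ?mule0//; case: ifP => _; rewrite ?mule0// -!EFinM; congr EFin.
  by rewrite /c; ring.
rewrite lebesgue_integralZl//; last 2 first.
- apply: measurable_fun_ifT => //; first exact: measurable_fun_ltr.
  apply/measurable_EFinP; apply: measurable_fun_ifT => //; exact: measurable_fun_ltr.
- move=> u; case: ifP => // _; rewrite lee_fin; case: ifP => // u0.
  by rewrite exprn_ge0// ltW.
rewrite integral_expr// -EFinM; congr EFin; rewrite /c factS natrM expr_div_n.
have f0 : j`!%:R != 0 :> R by rewrite pnatr_eq0 -lt0n fact_gt0.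
have m0 : j.+1%:R != 0 :> R by rewrite pnatr_eq0.
by field; rewrite f0 nat1r m0 expf_neq0// gt_eqF ?mulr_gt0 ?exprn_gt0.
Qed.

End GaussConvolution.

(** * Resolvent and Green function bounds *)

Section MonotoneConvolution.
Context (R : realType).
Local Notation mu := (@lebesgue_measure R).
Variables (f_ : nat -> R -> R) (f : R -> R).
Hypotheses (mf_ : forall n, measurable_fun setT (f_ n)) (f_0 : forall n r, 0 <= f_ n r).
Hypothesis nd : forall r, nondecreasing_seq (f_ ^~ r).
Hypothesis cvgf : forall r, f_ n r @[n --> \oo] --> f r.

Let f0 r : 0 <= f r.
Proof.
apply: le_trans (f_0 0 r) _; rewrite -(cvg_lim _ (@cvgf r))//.
apply: nondecreasing_cvgn_le; first exact: nd.
by apply/cvg_ex; exists (f r).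
Qed.

Let f_le n r : f_ n r <= f r.
Proof.
rewrite -(cvg_lim _ (@cvgf r))//; apply: nondecreasing_cvgn_le; first exact: nd.
by apply/cvg_ex; exists (f r).
Qed.

Lemma nd_iconv m v : nondecreasing_seq (fun n => iconv (f_ n) m v).
Proof.
elim: m v => [|m IH] v n1 n2 n12 /=; first by rewrite lee_fin nd.
apply: le_lebesgue_integral.
- apply: emeasurable_funM; first exact: measurable_iconv.
  by apply/measurable_EFinP; apply: (measurableT_comp (mf_ n1)); exact: measurable_funB.
- apply: emeasurable_funM; first exact: measurable_iconv.
  by apply/measurable_EFinP; apply: (measurableT_comp (mf_ n2)); exact: measurable_funB.
- by move=> u; rewrite mule_ge0 ?iconv_ge0 ?lee_fin.
move=> u; apply: lee_pmul; rewrite ?iconv_ge0 ?lee_fin//; first exact: IH.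
exact: nd.
Qed.

(** Used for the kernels at distance 2 delta with delta decreasing to 0: the lower bounds for small
    balls around an atom tend to the explicit value at distance 0. *)
Lemma cvg_iconv m v : iconv (f_ n) m v @[n --> \oo] --> iconv f m v.
Proof.
elim: m v => [|m IH] v /=; first by apply: cvg_EFin; [exact: nearW|exact: cvgf].
pose g n u := (iconv (f_ n) m u * (f_ n (v - u))%:E)%E.
have -> : (\int[mu]_u (iconv f m u * (f (v - u))%:E) = \int[mu]_u limn (g ^~ u))%E.
  apply: eq_integral => u _; apply/esym/cvg_lim => //.
  (* Iterated convolutions may be infinite and multiplication is discontinuous at 0 times infinity;
     but if the limit [f] vanishes at a point, so do all [f_ n]. *)
  have [fu0|fu0] := eqVneq (f (v - u)) 0.
    rewrite fu0 mule0 /g [X in X @ _](_ : _ = fun=> 0%E); first exact: cvg_cst.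
    apply/funext => n; rewrite (_ : f_ n (v - u) = 0) ?mule0//.
    by apply/eqP; rewrite eq_le f_0 andbT -fu0 f_le.
  apply: cvgeM; last 2 first.
  - exact: IH.
  - by apply: cvg_EFin; [exact: nearW|exact: cvgf].
  by rewrite mule_defE eqe (negbTE fu0) andbF.
apply: (@cvg_monotone_convergence _ (measurableTypeR R) R mu setT measurableT g).
- move=> n; apply: emeasurable_funM; first exact: measurable_iconv.
  by apply/measurable_EFinP; apply: (measurableT_comp (mf_ n)); exact: measurable_funB.
- by move=> n u _; rewrite mule_ge0 ?iconv_ge0 ?lee_fin.
- move=> u _ n1 n2 n12; apply: lee_pmul; rewrite ?iconv_ge0 ?lee_fin//.
    exact: nd_iconv.
  exact: nd.
Qed.

Lemma cvg_integral_iconv m t :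
  (\int[mu]_u (if (u < t)%R then iconv (f_ n) m u else 0))%E @[n --> \oo] -->
  (\int[mu]_u (if (u < t)%R then iconv f m u else 0))%E.
Proof.
pose g n u := (if (u < t)%R then iconv (f_ n) m u else 0)%E.
have -> : (\int[mu]_u (if (u < t)%R then iconv f m u else 0) = \int[mu]_u limn (g ^~ u))%E.
  apply: eq_integral => u _; apply/esym/cvg_lim => //; rewrite /g.
  by case: ifP => _; [exact: cvg_iconv|exact: cvg_cst].
apply: (@cvg_monotone_convergence _ (measurableTypeR R) R mu setT measurableT g).
- move=> n; apply: measurable_fun_ifT => //; first exact: measurable_fun_ltr.
  exact: measurable_iconv.
- by move=> n u _; rewrite /g; case: ifP => // _; exact: iconv_ge0.
- by move=> u _ n1 n2 n12; rewrite /g; case: ifP => // _; exact: nd_iconv.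
Qed.

End MonotoneConvolution.

(** * Resolvent kernel *)

Section GaussLaplace.
Context (R : realType).
Local Notation mu := (@lebesgue_measure R).
Variables (e : R) (e0 : 0 < e).

Lemma integral_expR l : 0 < l ->
  (\int[mu]_v (if 0 < v then expR (- (l * v)) else 0)%:E = l^-1%:E)%E.
Proof.
move=> l0; have mE : measurable_fun setT (fun v : R => (if 0 < v then expR (- (l * v)) else 0)%:E).
  apply/measurable_EFinP; apply: measurable_fun_ifT => //; first exact: measurable_fun_ltr.
  apply: (measurableT_comp (@measurable_expR R)).
  by apply: measurable_funN; exact: measurable_funM.
have E0 v : (0 <= (if 0 < v then expR (- (l * v)) else 0)%:E :> \bar R)%E.
  by rewrite lee_fin; case: ifP => // _; exact: expR_ge0.
have l00 : (0 <= l%:E)%E by rewrite lee_fin ltW.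
suff H : (l%:E * \int[mu]_v (if 0 < v then expR (- (l * v)) else 0)%:E = 1)%E.
  by rewrite -[RHS]mule1 -H muleA -EFinM mulVf ?gt_eqF// mul1e.
rewrite -lebesgue_integralZl// -(integral_exponential_pdf l0).
apply: (@eq_integral_off _ 0).
- exact: emeasurable_funM.
- by apply/measurable_EFinP; exact: measurable_exponential_pdf.
move=> v v0; rewrite -EFinM; congr EFin; rewrite /exponential_pdf patchE.
rewrite mem_setE in_itv/= andbT le_eqVlt eq_sym (negbTE v0)/=.
by case: ifP => _; rewrite ?mulr0// mulNr.
Qed.

Definition resolvent (l w : R) : \bar R :=
  (\int[mu]_r (expR (- (l * r)) * gaussk e r w)%:E)%E.

Lemma measurable_resolvent_integrand l w :
  measurable_fun setT (fun r : R => (expR (- (l * r)) * gaussk e r w)%:E : \bar R).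
Proof.
apply/measurable_EFinP; apply: measurable_funM; last exact: measurable_gaussk.
apply: (measurableT_comp (@measurable_expR R)).
by apply: measurable_funN; exact: measurable_funM.
Qed.

Lemma resolvent_integrand_ge0 l w r : (0 <= (expR (- (l * r)) * gaussk e r w)%:E :> \bar R)%E.
Proof. by rewrite lee_fin mulr_ge0 ?expR_ge0// gaussk_ge0. Qed.

(* Squaring turns the Laplace transform of the kernel into that of its
   convolution square, which is constant. *)
Lemma resolvent0 l : 0 < l -> resolvent l 0 = ((e * Num.sqrt (2 * l))^-1)%:E.
Proof.
move=> l0; pose L := resolvent l 0.
pose h r := (expR (- (l * r)) * gaussk e r 0)%:E : \bar R.
have mh : measurable_fun setT h by exact: measurable_resolvent_integrand.
have h0 r : (0 <= h r)%E by exact: resolvent_integrand_ge0.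
have L0 : (0 <= L)%E by apply: integral_ge0 => r _; exact: h0.
have LL : (L * L = ((2 * e ^+ 2 * l)^-1)%:E)%E.
  pose g r v := (h r * h (v - r)%R)%E.
  have mg : measurable_fun setT (fun p : R * R => g p.1 p.2).
    apply: emeasurable_funM; first exact: (measurableT_comp mh).
    by apply: (measurableT_comp mh); exact: measurable_funB.
  have g0 r v : (0 <= g r v)%E by rewrite mule_ge0.
  transitivity (\int[mu]_r \int[mu]_v g r v)%E.
    rewrite {1}/L /resolvent muleC -(lebesgue_integralZl mh h0 L0).
    apply: eq_integral => r _; rewrite /g.
    have m1 : measurable_fun setT (fun v : R => h (v - r)).
      by apply: (measurableT_comp mh); exact: measurable_funB.
    rewrite (@lebesgue_integralZl R (h r) _ m1 (fun v => h0 (v - r)) (h0 r)).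
    by rewrite (integral_shift (- r) mh h0) muleC.
  rewrite (tonelli_plane mg g0).
  transitivity (\int[mu]_v (((2 * e ^+ 2)^-1)%:E * (if 0 < v then expR (- (l * v)) else 0)%:E))%E.
    apply: eq_integral => v _.
    transitivity (\int[mu]_r ((expR (- (l * v)))%:E *
        ((gaussk e r 0)%:E * (gaussk e (v - r) 0)%:E)))%E.
      apply: eq_integral => r _; rewrite /g /h -!EFinM; congr EFin.
      rewrite mulrACA -expRD; congr (expR _ * _); ring.
    have m1 : measurable_fun setT (fun r : R =>
        (gaussk e r 0)%:E * (gaussk e (v - r) 0)%:E)%E.
      apply: emeasurable_funM; apply/measurable_EFinP; first exact: measurable_gaussk.
      by apply: measurable_gaussk => //; exact: measurable_funB.
    have p1 r : (0 <= (gaussk e r 0)%:E * (gaussk e (v - r) 0)%:E)%E.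
      by rewrite mule_ge0 ?lee_fin ?gaussk_ge0.
    have p2 : (0 <= (expR (- (l * v)))%:E :> \bar R)%E by rewrite lee_fin expR_ge0.
    rewrite (lebesgue_integralZl m1 p1 p2).
    have := iconv_gaussk1 e0 v; rewrite /= => ->.
    by rewrite -!EFinM; congr EFin; case: ifP => _; rewrite ?mulr0// mulrC.
  have m1 : measurable_fun setT (fun v : R => (if 0 < v then expR (- (l * v)) else 0)%:E).
    apply/measurable_EFinP; apply: measurable_fun_ifT => //; first exact: measurable_fun_ltr.
    apply: (measurableT_comp (@measurable_expR R)).
    by apply: measurable_funN; exact: measurable_funM.
  have p1 v : (0 <= (if 0 < v then expR (- (l * v)) else 0)%:E :> \bar R)%E.
    by rewrite lee_fin; case: ifP => // _; exact: expR_ge0.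
  have p2 : (0 <= ((2 * e ^+ 2)^-1)%:E :> \bar R)%E.
    by rewrite lee_fin invr_ge0 mulr_ge0// sqr_ge0.
  by rewrite (lebesgue_integralZl m1 p1 p2) integral_expR// -EFinM -invfM.
have s0 : 0 < e * Num.sqrt (2 * l) by rewrite mulr_gt0// sqrtr_gt0 mulr_gt0.
(* The finite square excludes an infinite [L], and nonnegativity selects the root. *)
rewrite -/L; case: L L0 LL => [r| |]//=.
- rewrite lee_fin => r0; rewrite -EFinM => -[rr]; congr EFin.
  apply/eqP; rewrite -(@eqrXn2 _ 2) ?invr_ge0 ?(ltW s0)//.
  by rewrite expr2 rr exprVn exprMn sqr_sqrtr ?mulr_ge0 ?ltW//; apply/eqP; congr (_^-1); ring.
Qed.

Lemma resolvent_le l w : 0 < l -> (resolvent l w <= ((e * Num.sqrt (2 * l))^-1)%:E)%E.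
Proof.
move=> l0; rewrite -resolvent0//; apply: le_lebesgue_integral.
- exact: measurable_resolvent_integrand.
- exact: measurable_resolvent_integrand.
- exact: resolvent_integrand_ge0.
move=> r; rewrite lee_fin ler_wpM2l ?expR_ge0// /gaussk; case: ifPn => // r0.
rewrite ler_wpM2l ?powR_ge0// ler_expR expr0n oppr0 !mul0r.
rewrite !mulNr oppr_le0; apply: divr_ge0; first by apply: mulr_ge0; [exact: sqr_ge0|exact: powR_ge0].
by rewrite mulrn_wge0 ?sqr_ge0.
Qed.

(** Half of the exponent l r is combined with the Gaussian exponent to give the decay in [d]; the
    other half leaves the resolvent at rate l / 2 at the origin. The lost factor sqrt 2 is harmless
    away from the diagonal. *)
Lemma resolvent_far l d w : 0 < l -> 0 <= d -> d <= `|w| ->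
  (resolvent l w <= (expR (- (d * (Num.sqrt l / e))) * (e * Num.sqrt l)^-1)%:E)%E.
Proof.
move=> l0 d0 dw.
have l20 : 0 < l / 2 by rewrite divr_gt0.
rewrite (_ : Num.sqrt l = Num.sqrt (2 * (l / 2))) in |- *; last first.
  by congr Num.sqrt; field.
have p2 : (0 <= (expR (- (d * (Num.sqrt (2 * (l / 2)) / e))))%:E :> \bar R)%E.
  by rewrite lee_fin expR_ge0.
rewrite EFinM -(resolvent0 l20) -(lebesgue_integralZl
  (measurable_resolvent_integrand _ _) (resolvent_integrand_ge0 _ _) p2).
apply: le_lebesgue_integral.
- exact: measurable_resolvent_integrand.
- apply: emeasurable_funM => //; exact: measurable_resolvent_integrand.
- exact: resolvent_integrand_ge0.
move=> r; rewrite -EFinM lee_fin /gaussk; case: ifPn => r0; last by rewrite !mulr0.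
set p := _ `^ _; have p0 : 0 <= p by exact: powR_ge0.
rewrite expr0n oppr0 !mul0r expR0 mulr1; set s := Num.sqrt _.
rewrite [leLHS](_ : _ = p * expR (- (l * r) + - w ^+ 2 * r `^ (-1) / (e ^+ 2 *+ 2))); last first.
  by rewrite expRD; ring.
rewrite [leRHS](_ : _ = p * expR (- (d * (s / e)) + - (l / 2 * r))); last first.
  by rewrite expRD; ring.
rewrite ler_wpM2l// ler_expR (powR_inv1 (ltW r0)).
have s2 : s ^+ 2 = l by rewrite /s sqr_sqrtr; [field|rewrite mulr_ge0 ?ltW].
have w2 : d ^+ 2 <= w ^+ 2.
  by rewrite -[w ^+ 2]real_normK ?num_real// lerXn2r ?nnegrE.
(* Arithmetic-geometric mean: it trades the two exponents for a term free of [r]. *)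
have h : 2 * (s * r * (d / e)) <= (s * r) ^+ 2 + (d / e) ^+ 2.
  by have := sqr_ge0 (s * r - d / e); lra.
have h2 : d * (s / e) <= l * r / 2 + w ^+ 2 / (2 * e ^+ 2 * r).
  have r20 : 0 < 2 * r by rewrite mulr_gt0.
  rewrite -(ler_pM2l r20).
  have -> : 2 * r * (d * (s / e)) = 2 * (s * r * (d / e)) by ring.
  apply: (le_trans h).
  have -> : 2 * r * (l * r / 2 + w ^+ 2 / (2 * e ^+ 2 * r)) = (s * r) ^+ 2 + w ^+ 2 / e ^+ 2.
    by rewrite exprMn s2; field; rewrite !gt_eqF.
  by rewrite lerD2l expr_div_n ler_wpM2r// invr_ge0 sqr_ge0.
have -> : - w ^+ 2 / r / (e ^+ 2 *+ 2) = - (w ^+ 2 / (2 * e ^+ 2 * r)).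
  by rewrite -mulr_natr; field; rewrite !gt_eqF.
have E : l / 2 * r = l * r / 2 by ring.
rewrite E; move: h2; set a := d * (s / e); set b := w ^+ 2 / _; lra.
Qed.

End GaussLaplace.

Lemma partial_geometric (R : realFieldType) (a th : R) n : 0 <= a -> 0 <= th < 1 ->
  \sum_(0 <= i < n) a * th ^+ i <= a / (1 - th).
Proof.
move=> a0 /andP[th0 th1]; have p : 0 < 1 - th by rewrite subr_gt0.
rewrite -big_distrr/= ler_wpM2l// -[leRHS]mul1r ler_pdivlMr//.
elim: n => [|n IH]; first by rewrite big_nil mul0r.
have H m : (\sum_(0 <= i < m) th ^+ i) * (1 - th) = 1 - th ^+ m.
  elim: m => [|m IHm]; first by rewrite big_nil mul0r expr0 subrr.
  by rewrite big_nat_recr//= mulrDl IHm exprS; ring.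
by rewrite H gerBl exprn_ge0.
Qed.

(** * Green function bounds by decomposition into annuli *)

Section GreenBounds.
Context (R : realType).
Local Notation mu := (@lebesgue_measure R).
Variables (e : R) (e0 : 0 < e).
Variables (k : R -> R) (mk : measurable_fun setT k) (k0 : forall z, 0 <= k z).

Lemma measurable_resolvent l (f : R -> R) : measurable_fun setT f ->
  measurable_fun setT (fun z => resolvent e l (f z)).
Proof.
move=> mf; apply: (@measurable_integral_planel R
  (fun r z => (expR (- (l * r)) * gaussk e r (f z))%:E)).
  apply/measurable_EFinP; apply: measurable_funM.
    apply: (measurableT_comp (@measurable_expR R)).
    by apply: measurable_funN; exact: measurable_funM.
  by apply: measurable_gaussk => //; exact: (measurableT_comp mf).
by move=> r z; rewrite lee_fin mulr_ge0 ?expR_ge0// gaussk_ge0.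
Qed.

Lemma resolvent_ge0 l w : (0 <= resolvent e l w)%E.
Proof. by apply: integral_ge0 => r _; exact: resolvent_integrand_ge0. Qed.

Lemma green_resolvent l y :
  green e k l y = (\int[mu]_z ((k z)%:E * resolvent e l (z - y)))%E.
Proof.
pose g r z := ((expR (- (l * r)))%:E * ((k z)%:E * (gaussk e r (z - y))%:E))%E.
have mEk : measurable_fun setT (fun z : R => (k z)%:E) by exact/measurable_EFinP.
have mg1 r : measurable_fun setT (fun z : R => (k z)%:E * (gaussk e r (z - y))%:E)%E.
  apply: emeasurable_funM => //; apply/measurable_EFinP.
  by apply: measurable_gaussk => //; exact: measurable_funB.
have g10 r z : (0 <= (k z)%:E * (gaussk e r (z - y))%:E)%E.
  by rewrite mule_ge0 ?lee_fin ?gaussk_ge0.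
have E0 r : (0 <= (expR (- (l * r)))%:E :> \bar R)%E by rewrite lee_fin expR_ge0.
have k0' z : (0 <= (k z)%:E)%E by rewrite lee_fin.
have mg : measurable_fun setT (fun p : R * R => g p.1 p.2).
  apply: emeasurable_funM.
    apply/measurable_EFinP; apply: (measurableT_comp (@measurable_expR R)).
    by apply: measurable_funN; exact: measurable_funM.
  apply: emeasurable_funM; first exact: (measurableT_comp mEk).
  by apply/measurable_EFinP; apply: measurable_gaussk => //; exact: measurable_funB.
transitivity (\int[mu]_r \int[mu]_z g r z)%E.
  by apply: eq_integral => r _; rewrite /trans -(lebesgue_integralZl (mg1 r) (g10 r) (E0 r)).
have g0 r z : (0 <= g r z)%E by rewrite mule_ge0.
rewrite (tonelli_plane mg g0); apply: eq_integral => z _.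
rewrite /resolvent -(lebesgue_integralZl (measurable_resolvent_integrand _ _ _)
  (resolvent_integrand_ge0 _ _ _) (k0' z)).
by apply: eq_integral => r _; rewrite /g EFinM muleCA.
Qed.

Section Cells.
Variables (D N : R).
Hypotheses (D0 : 0 < D) (N0 : 0 <= N).
Hypothesis mass : forall y : R, (\int[mu]_(z in `[(y - D)%R, (y + D)%R]) (k z)%:E <= N%:E)%E.

Let restr (A : pred R) z := (if A z then k z else 0)%:E : \bar R.

Let restr_ge0 A z : (0 <= restr A z)%E.
Proof. by rewrite lee_fin; case: ifP. Qed.

Let massE y : (\int[mu]_z restr (fun z : R => z \in `[(y - D)%R, (y + D)%R]) z <= N%:E)%E.
Proof.
apply: le_trans (mass y); rewrite [leRHS]integral_mkcond le_eqVlt; apply/orP; left.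
apply/eqP/eq_integral => z _; rewrite patchE /restr mem_setE.
by case: ifP.
Qed.

Let mrestr (A : pred R) : measurable_fun setT A -> measurable_fun setT (restr A).
Proof. by move=> mA; apply/measurable_EFinP; exact: measurable_fun_ifT. Qed.

Let mitv (a b : R) : measurable_fun setT (fun z : R => z \in `[a, b]).
Proof.
rewrite [X in measurable_fun _ X](_ : _ = fun z => (a <= z) && (z <= b)).
  by apply: measurable_and; exact: measurable_fun_ler.
by apply/funext => z; rewrite in_itv.
Qed.

Let cell j y (z : R) := (j%:R * D <= `|z - y|) && (`|z - y| < j.+1%:R * D).

Let mdist y : measurable_fun setT (fun z : R => `|z - y|).
Proof. by apply: measurableT_comp => //; exact: measurable_funB. Qed.

Let mcell j y : measurable_fun setT (cell j y).
Proof.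
apply: measurable_and; first exact: measurable_fun_ler.
exact: measurable_fun_ltr.
Qed.

(** The annulus has one piece on each side of [y], each of width [D], so each lies in the ball of
    radius [D] around its midpoint. *)
Let cell_mass j y : (\int[mu]_z restr (cell j y) z <= (2 * N)%:E)%E.
Proof.
pose c1 := y + (j%:R + 2^-1) * D; pose c2 := y - (j%:R + 2^-1) * D.
rewrite mulr_natl mulr2n EFinD.
apply: le_trans (leeD (massE c1) (massE c2)).
have m1 (c : R) : measurable_fun setT (restr (fun z : R => z \in `[(c - D)%R, (c + D)%R])).
  by apply: mrestr; exact: mitv.
rewrite -ge0_integralD//; [|exact: m1|exact: m1].
apply: le_lebesgue_integral.
- exact: mrestr.
- exact: emeasurable_funD.
- exact: restr_ge0.
move=> z; rewrite /restr -EFinD lee_fin; case: ifPn => cz; last first.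
  by rewrite addr_ge0//; case: ifP.
have [zy|zy] := leP 0 (z - y).
  rewrite ifT; last first.
    move: cz; rewrite /cell ger0_norm// -natr1 /= => /andP[h1 h2].
    by rewrite in_itv/= /c1; apply/andP; split; lra.
  by rewrite lerDl; case: ifP.
rewrite [X in _ <= _ + X]ifT; last first.
  move: cz; rewrite /cell ltr0_norm// -natr1 /= => /andP[h1 h2].
  by rewrite in_itv/= /c2; apply/andP; split; lra.
by rewrite lerDr; case: ifP.
Qed.

(** On the annulus number j the resolvent is at most a constant times the j-th power of exp (- D
    sqrt l / e); the masses are uniformly bounded, so a geometric series starting at [j0]
    remains. *)
Lemma resolvent_cells l y j0 : 0 < l ->
  (\int[mu]_z ((if (j0%:R * D <= `|z - y|)%R then k z else 0%R)%:E * resolvent e l (z - y)) <=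
   (2 * N * (e * Num.sqrt l)^-1 * expR (- (D * (Num.sqrt l / e))) ^+ j0 /
     (1 - expR (- (D * (Num.sqrt l / e)))))%:E)%E.
Proof.
move=> l0; set th := expR _; set p := (e * Num.sqrt l)^-1.
have s0 : 0 < Num.sqrt l by rewrite sqrtr_gt0.
have p0 : 0 <= p by rewrite invr_ge0 mulr_ge0 ?ltW.
have th0 : 0 <= th by exact: expR_ge0.
have th1 : th < 1.
  by rewrite /th -expR0 ltr_expR oppr_lt0 mulr_gt0// divr_gt0.
pose c i : R := p * th ^+ j0 * th ^+ i.
have c0 i : 0 <= c i by rewrite /c !mulr_ge0// exprn_ge0.
pose t i z := ((c i)%:E * restr (cell (j0 + i) y) z)%E.
have t0 i z : (0 <= t i z)%E by rewrite mule_ge0// lee_fin.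
have mt i : measurable_fun setT (t i) by apply: emeasurable_funM => //; exact: mrestr.
have mt' i : measurable_fun (setT : set (measurableTypeR R)) (t i) by exact: mt.
have step : (\int[mu]_z ((if (j0%:R * D <= `|z - y|)%R then k z else 0%R)%:E
    * resolvent e l (z - y)) <= \int[mu]_z \sum_(i <oo) t i z)%E.
  apply: le_lebesgue_integral.
  - apply: emeasurable_funM.
      apply/measurable_EFinP; apply: measurable_fun_ifT => //.
      exact: measurable_fun_ler.
    by apply: measurable_resolvent; exact: measurable_funB.
  - by apply: ge0_emeasurable_sum.
  - by move=> z; rewrite mule_ge0 ?resolvent_ge0// lee_fin; case: ifP.
  move=> z; case: ifPn => hz; last by rewrite mul0e nneseries_ge0.
  have zy0 : 0 <= `|z - y| / D by rewrite divr_ge0// ltW.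
  (* The index of the annulus containing [z]; the single term of this index already dominates the
     integrand. *)
  pose j := Num.truncn (`|z - y| / D).
  have /andP[j1 j2] := truncn_itv zy0; rewrite -/j in j1 j2.
  have j0j : (j0 <= j)%N by rewrite truncn_ge_nat// ler_pdivlMr.
  have cz : cell (j0 + (j - j0)) y z.
    by rewrite subnKC// /cell -ler_pdivlMr// j1 -ltr_pdivrMr.
  apply: (@le_trans _ _ (t (j - j0)%N z)); last first.
    apply: le_trans (nneseries_lim_ge (j - j0).+1 _) => //.
    by rewrite big_nat_recr//= leeDr// sume_ge0.
  rewrite /t /restr cz muleC lee_wpmul2r ?lee_fin//.
  have jD : 0 <= j%:R * D by rewrite mulr_ge0// ltW.
  have jle : j%:R * D <= `|z - y| by rewrite -ler_pdivlMr.
  apply: le_trans (resolvent_far e0 l0 jD jle) _.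
  rewrite lee_fin /c -mulrA -exprD subnKC// [leRHS]mulrC ler_wpM2r//.
  rewrite /th -expRM_natl le_eqVlt; apply/orP; left; apply/eqP; congr expR; ring.
apply: (le_trans step).
rewrite integral_nneseries//.
apply: (@le_trans _ _ (\sum_(i <oo) (2 * N * p * th ^+ j0 * th ^+ i)%:E)%E).
  apply: lee_nneseries => i *; first by apply: integral_ge0 => z _; exact: t0.
  rewrite (lebesgue_integralZl (mrestr (mcell _ _)) (restr_ge0 _) (c0 i : (0 <= (c i)%:E)%E)).
  apply: (@le_trans _ _ ((c i)%:E * (2 * N)%:E)%E).
    by rewrite lee_wpmul2l ?lee_fin.
  by rewrite -EFinM lee_fin /c le_eqVlt; apply/orP; left; apply/eqP; ring.
apply: lime_le.
  by apply: is_cvg_nneseries => i _ _; rewrite lee_fin !mulr_ge0// exprn_ge0.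
apply: nearW => n; rewrite sumEFin lee_fin; apply: partial_geometric.
  by rewrite !mulr_ge0// exprn_ge0.
by rewrite th0.
Qed.

(** The sharp constant of [resolvent_le] is spent on the ball around [y], since it fixes the
    critical mass; everything beyond falls under [resolvent_cells] with [j0 = 1]. *)
Lemma green_cells l y : 0 < l -> (green e k l y <=
  (N * (e * Num.sqrt (2 * l))^-1 +
   2 * N * (e * Num.sqrt l)^-1 * expR (- (D * (Num.sqrt l / e))) /
     (1 - expR (- (D * (Num.sqrt l / e)))))%:E)%E.
Proof.
move=> l0; rewrite green_resolvent EFinD.
set p := (e * Num.sqrt (2 * l))^-1.
have p0 : (0 <= p%:E)%E.
  by rewrite lee_fin invr_ge0 mulr_ge0 ?sqrtr_ge0 ?ltW.
have m1 : measurable_fun setT (restr (fun z : R => z \in `[(y - D)%R, (y + D)%R])).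
  by apply: mrestr; exact: mitv.
have := resolvent_cells y 1 l0; rewrite expr1 mul1r => far.
apply: (@le_trans _ _ (p%:E * N%:E + \int[mu]_z ((if (D <= `|z - y|)%R then k z else 0%R)%:E *
  resolvent e l (z - y)))%E); last by rewrite [in leRHS]mulrC EFinM leeD2l.
apply: (@le_trans _ _ (p%:E * \int[mu]_z restr (fun z : R => z \in `[(y - D)%R, (y + D)%R]) z +
  \int[mu]_z ((if (D <= `|z - y|)%R then k z else 0%R)%:E *
  resolvent e l (z - y)))%E); last first.
  by rewrite leeD2r// lee_wpmul2l.
have mres : measurable_fun setT (fun z : R => resolvent e l (z - y)).
  by apply: measurable_resolvent; exact: measurable_funB.
have m2 : measurable_fun setT (fun z : R => (if (D <= `|z - y|)%R then k z else 0%R)%:E *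
  resolvent e l (z - y))%E.
  apply: emeasurable_funM => //; apply/measurable_EFinP; apply: measurable_fun_ifT => //.
  exact: measurable_fun_ler.
rewrite -(lebesgue_integralZl m1 (restr_ge0 _) p0) -ge0_integralD//; last 3 first.
- by move=> z _; rewrite mule_ge0.
- exact: emeasurable_funM.
- by move=> z _; rewrite mule_ge0 ?resolvent_ge0// lee_fin; case: ifP.
apply: le_lebesgue_integral.
- by apply: emeasurable_funM => //; exact/measurable_EFinP.
- by apply: emeasurable_funD => //; exact: emeasurable_funM.
- by move=> z; rewrite mule_ge0 ?resolvent_ge0// lee_fin.
move=> z; case: ifPn => hz.
  by rewrite leeDr// mule_ge0.
rewrite mul0e adde0 /restr ifT; last first.
  move: hz; rewrite -ltNge ltr_norml => /andP[h1 h2].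
  by rewrite in_itv/=; apply/andP; split; lra.
by rewrite muleC lee_wpmul2r ?lee_fin//; exact: resolvent_le.
Qed.

End Cells.

End GreenBounds.

(** * Passage of moments to the limit *)

Section MomentLimits.
Context d (Omega : measurableType d) (R : realType) (P : probability Omega R).
Variables (L : Omega -> R) (mL : measurable_fun setT L).

Let mEL : measurable_fun setT (fun w => (L w)%:E).
Proof. exact/measurable_EFinP. Qed.

Lemma exprB_le (a b K : R) m : 0 <= a -> a <= b -> b <= K ->
  b ^+ m.+1 <= a ^+ m.+1 + (m.+1%:R * K ^+ m) * (b - a).
Proof.
move=> a0 ab bK; have b0 := le_trans a0 ab; have K0 := le_trans b0 bK.
rewrite addrC -lerBlDr subrXX mulrC ler_wpM2r ?subr_ge0//.
apply: (@le_trans _ _ (\sum_(i < m.+1) K ^+ m)).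
  apply: ler_sum => i _.
  have im : (i <= m)%N by rewrite -ltnS.
  rewrite (_ : K ^+ m = K ^+ (m - i) * K ^+ i); last by rewrite -exprD subnK.
  rewrite ler_pM ?exprn_ge0// lerXn2r ?nnegrE//.
  exact: le_trans ab bK.
by rewrite sumr_const card_ord mulr_natl.
Qed.

(** Truncation of [|L|] at [n] makes the power Lipschitz on the relevant range, so closeness in mean
    is enough; then [n] tends to infinity by monotone convergence. *)
Lemma moment_limit_le m (Bd : R) :
  (forall eta, 0 < eta -> exists A : Omega -> \bar R,
    [/\ measurable_fun setT A, forall w, (0 <= A w)%E,
      (\int[P]_w `|A w - (L w)%:E| <= eta%:E)%E &
      (\int[P]_w (A w ^+ m.+1) <= Bd%:E)%E]) ->
  (\int[P]_w (`|L w| ^+ m.+1)%:E <= Bd%:E)%E.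
Proof.
move=> H.
pose f (n : nat) w : \bar R := (Num.min `|L w| n%:R ^+ m.+1)%:E.
have f0 n w : (0 <= f n w)%E.
  by rewrite lee_fin exprn_ge0// le_min normr_ge0 ler0n.
have mf n : measurable_fun setT (f n).
  apply/measurable_EFinP; apply: measurable_funX; apply: measurable_minr => //.
  exact: measurableT_comp.
have fB n : (\int[P]_w f n w <= Bd%:E)%E.
  apply/lee_addgt0Pr => h h0.
  (* A Lipschitz constant of the power m + 1 on [0, n]; the added 1 keeps it positive when n = 0. *)
  pose c : R := m.+1%:R * n%:R ^+ m + 1.
  have c0 : 0 < c by rewrite ltr_wpDl// mulr_ge0// exprn_ge0.
  have [A [mA A0 AL AB]] := H (h / c) (divr_gt0 h0 c0).
  have mD : measurable_fun setT (fun w => `|A w - (L w)%:E|)%E.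
    by apply: measurableT_comp => //; exact: emeasurable_funB.
  apply: (@le_trans _ _ (\int[P]_w (A w ^+ m.+1 + c%:E * `|A w - (L w)%:E|))%E).
    apply: ge0_le_integralT => //.
      by apply: emeasurable_funD; [exact: measurable_expe|exact: emeasurable_funM].
    move=> w; move: (A0 w); case: (A w) => [a| |]//.
    - rewrite lee_fin => a0; rewrite -EFinB abse_EFin -?EFin_expe -?EFinM -?EFinD lee_fin.
      set b := Num.min _ _.
      have b0 : 0 <= b by rewrite le_min normr_ge0 ler0n.
      have [ba|ab] := leP b a.
        rewrite (@le_trans _ _ (a ^+ m.+1))//; first by rewrite lerXn2r// nnegrE.
        by rewrite lerDl mulr_ge0// ltW.
      have bn : b <= n%:R by rewrite ge_min lexx orbT.
      apply: le_trans (exprB_le m a0 (ltW ab) bn) _.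
      rewrite lerD2l ler_pM ?mulr_ge0 ?exprn_ge0 ?subr_ge0 ?(ltW ab)//.
        by rewrite /c lerDl.
      have : b <= `|L w| by rewrite ge_min lexx.
      have := lerB_dist (L w) a; have := ger0_norm a0.
      by rewrite distrC; lra.
    - move=> _; rewrite (_ : (+oo ^+ m.+1)%E = +oo%E); last first.
        by elim: (m) => [//|n' IH]; rewrite expeS IH mulyy.
      by rewrite (le_trans (leey _))// leeDl// mule_ge0// lee_fin ltW.
  rewrite ge0_integralD//; last 4 first.
  - by move=> w _; rewrite expe_ge0.
  - exact: measurable_expe.
  - by move=> w _; rewrite mule_ge0// lee_fin ltW.
  - exact: emeasurable_funM.
  rewrite leeD// ge0_integralZlT//; last by rewrite lee_fin ltW.
  apply: (@le_trans _ _ (c%:E * (h / c)%:E)%E).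
    by rewrite lee_wpmul2l// lee_fin ltW.
  by rewrite -EFinM mulrCA divff ?mulr1// gt_eqF.
have cv : (\int[P]_w f n w)%E @[n --> \oo] --> (\int[P]_w (`|L w| ^+ m.+1)%:E)%E.
  have -> : (\int[P]_w (`|L w| ^+ m.+1)%:E = \int[P]_w limn (f ^~ w))%E.
    apply: eq_integral => w _; apply/esym/cvg_lim => //.
    apply: cvg_near_cst; exists (Num.truncn `|L w|).+1 => // n /= hn.
    rewrite /f min_l//; apply: (le_trans (ltW (truncnS_gt _))).
    by rewrite ler_nat.
  apply: cvg_monotone_convergence => // w _ n1 n2 n12.
  rewrite lee_fin lerXn2r ?nnegrE ?le_min ?normr_ge0 ?ler0n//.
  by rewrite ge_min lexx/= ge_min ler_nat n12 orbT.
rewrite -(cvg_lim _ cv)//; apply: lime_le; first by apply/cvg_ex; eexists; exact: cv.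
exact: nearW.
Qed.

(** The power of [A] exceeds that of the positive part of [L] by at most (m + 1) A^m |A - L|.
    Splitting this product into weighted squares calls for mean-square closeness and a bound on the
    moment of order 2m. *)
Lemma moment_limit_ge m (Dm Bd : R) : 0 <= Dm ->
  (forall eta, 0 < eta -> exists A : Omega -> \bar R,
    [/\ measurable_fun setT A, forall w, (0 <= A w)%E,
      (\int[P]_w (`|A w - (L w)%:E| ^+ 2) <= eta%:E)%E,
      (\int[P]_w (A w ^+ (m + m)) <= Dm%:E)%E &
      (Bd%:E <= \int[P]_w (A w ^+ m.+1))%E]) ->
  (Bd%:E <= \int[P]_w (Num.max (L w) 0 ^+ m.+1)%:E)%E.
Proof.
move=> D0 H; apply/lee_addgt0Pr => h h0.
pose c : R := m.+1%:R * (1 + Dm).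
have c0 : 0 < c by rewrite mulr_gt0// ltr_pwDl.
(* The weight in s r <= r^2 / g + g s^2; with mean-square error g^2 the total error is g c = h. *)
pose g := h / c; have g0 : 0 < g by rewrite divr_gt0.
have [A [mA A0 AL AD AB]] := H (g ^+ 2) (exprn_gt0 _ g0).
have mD : measurable_fun setT (fun w => `|A w - (L w)%:E|)%E.
  by apply: measurableT_comp => //; exact: emeasurable_funB.
apply: (le_trans AB).
pose b w := Num.max (L w) 0.
have mb : measurable_fun setT b by exact: measurable_maxr.
have b0 w : 0 <= b w by rewrite le_max lexx orbT.
pose c1 : R := m.+1%:R / g; pose c2 : R := m.+1%:R * g.
have c10 : 0 <= c1 by rewrite divr_ge0// ltW.
have c20 : 0 <= c2 by rewrite mulr_ge0// ltW.
apply: (@le_trans _ _ (\int[P]_w ((b w ^+ m.+1)%:E +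
  (c1%:E * (`|A w - (L w)%:E| ^+ 2) + c2%:E * A w ^+ (m + m))))%E).
  apply: ge0_le_integralT => //.
  - exact: measurable_expe.
  - apply: emeasurable_funD; first by apply/measurable_EFinP; exact: measurable_funX.
    by apply: emeasurable_funD; apply: emeasurable_funM => //; exact: measurable_expe.
  - by move=> w; rewrite expe_ge0.
  move=> w; move: (A0 w); case: (A w) => [a| |]//.
  - rewrite lee_fin => a0; rewrite -EFinB abse_EFin -?EFin_expe -?EFinM -?EFinD lee_fin.
    have [ab|ba] := leP a (b w).
      rewrite (@le_trans _ _ (b w ^+ m.+1))//; first by rewrite lerXn2r// nnegrE.
      by rewrite lerDl addr_ge0// mulr_ge0// exprn_ge0.
    apply: le_trans (exprB_le m (b0 w) (ltW ba) (lexx a)) _; rewrite lerD2l.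
    have aL : a - b w <= `|a - L w|.
      have : L w <= b w by rewrite le_max lexx.
      by have := ler_norm (a - L w); lra.
    have -> : c1 * `|a - L w| ^+ 2 + c2 * a ^+ (m + m) =
       m.+1%:R * (`|a - L w| ^+ 2 / g + g * (a ^+ m) ^+ 2).
      by rewrite /c1 /c2 exprD; ring.
    rewrite -mulrA ler_wpM2l//.
    apply: (@le_trans _ _ (a ^+ m * `|a - L w|)); first by rewrite ler_wpM2l// exprn_ge0.
    set s := a ^+ m; set r := `|a - L w|.
    have s0 : 0 <= s by rewrite exprn_ge0.
    have : 0 <= (r - g * s) ^+ 2 / g by rewrite divr_ge0 ?sqr_ge0 ?ltW.
    have -> : (r - g * s) ^+ 2 / g = r ^+ 2 / g + g * s ^+ 2 - 2 * (s * r).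
      by field; rewrite gt_eqF.
    have sr : 0 <= s * r by exact: mulr_ge0 s0 (normr_ge0 _).
    by lra.
  - move=> _; rewrite (_ : (+oo ^+ 2)%E = +oo%E)//.
    rewrite gt0_muley ?lte_fin ?divr_gt0//.
    apply: (le_trans (leey _)).
    apply: (@le_trans _ _ (+oo + (c2%:E * +oo ^+ (m + m)))%E).
      by rewrite leeDl// mule_ge0// expe_ge0.
    by rewrite leeDr// lee_fin exprn_ge0.
have i1 : measurable_fun setT (fun w => (b w ^+ m.+1)%:E).
  by apply/measurable_EFinP; exact: measurable_funX.
have i2 : measurable_fun setT (fun w => `|A w - (L w)%:E| ^+ 2)%E.
  exact: measurable_expe.
have i3 : measurable_fun setT (fun w => A w ^+ (m + m))%E by exact: measurable_expe.
have j2 w : (0 <= `|A w - (L w)%:E| ^+ 2)%E by rewrite expe_ge0.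
have j3 w : (0 <= A w ^+ (m + m))%E by rewrite expe_ge0.
have c1' : (0 <= c1%:E)%E by rewrite lee_fin.
have c2' : (0 <= c2%:E)%E by rewrite lee_fin.
rewrite ge0_integralD//; last 3 first.
- by move=> w _; rewrite lee_fin exprn_ge0.
- by move=> w _; rewrite adde_ge0// mule_ge0.
- by apply: emeasurable_funD; exact: emeasurable_funM.
rewrite leeD2l// ge0_integralD//; last 4 first.
- by move=> w _; rewrite mule_ge0.
- exact: emeasurable_funM.
- by move=> w _; rewrite mule_ge0.
- exact: emeasurable_funM.
rewrite (ge0_integralZlT P i2 j2 c1') (ge0_integralZlT P i3 j3 c2').
apply: (@le_trans _ _ (c1%:E * (g ^+ 2)%:E + c2%:E * Dm%:E)%E).
  by rewrite leeD// lee_wpmul2l.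
rewrite -!EFinM -EFinD lee_fin /c1 /c2 le_eqVlt; apply/orP; left; apply/eqP.
have -> : m.+1%:R / g * g ^+ 2 + m.+1%:R * g * Dm = g * c.
  by rewrite /c; field; rewrite gt_eqF.
by rewrite /g mulfVK// gt_eqF.
Qed.

(** As A >= 0, the negative part of [L] is at most |A - L|, so the integral of its square is 0. *)
Lemma ae_ge0_limit :
  (forall eta, 0 < eta -> exists A : Omega -> \bar R,
    [/\ measurable_fun setT A, forall w, (0 <= A w)%E &
      (\int[P]_w (`|A w - (L w)%:E| ^+ 2) <= eta%:E)%E]) ->
  {ae P, forall w, 0 <= L w}.
Proof.
move=> H.
pose f w : \bar R := (Num.max (- L w) 0 ^+ 2)%:E.
have mf : measurable_fun setT f.
  apply/measurable_EFinP; apply: measurable_funX; apply: measurable_maxr => //.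
  exact: measurable_funN.
have f0 w : (0 <= f w)%E by rewrite lee_fin sqr_ge0.
have I0 : (\int[P]_w `|f w| = 0)%E.
  under eq_integral do rewrite gee0_abs//.
  apply/eqP; rewrite eq_le integral_ge0// andbT.
  apply/lee_addgt0Pr => h h0; rewrite add0e.
  have [A [mA A0 AL]] := H h h0; apply: le_trans AL.
  apply: ge0_le_integralT => //.
    apply: measurable_expe; apply: measurableT_comp => //; exact: emeasurable_funB.
  move=> w; move: (A0 w); case: (A w) => [a| |]//.
    rewrite lee_fin => a0; rewrite -EFinB abse_EFin -?EFin_expe lee_fin.
    rewrite lerXn2r ?nnegrE ?le_max ?lexx ?orbT// ge_max normr_ge0 andbT.
    by rewrite (le_trans _ (ler_norm _))//; lra.
  by move=> _; rewrite (_ : (+oo ^+ 2)%E = +oo%E)// leey.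
have := (ae_eq_integral_abs P measurableT mf).1 I0.
apply: filterS => w /= /(_ I) [] /eqP; rewrite sqrf_eq0 => /eqP h.
have : - L w <= Num.max (- L w) 0 by rewrite le_max lexx.
by rewrite h oppr_le0.
Qed.

Lemma integral_expR_series (g : Omega -> R) : measurable_fun setT g ->
  (forall w, 0 <= g w) ->
  (\int[P]_w (expR (g w))%:E = \sum_(m <oo) \int[P]_w (g w ^+ m / m`!%:R)%:E)%E.
Proof.
move=> mg g0; rewrite -integral_nneseries//; last 2 first.
- move=> n; apply/measurable_EFinP; apply: measurable_funM => //.
  exact: measurable_funX.
- by move=> n w _; rewrite lee_fin divr_ge0// exprn_ge0.
apply: eq_integral => w _; rewrite /expR -EFin_lim; last exact: is_cvg_series_exp_coeff.
apply: congr_lim; apply/funext => n; rewrite /= /series/= sumEFin.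
by congr EFin; apply: eq_bigr => i _; rewrite /exp_coeff.
Qed.

End MomentLimits.

(** * Vague approximation *)

Section Vague.
Context (R : realType).
Local Notation leb := (@lebesgue_measure R).
Variables (mu : {measure set R -> \bar R}) (mu_ : nat -> {measure set R -> \bar R}).
Variable k : nat -> R -> R.
Hypothesis apx : approximating_measures mu mu_ k.

(** For a < b, a compactly supported continuous function between the indicators of the closed balls
    of radii [a] and [b]: it carries vague convergence over to balls, at the price of a change of
    radius. *)
Definition tent (y a b z : R) : R := Num.max 0 (Num.min 1 ((b - `|z - y|) / (b - a))).

Lemma continuous_tent y a b : continuous (tent y a b).
Proof.
have ex (f g : R -> R) : continuous f -> continuous g ->
    continuous (fun z => Num.max (f z) (g z)).
  move=> cf cg; rewrite (_ : (fun z => _) = (fun z => (f z + g z + `|f z - g z|) / 2)); last first.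
    by apply/funext => z; rewrite maxr_absE.
  move=> z.
  apply: cvgM; last exact: cvg_cst.
  by apply: cvgD; [apply: cvgD; [exact: cf|exact: cg]|apply: cvg_norm; apply: cvgB; [exact: cf|exact: cg]].
have en (f g : R -> R) : continuous f -> continuous g ->
    continuous (fun z => Num.min (f z) (g z)).
  move=> cf cg; rewrite (_ : (fun z => _) = (fun z => (f z + g z - `|f z - g z|) / 2)); last first.
    by apply/funext => z; rewrite minr_absE.
  move=> z.
  apply: cvgM; last exact: cvg_cst.
  by apply: cvgB; [apply: cvgD; [exact: cf|exact: cg]|apply: cvg_norm; apply: cvgB; [exact: cf|exact: cg]].
apply: ex; first by move=> z; exact: cvg_cst.
apply: en; first by move=> z; exact: cvg_cst.
move=> z; apply: cvgM; last exact: cvg_cst.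
apply: cvgB; first exact: cvg_cst.
by apply: cvg_norm; apply: cvgB; [exact: cvg_id|exact: cvg_cst].
Qed.

Lemma tent_ge0 y a b z : 0 <= tent y a b z.
Proof. by rewrite le_max lexx. Qed.

Lemma tent_le1 y a b z : tent y a b z <= 1.
Proof. by rewrite ge_max ler01/= ge_min lexx. Qed.

Lemma tent1 y a b z : a < b -> `|z - y| <= a -> tent y a b z = 1.
Proof.
move=> ab za; rewrite /tent min_l ?max_r//.
by rewrite ler_pdivlMr ?subr_gt0// mul1r lerD2l lerN2.
Qed.

Lemma tent0 y a b z : a < b -> b < `|z - y| -> tent y a b z = 0.
Proof.
move=> ab zb; rewrite /tent max_l// ge_min; apply/orP; right.
by rewrite pmulr_lle0 ?invr_gt0 ?subr_gt0// subr_le0 ltW.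
Qed.

Lemma tent_compact y a b : a < b -> compact (closure [set z | tent y a b z != 0]).
Proof.
move=> ab; apply: (@subclosed_compact _ _ `[y - b, y + b]%classic).
- exact: closed_closure.
- exact: segment_compact.
- have c : closed `[y - b, y + b]%classic by exact: itv_closed.
  rewrite [X in _ `<=` X]((closure_id _).1 c); apply: closure_subset => z /=.
  rewrite in_itv/=; apply: contraR => h; apply/eqP/tent0 => //.
  rewrite ltNge; apply: contra h; rewrite ler_norml => /andP[h1 h2].
  by apply/andP; split; lra.
Qed.

Lemma cvg_tent y a b : a < b ->
  (\int[mu_ n]_z (tent y a b z)%:E)%E @[n --> \oo] --> (\int[mu]_z (tent y a b z)%:E)%E.
Proof.
move=> ab; apply: (approx_vague apx); first exact: continuous_tent.
exact: tent_compact.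
Qed.

Let mtent y a b : measurable_fun setT (fun z => (tent y a b z)%:E).
Proof.
by apply/measurable_EFinP; apply: continuous_measurable_fun; exact: continuous_tent.
Qed.

Lemma integral_indic_ball (m : {measure set R -> \bar R}) y r :
  (\int[m]_z (\1_(`[(y - r)%R, (y + r)%R]%classic) z)%:E = m `[(y - r)%R, (y + r)%R]%classic)%E.
Proof. by rewrite integral_indic// setIT. Qed.

Lemma ball_le_tent (m : {measure set R -> \bar R}) y a b : a < b ->
  (m `[(y - a)%R, (y + a)%R]%classic <= \int[m]_z (tent y a b z)%:E)%E.
Proof.
move=> ab; rewrite -integral_indic_ball; apply: ge0_le_integralT => //.
  by apply/measurable_EFinP; exact: measurable_indic.
move=> z; rewrite lee_fin indicE; case: (boolP (z \in _)) => [|_]; last exact: tent_ge0.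
rewrite inE /= in_itv/= => /andP[h1 h2]; rewrite tent1// ler_norml.
by apply/andP; split; lra.
Qed.

Lemma tent_le_ball (m : {measure set R -> \bar R}) y a b : a < b ->
  (\int[m]_z (tent y a b z)%:E <= m `[(y - b)%R, (y + b)%R]%classic)%E.
Proof.
move=> ab; rewrite -integral_indic_ball; apply: ge0_le_integralT => //.
- by apply/measurable_EFinP; exact: measurable_indic.
- by move=> z; rewrite lee_fin tent_ge0.
move=> z; rewrite lee_fin indicE; case: (boolP (z \in _)) => [_|]; first exact: tent_le1.
rewrite notin_setE /= in_itv/= => /negP h; rewrite tent0// ltNge.
by apply: contra h; rewrite ler_norml => /andP[h1 h2]; apply/andP; split; lra.
Qed.

Lemma vague_lt y a b (M : \bar R) : a < b -> (mu `[(y - b)%R, (y + b)%R]%classic < M)%E ->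
  \forall n \near \oo, (mu_ n `[(y - a)%R, (y + a)%R]%classic < M)%E.
Proof.
move=> ab hM; have h := le_lt_trans (tent_le_ball mu y ab) hM.
have N : \forall n \near \oo, (\int[mu_ n]_z (tent y a b z)%:E < M)%E.
  exact: cvg_tent (open_ereal_lt' h).
by apply: filterS N => n; apply: le_lt_trans; exact: ball_le_tent.
Qed.

Lemma vague_gt y r (c : \bar R) : 0 < r -> (c < mu [set y])%E ->
  \forall n \near \oo, (c < mu_ n `[(y - r)%R, (y + r)%R]%classic)%E.
Proof.
move=> r0 hc; have h : (c < \int[mu]_z (tent y 0 r z)%:E)%E.
  apply: lt_le_trans hc _; apply: le_trans (ball_le_tent mu y r0).
  by rewrite subr0 addr0 set_itv1.
have N : \forall n \near \oo, (c < \int[mu_ n]_z (tent y 0 r z)%:E)%E.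
  exact: cvg_tent (open_ereal_gt' h).
by apply: filterS N => n hn; apply: lt_le_trans hn _; exact: tent_le_ball.
Qed.

(** Compactness of the set of centres: part of the gap between the radii pays for the passage to the
    limit, the rest for moving the centre. *)
Lemma vague_uniform_lt c1 c2 a b (M : \bar R) : 0 < a -> a < b ->
  (forall y, c1 <= y <= c2 -> (mu `[(y - b)%R, (y + b)%R]%classic < M)%E) ->
  \forall n \near \oo, forall y, c1 <= y <= c2 ->
    (mu_ n `[(y - a)%R, (y + a)%R]%classic < M)%E.
Proof.
move=> a0 ab H.
have K := @segment_compact R c1 c2; move/compact_near_coveringP in K.
pose Q n y := (mu_ n `[(y - a)%R, (y + a)%R]%classic < M)%E.
have N : \forall n \near \oo, `[c1, c2]%classic `<=` Q n.
  apply: K => y /=; rewrite in_itv/= => yc.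
  (* Half of the gap is kept for moving the centre by less than [r]. *)
  pose r := (b - a) / 2; have r0 : 0 < r by rewrite divr_gt0// subr_gt0.
  have ab' : a + r < b by rewrite /r; lra.
  have h := vague_lt ab' (H y yc).
  exists (ball y r, [set n | (mu_ n `[(y - (a + r))%R, (y + (a + r))%R]%classic < M)%E]) => /=.
    by split => //; exact: nbhsx_ballx.
  move=> [y' n] /= [yy' hn]; rewrite /Q; apply: le_lt_trans hn.
  apply: le_measure; rewrite ?inE//; apply: subset_itv; rewrite bnd_simp.
    by move: yy'; rewrite /ball/= ltr_norml => /andP[]; lra.
  by move: yy'; rewrite /ball/= ltr_norml => /andP[]; lra.
by apply: filterS N => n hQ y yc; apply: hQ; rewrite /= in_itv.
Qed.

End Vague.

(** * Approximating functionals in mean square *)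

Section Approximation.
Context d (Omega : measurableType d) (R : realType) (P : probability Omega R).
Variables (B : R -> {RV P >-> R}) (hB : wiener_process P B).
Local Notation mu := (@lebesgue_measure R).
Variables (x e t : R) (e0 : 0 < e).

Lemma addfD (k1 k2 : R -> R) w : measurable_fun setT k1 -> measurable_fun setT k2 ->
  (forall z, 0 <= k1 z) -> (forall z, 0 <= k2 z) ->
  (addf B x e (k1 \+ k2)%R t w = addf B x e k1 t w + addf B x e k2 t w)%E.
Proof.
move=> mk1 mk2 k10 k20.
have mc k : measurable_fun setT k -> measurable_fun setT
    (fun u : R => (if u < t then occ B x e k u w else 0)%:E).
  move=> mk; apply/measurable_EFinP; apply: measurable_fun_ifT => //.
    exact: measurable_fun_ltr.
  have mp : measurable_fun setT (fun u : R => (u, w)) by exact: measurable_fun_pair.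
  exact: (measurableT_comp (measurable_occ hB x e mk) mp).
have c0 k u : (forall z, 0 <= k z) -> (0 <= (if u < t then occ B x e k u w else 0)%:E :> \bar R)%E.
  by move=> k0; rewrite lee_fin; case: ifP => // _; exact: occ_ge0.
rewrite /addf /cumul -[RHS](@ge0_integralD _ (measurableTypeR R) R mu setT measurableT
  _ _ (fun u _ => c0 k1 u k10) (mc k1 mk1) (fun u _ => c0 k2 u k20) (mc k2 mk2)).
apply: eq_integral => u _; rewrite -EFinD; congr EFin; rewrite /occ.
by case: ifP => _; rewrite ?addr0//; case: ifP => _; rewrite ?addr0.
Qed.

Lemma addfZ (c : R) (k : R -> R) w : 0 <= c -> measurable_fun setT k ->
  (forall z, 0 <= k z) ->
  (addf B x e (fun z => c * k z)%R t w = c%:E * addf B x e k t w)%E.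
Proof.
move=> c0 mk k0.
have mc : measurable_fun setT (fun u : R => (if u < t then occ B x e k u w else 0)%:E).
  apply/measurable_EFinP; apply: measurable_fun_ifT => //.
    exact: measurable_fun_ltr.
  have mp : measurable_fun setT (fun u : R => (u, w)) by exact: measurable_fun_pair.
  exact: (measurableT_comp (measurable_occ hB x e mk) mp).
have h0 u : (0 <= (if u < t then occ B x e k u w else 0)%:E :> \bar R)%E.
  by rewrite lee_fin; case: ifP => // _; exact: occ_ge0.
have c0' : (0 <= c%:E)%E by rewrite lee_fin.
rewrite /addf /cumul -(lebesgue_integralZl mc h0 c0').
apply: eq_integral => u _; rewrite -EFinM; congr EFin; rewrite /occ.
by case: ifP => _; rewrite ?mulr0//; case: ifP => _; rewrite ?mulr0.
Qed.

Lemma le_addf (k1 k2 : R -> R) w : measurable_fun setT k1 -> measurable_fun setT k2 ->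
  (forall z, 0 <= k1 z) -> (forall z, k1 z <= k2 z) ->
  (addf B x e k1 t w <= addf B x e k2 t w)%E.
Proof.
move=> mk1 mk2 k10 k12.
have mc k : measurable_fun setT k -> measurable_fun setT
    (fun u : R => (if u < t then occ B x e k u w else 0)%:E).
  move=> mk; apply/measurable_EFinP; apply: measurable_fun_ifT => //.
    exact: measurable_fun_ltr.
  have mp : measurable_fun setT (fun u : R => (u, w)) by exact: measurable_fun_pair.
  exact: (measurableT_comp (measurable_occ hB x e mk) mp).
apply: le_lebesgue_integral; [exact: mc|exact: mc| |].
  by move=> u; rewrite lee_fin; case: ifP => // _; exact: occ_ge0.
by move=> u; rewrite lee_fin /occ; case: ifP => // _; case: ifP.
Qed.

Section Functional.
Variables (k : R -> R) (mk : measurable_fun setT k) (k0 : forall z, 0 <= k z).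
Local Notation F := (integral_functional (fun s w => x + e * B s w) k t).

(** The offset [e * B 0 w] has to stay, since it vanishes only almost surely; in this form joint
    measurability follows from that of [wpos]. *)
Let F_E w : F w = (\int[mu]_s (if 0 <= s <= t then k (wpos B x e s w + e * B 0 w) else 0)%:E)%E.
Proof.
rewrite /integral_functional integral_mkcond; apply: eq_integral => s _.
rewrite patchE mem_setE in_itv/=; case: ifPn => // /andP[s0 _].
by rewrite /wpos /wpath max_l//; congr (k _)%:E; ring.
Qed.

Let mint : measurable_fun setT (fun p : R * Omega =>
  (if 0 <= p.1 <= t then k (wpos B x e p.1 p.2 + e * B 0 p.2) else 0)%:E).
Proof.
apply/measurable_EFinP; apply: measurable_fun_ifT => //.
  by apply: measurable_and; exact: measurable_fun_ler.
apply: (measurableT_comp mk); apply: measurable_funD.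
  exact: measurable_wpos_joint.
by apply: measurable_funM => //; exact: measurableT_comp.
Qed.

Lemma measurable_functional : measurable_fun setT F.
Proof.
rewrite (_ : F = fun w => (\int[mu]_s (if 0 <= s <= t then
    k (wpos B x e s w + e * B 0 w) else 0)%:E)%E); last exact/funext.
apply: (@measurable_integral_lebesgue _ Omega R (fun s w => (if 0 <= s <= t then
    k (wpos B x e s w + e * B 0 w) else 0)%:E) mint).
by move=> s w; rewrite lee_fin; case: ifP.
Qed.

(** The two differ by the offset of the start, zero almost surely, and by the endpoint s = t. *)
Lemma functional_ae : {ae P, forall w, F w = addf B x e k t w}.
Proof.
have := wiener_start hB; apply: filterS => w B0; rewrite F_E.
apply: (@eq_integral_off _ t).
- have mp : measurable_fun setT (fun s : R => (s, w)) by exact: measurable_fun_pair.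
  exact: (measurableT_comp mint mp).
- apply/measurable_EFinP; apply: measurable_fun_ifT => //.
    exact: measurable_fun_ltr.
  have mp : measurable_fun setT (fun u : R => (u, w)) by exact: measurable_fun_pair.
  exact: (measurableT_comp (measurable_occ hB x e mk) mp).
move=> s st; rewrite B0 mulr0 addr0 /occ (le_eqVlt s) (negbTE st)/=.
by case: (0 <= s); case: (s < t).
Qed.

End Functional.

Lemma addf_l2 (k : nat -> R -> R) (L : {RV P >-> R}) :
  (forall n, measurable_fun setT (k n)) -> (forall n z, 0 <= k n z) ->
  (Lnorm P 2%:E (fun w => integral_functional (fun s w => (x + e * B s w)%R) (k n) t w
     - (L w)%:E)%E @[n --> \oo] --> 0%E) ->
  forall eta, 0 < eta -> \forall n \near \oo,
    (\int[P]_w (`|addf B x e (k n) t w - (L w)%:E| ^+ 2) <= eta%:E)%E.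
Proof.
move=> mk k0 cv eta eta0.
have s0 : 0 < Num.sqrt eta by rewrite sqrtr_gt0.
have N : \forall n \near \oo, (Lnorm P 2%:E (fun w =>
    integral_functional (fun s w => (x + e * B s w)%R) (k n) t w - (L w)%:E)%E < (Num.sqrt eta)%:E)%E.
  by apply: cv (open_ereal_lt' _); rewrite lte_fin.
apply: filterS N => n hn.
have mEL : measurable_fun setT (fun w => (L w)%:E) by exact/measurable_EFinP.
have -> : (\int[P]_w (`|addf B x e (k n) t w - (L w)%:E| ^+ 2) =
   \int[P]_w (`|integral_functional (fun s w => (x + e * B s w)%R) (k n) t w - (L w)%:E| `^ 2%R))%E.
  apply: ge0_ae_eq_integral => //.
  - apply: measurable_expe; apply: measurableT_comp => //.
    by apply: emeasurable_funB => //; exact: measurable_addfE.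
  - apply: (measurableT_comp (measurable_poweR _)); apply: measurableT_comp => //.
    by apply: emeasurable_funB => //; exact: measurable_functional.
  - by move=> w _; rewrite expe_ge0.
  - by move=> w _; exact: poweR_ge0.
  - apply: filterS (functional_ae (mk n)) => w h _; rewrite h.
    have := abse_ge0 (addf B x e (k n) t w - (L w)%:E)%E.
    case: (`|_|)%E => [r| |]// r0; last by rewrite poweRyr.
    by rewrite poweR_EFin powR_mulrn// EFin_expe.
rewrite -poweR_Lnorm//.
apply: (@le_trans _ _ ((Num.sqrt eta)%:E `^ 2%R)%E).
  by apply: gt0_ler_poweR => //; rewrite ?in_itv/= ?leey ?andbT ?Lnorm_ge0 ?lee_fin ?(ltW s0)// ltW.
by rewrite poweR_EFin powR_mulrn ?sqrtr_ge0// sqr_sqrtr// ltW.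
Qed.

(** Cauchy-Schwarz up to a factor 2, from the pointwise bound a <= h + a^2 / h. *)
Lemma integral_l1_l2 (f : Omega -> \bar R) (h : R) : 0 < h ->
  measurable_fun setT f -> (forall w, 0 <= f w)%E ->
  (\int[P]_w (f w ^+ 2) <= (h ^+ 2)%:E)%E -> (\int[P]_w f w <= (2 * h)%:E)%E.
Proof.
move=> h0 mf f0 H.
have hi : (0 <= (h^-1)%:E)%E by rewrite lee_fin invr_ge0 ltW.
apply: (@le_trans _ _ (\int[P]_w (h%:E + (h^-1)%:E * f w ^+ 2))%E).
  apply: ge0_le_integralT => //.
    apply: emeasurable_funD => //; apply: emeasurable_funM => //; exact: measurable_expe.
  move=> w; move: (f0 w); case: (f w) => [a| |]//.
    rewrite lee_fin => a0; rewrite -EFin_expe -EFinM -EFinD lee_fin.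
    have : 0 <= (a - h) ^+ 2 / h by rewrite divr_ge0 ?sqr_ge0 ?ltW.
    have -> : (a - h) ^+ 2 / h = h + h^-1 * a ^+ 2 - 2 * a by field; rewrite gt_eqF.
    by lra.
  move=> _; rewrite (_ : (+oo ^+ 2)%E = +oo%E)// gt0_muley ?lte_fin ?invr_gt0//.
rewrite ge0_integralD//; last 3 first.
- by move=> w _; rewrite lee_fin ltW.
- by move=> w _; rewrite mule_ge0// expe_ge0.
- by apply: emeasurable_funM => //; exact: measurable_expe.
rewrite ge0_integralZlT//; last 2 first.
- exact: measurable_expe.
- by move=> w; rewrite expe_ge0.
rewrite integral_cst//= probability_setT mule1 (_ : 2 * h = h + h^-1 * h ^+ 2); last first.
  by field; rewrite gt_eqF.
by rewrite EFinD leeD2l// EFinM lee_wpmul2l.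
Qed.

End Approximation.

(** * Exponential moments of the local time *)

Section Truncation.
Context (R : realType).
Local Notation leb := (@lebesgue_measure R).

(** A ball of radius D <= 1 whose centre is farther than r + 1 from [x] misses the cut density, so a
    bound for nearby centres holds for all. *)
Lemma mass_cut (kk : R -> R) (C : pred R) (x r D N c : R) :
  measurable_fun setT kk -> measurable_fun setT C -> (forall z, 0 <= kk z) ->
  0 <= c -> 0 <= N -> 0 < D <= 1 -> (forall z, C z -> `|z - x| <= r) ->
  (forall y, x - r - 1 <= y <= x + r + 1 ->
    (\int[leb]_(z in `[(y - D)%R, (y + D)%R]) (kk z)%:E <= N%:E)%E) ->
  forall y, (\int[leb]_(z in `[(y - D)%R, (y + D)%R])
    (c * (if C z then kk z else 0))%:E <= (c * N)%:E)%E.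
Proof.
move=> mk mC k0 c0 N0 /andP[D0 D1] Cr H y.
have mk' : measurable_fun (`[(y - D)%R, (y + D)%R]%classic : set (measurableTypeR R))
    (fun z => (kk z)%:E).
  by apply: measurable_funTS; apply/measurable_EFinP.
have mI : measurable (`[(y - D)%R, (y + D)%R]%classic : set (measurableTypeR R)).
  exact: measurable_itv.
have [yr|yr] := boolP (x - r - 1 <= y <= x + r + 1).
  rewrite EFinM; apply: (@le_trans _ _ (\int[leb]_(z in `[(y - D)%R, (y + D)%R]) (c%:E * (kk z)%:E))%E).
    apply: ge0_le_integral => //.
    - by move=> z _; rewrite lee_fin mulr_ge0//; case: ifP.
    - apply: measurable_funTS; apply/measurable_EFinP.
      apply: measurable_funM => //; exact: measurable_fun_ifT.
    - exact: emeasurable_funM.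
    - move=> z _; rewrite -EFinM lee_fin ler_wpM2l//.
      by case: ifP.
  have k0' z : `[(y - D)%R, (y + D)%R]%classic z -> (0 <= (kk z)%:E)%E by rewrite lee_fin.
  have c0' : (0 <= c%:E)%E by rewrite lee_fin.
  rewrite (ge0_integralZl leb mI mk' k0' c0').
  by apply: lee_wpmul2l => //; exact: H.
rewrite integral0_eq; first by rewrite lee_fin mulr_ge0.
move=> z /=; rewrite in_itv/= => /andP[h1 h2]; case: ifPn => [/Cr|]; last by rewrite mulr0.
rewrite ler_norml => /andP[h3 h4]; move: yr; rewrite negb_and -!ltNge.
by case/orP => ?; exfalso; lra.
Qed.

Lemma abse_leD (a c : \bar R) (l : R) : (0 <= a)%E -> (0 <= c)%E ->
  (`|a - l%:E| <= `|(a + c) - l%:E| + c)%E.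
Proof.
case: a => [a| |]//; case: c => [c| |]//; rewrite ?lee_fin => a0 c0.
- change ((`|a - l|%R)%:E <= (`|a + c - l| + c)%:E)%E; rewrite lee_fin.
  have -> : a - l = (a + c - l) - c by ring.
  by rewrite (le_trans (ler_normB _ _))// (ger0_norm c0).
- by rewrite ?addey ?leey.
Qed.

(* Either b <= (p - 1) a, so a + b <= p a, or a < b / (p - 1), so
   a + b <= p / (p - 1) b. *)
Lemma expeD_le (a b : \bar R) (p : R) m : 1 < p -> (0 <= a)%E -> (0 <= b)%E ->
  ((a + b) ^+ m.+1 <= (p%:E * a) ^+ m.+1 + ((p / (p - 1))%:E * b) ^+ m.+1)%E.
Proof.
move=> p1; have p0 : 0 < p by rewrite (lt_trans _ p1).
have q0 : 0 < p - 1 by rewrite subr_gt0.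
have inf n : (+oo ^+ n.+1 = +oo :> \bar R)%E.
  by elim: n => [//|n' IH]; rewrite expeS IH mulyy.
case: a => [a| |]//; case: b => [b| |]//; rewrite ?lee_fin ?lee_fin => a0 b0.
- rewrite -EFinD -!EFinM -!EFin_expe -EFinD lee_fin.
  have pa0 : 0 <= p * a by rewrite mulr_ge0 ?(ltW p0).
  have qb0 : 0 <= p / (p - 1) * b by rewrite mulr_ge0 ?divr_ge0 ?(ltW p0) ?(ltW q0).
  have ab0 : 0 <= a + b by rewrite addr_ge0.
  have [h|h] := leP b ((p - 1) * a).
    have h1 : a + b <= p * a by lra.
    by rewrite (le_trans (lerXn2r m.+1 ab0 pa0 h1))// lerDl exprn_ge0.
  have h1 : a + b <= p / (p - 1) * b.
    rewrite -subr_ge0 (_ : _ - _ = (b - (p - 1) * a) / (p - 1)).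
      by rewrite divr_ge0 ?(ltW q0) ?subr_ge0 ?(ltW h).
    by field; rewrite gt_eqF.
  by rewrite (le_trans (lerXn2r m.+1 ab0 qb0 h1))// lerDr exprn_ge0.
- rewrite gt0_muley ?lte_fin ?divr_gt0// inf.
  by rewrite (le_trans (leey _))// leeDr// expe_ge0// mule_ge0 ?lee_fin ?(ltW p0).
- rewrite (gt0_muley (x := p%:E)) ?lte_fin// inf.
  by rewrite (le_trans (leey _))// leeDl// expe_ge0// mule_ge0 ?lee_fin ?divr_ge0 ?(ltW p0) ?(ltW q0).
- rewrite (gt0_muley (x := p%:E)) ?lte_fin// inf.
  rewrite (le_trans (leey _))// leeDl// expe_ge0// mule_ge0 ?lee_fin ?divr_ge0 ?(ltW p0) ?(ltW q0)//.
Qed.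

(* The bounds of green_cells (cells of radius D, mass at most N on each) and of
   resolvent_cells (unit cells at distance at least j). *)
Definition green_ub (e D N l : R) : R := N * (e * Num.sqrt (2 * l))^-1 +
   2 * N * (e * Num.sqrt l)^-1 * expR (- (D * (Num.sqrt l / e))) /
     (1 - expR (- (D * (Num.sqrt l / e)))).

Definition tail_ub (e N l : R) (j : nat) : R :=
  2 * N * (e * Num.sqrt l)^-1 * expR (- (Num.sqrt l / e)) ^+ j /
     (1 - expR (- (Num.sqrt l / e))).

Lemma green_ub_ge0 e D N l : 0 < e -> 0 < D -> 0 <= N -> 0 < l -> 0 <= green_ub e D N l.
Proof.
move=> e0 D0 N0 l0; have s0 : 0 < Num.sqrt l by rewrite sqrtr_gt0.
have h : expR (- (D * (Num.sqrt l / e))) <= 1.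
  by rewrite -expR0 ler_expR oppr_le0 mulr_ge0 ?divr_ge0 ?(ltW s0) ?(ltW e0) ?(ltW D0).
rewrite /green_ub addr_ge0//.
  by rewrite mulr_ge0 ?invr_ge0 ?mulr_ge0 ?sqrtr_ge0 ?(ltW e0).
rewrite mulr_ge0 ?invr_ge0 ?subr_ge0// mulr_ge0 ?expR_ge0//.
by rewrite !mulr_ge0 ?invr_ge0 ?mulr_ge0 ?(ltW s0) ?(ltW e0).
Qed.

Lemma tail_ub_ge0 e N l j : 0 < e -> 0 <= N -> 0 < l -> 0 <= tail_ub e N l j.
Proof.
move=> e0 N0 l0; have s0 : 0 < Num.sqrt l by rewrite sqrtr_gt0.
have h : expR (- (Num.sqrt l / e)) <= 1.
  by rewrite -expR0 ler_expR oppr_le0 divr_ge0 ?(ltW s0) ?(ltW e0).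
rewrite /tail_ub mulr_ge0 ?invr_ge0 ?subr_ge0// mulr_ge0 ?exprn_ge0 ?expR_ge0//.
by rewrite !mulr_ge0 ?invr_ge0 ?mulr_ge0 ?(ltW s0) ?(ltW e0).
Qed.

Lemma tail_ub_cvg e N l c : 0 < e -> 0 <= N -> 0 < l -> 0 < c ->
  \forall j \near \oo, tail_ub e N l j < c.
Proof.
move=> e0 N0 l0 c0; have s0 : 0 < Num.sqrt l by rewrite sqrtr_gt0.
have h : expR (- (Num.sqrt l / e)) < 1.
  by rewrite -expR0 ltr_expR oppr_lt0 divr_gt0.
have h0 : `|expR (- (Num.sqrt l / e))| < 1 by rewrite ger0_norm ?expR_ge0.
pose a : R := 2 * N * (e * Num.sqrt l)^-1 / (1 - expR (- (Num.sqrt l / e))).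
have cv : a * expR (- (Num.sqrt l / e)) ^+ j @[j --> \oo] --> a * 0.
  by apply: cvgM; [exact: cvg_cst|exact: cvg_expr].
rewrite mulr0 in cv; move/cvgrPdist_lt : cv => /(_ c c0); apply: filterS => j.
rewrite sub0r normrN => /(le_lt_trans (ler_norm _)); apply: le_lt_trans.
by rewrite /tail_ub /a le_eqVlt; apply/orP; left; apply/eqP; ring.
Qed.

End Truncation.

(** Smallness at the single point [x] only, to be used for the factor [green x] of
    [addf_moment_le]. *)
Lemma green_tail (R : realType) (e : R) (e0 : 0 < e) (k : R -> R) (N : R) j l x :
  measurable_fun setT k -> (forall z, 0 <= k z) -> 0 <= N -> 0 < l ->
  (forall y, (\int[@lebesgue_measure R]_(z in `[(y - 1)%R, (y + 1)%R]) (k z)%:E <= N%:E)%E) ->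
  (forall z, k z != 0 -> j%:R <= `|z - x|) ->
  (green e k l x <= (tail_ub e N l j)%:E)%E.
Proof.
move=> mk k0 N0 l0 mass supp; rewrite green_resolvent//.
have := resolvent_cells e0 mk k0 ltr01 N0 mass x j l0.
rewrite !mul1r mulr1 -/(tail_ub e N l j); apply: le_trans.
rewrite le_eqVlt; apply/orP; left; apply/eqP/eq_integral => z _.
case: ifPn => // h; have [->//|/supp h'] := eqVneq (k z) 0.
by rewrite h' in h.
Qed.

Section TwoScales.
Context d (Omega : measurableType d) (R : realType) (P : probability Omega R).
Variables (B : R -> {RV P >-> R}) (hB : wiener_process P B).
Local Notation leb := (@lebesgue_measure R).
Variables (x e t : R) (e0 : 0 < e).

(** For m = 0 the uniform bound on the Green function enters with exponent 0, so any finite bound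
    will do, and rate 1 is as good as any. *)
Lemma addf_mean_tail (k : R -> R) (N : R) j :
  measurable_fun setT k -> (forall z, 0 <= k z) -> 0 <= N ->
  (forall y, (\int[leb]_(z in `[(y - 1)%R, (y + 1)%R]) (k z)%:E <= N%:E)%E) ->
  (forall z, k z != 0 -> j%:R <= `|z - x|) ->
  (\int[P]_w addf B x e k t w <= (expR t * tail_ub e N 1 j)%:E)%E.
Proof.
move=> mk k0 N0 mass supp.
have gr y := green_cells e0 mk k0 ltr01 N0 mass y ltr01.
have := addf_moment_le hB x e0 mk k0 ler01 gr t 0.
rewrite (_ : 1`! = 1%N)// expr0 mulr1 !mul1r => /le_trans; apply.
by rewrite EFinM lee_wpmul2l ?lee_fin ?expR_ge0//; exact: green_tail.
Qed.

(** The conjugate factors of [expeD_le] are absorbed into the densities. The remote part [k2] may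
    need a large rate [l2] to bring its ratio down to 1/2; the resulting exp (l2 t) is to be offset
    by [tail_ub]. *)
Lemma two_scale_moment (k1 k2 : R -> R) (p D N1 l1 Q1 N2 l2 : R) j m :
  measurable_fun setT k1 -> (forall z, 0 <= k1 z) ->
  measurable_fun setT k2 -> (forall z, 0 <= k2 z) ->
  1 < p -> 0 < D -> 0 <= N1 -> 0 < l1 -> 0 <= N2 -> 0 < l2 ->
  (forall y, (\int[leb]_(z in `[(y - D)%R, (y + D)%R]) (p * k1 z)%:E <= N1%:E)%E) ->
  green_ub e D N1 l1 <= Q1 ->
  (forall y, (\int[leb]_(z in `[(y - 1)%R, (y + 1)%R]) (p / (p - 1) * k2 z)%:E <= N2%:E)%E) ->
  green_ub e 1 N2 l2 <= 2^-1 ->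
  (forall z, k2 z != 0 -> j%:R <= `|z - x|) ->
  (\int[P]_w ((addf B x e k1 t w + addf B x e k2 t w) ^+ m.+1) <=
   (m.+1`!%:R * (expR (l1 * t) * Q1 * Q1 ^+ m
     + expR (l2 * t) * tail_ub e N2 l2 j * 2^-1 ^+ m))%:E)%E.
Proof.
move=> mk1 k10 mk2 k20 p1 D0 N10 l10 N20 l20 mass1 gr1 mass2 gr2 supp.
have p0 : 0 <= p by rewrite ltW// (lt_trans _ p1).
have q0 : 0 <= p / (p - 1) by rewrite divr_ge0// subr_ge0 ltW.
have mpk1 : measurable_fun setT (fun z : R => p * k1 z) by exact: measurable_funM.
have mqk2 : measurable_fun setT (fun z : R => p / (p - 1) * k2 z) by exact: measurable_funM.
have pk10 z : 0 <= p * k1 z by rewrite mulr_ge0.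
have qk20 z : 0 <= p / (p - 1) * k2 z by rewrite mulr_ge0.
have g1 y : (green e (fun z => p * k1 z)%R l1 y <= Q1%:E)%E.
  by apply: le_trans (green_cells e0 mpk1 pk10 D0 N10 mass1 y l10) _; rewrite lee_fin.
have g2 y : (green e (fun z => p / (p - 1) * k2 z)%R l2 y <= (2^-1)%:E)%E.
  by apply: le_trans (green_cells e0 mqk2 qk20 ltr01 N20 mass2 y l20) _; rewrite lee_fin.
have Q10 : 0 <= Q1.
  rewrite -lee_fin; apply: le_trans (g1 0); apply: integral_ge0 => r _.
  rewrite mule_ge0 ?lee_fin ?expR_ge0//; apply: integral_ge0 => z _.
  by rewrite mule_ge0 ?lee_fin ?gaussk_ge0.
have M1 := addf_moment_le hB x e0 mpk1 pk10 (ltW l10) g1 t m.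
have M2 := addf_moment_le hB x e0 mqk2 qk20 (ltW l20) g2 t m.
have A1m := measurable_expe m.+1 (measurable_addfE hB x e mpk1 pk10 t).
have A2m := measurable_expe m.+1 (measurable_addfE hB x e mqk2 qk20 t).
have A1 w : (0 <= addf B x e (fun z => p * k1 z)%R t w ^+ m.+1)%E by rewrite expe_ge0// addf_ge0.
have A2 w : (0 <= addf B x e (fun z => p / (p - 1) * k2 z)%R t w ^+ m.+1)%E.
  by rewrite expe_ge0// addf_ge0.
apply: (@le_trans _ _ (\int[P]_w (addf B x e (fun z => p * k1 z)%R t w ^+ m.+1
   + addf B x e (fun z => p / (p - 1) * k2 z)%R t w ^+ m.+1))%E).
  apply: ge0_le_integralT.
  - apply: measurable_expe; apply: emeasurable_funD; exact: measurable_addfE.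
  - exact: emeasurable_funD.
  - by move=> w; rewrite expe_ge0// adde_ge0// addf_ge0.
  move=> w; rewrite (addfZ hB _ _ _ w p0 mk1 k10) (addfZ hB _ _ _ w q0 mk2 k20).
  by apply: expeD_le => //; exact: addf_ge0.
rewrite (ge0_integralD P measurableT (fun w _ => A1 w) A1m (fun w _ => A2 w) A2m).
rewrite mulrDr EFinD; apply: leeD.
  apply: le_trans M1 _.
  have c0 : (0 <= (m.+1`!%:R * expR (l1 * t) * Q1 ^+ m)%:E)%E.
    by rewrite lee_fin !mulr_ge0 ?expR_ge0 ?exprn_ge0.
  apply: le_trans (lee_wpmul2l c0 (g1 x)) _; rewrite -EFinM lee_fin.
  by rewrite le_eqVlt; apply/orP; left; apply/eqP; ring.
apply: le_trans M2 _.
have c0 : (0 <= (m.+1`!%:R * expR (l2 * t) * 2^-1 ^+ m)%:E)%E.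
  by rewrite lee_fin !mulr_ge0 ?expR_ge0 ?exprn_ge0 ?invr_ge0.
have supp' z : p / (p - 1) * k2 z != 0 -> j%:R <= `|z - x|.
  by rewrite mulf_eq0 negb_or => /andP[_]; exact: supp.
apply: le_trans (lee_wpmul2l c0 (green_tail e0 mqk2 qk20 N20 l20 mass2 supp')) _.
by rewrite -EFinM lee_fin le_eqVlt; apply/orP; left; apply/eqP; ring.
Qed.

End TwoScales.

(** * Upper bound for the local time *)

Section UpperMoments.
Context d (Omega : measurableType d) (R : realType) (P : probability Omega R).
Variables (B : R -> {RV P >-> R}) (hB : wiener_process P B).
Local Notation leb := (@lebesgue_measure R).
Variables (x e t : R) (e0 : 0 < e).
Variables (mu : {measure set R -> \bar R}) (mu_ : nat -> {measure set R -> \bar R}).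
Variable k : nat -> R -> R.
Hypothesis apx : approximating_measures mu mu_ k.
Variable L : {RV P >-> R}.
Hypothesis cv : Lnorm P 2%:E (fun w => integral_functional (fun s w => (x + e * B s w)%R) (k n) t w
     - (L w)%:E)%E @[n --> \oo] --> 0%E.

Lemma approx_mass_bound : exists2 M : R, 0 <= M &
  forall n y, (\int[leb]_(z in `[(y - 1)%R, (y + 1)%R]) (k n z)%:E <= M%:E)%E.
Proof.
have := approx_bounded apx; set S := ereal_sup _ => S1.
have S2 n y : (mu_ n `[(y - 1)%R, (y + 1)%R]%classic <= S)%E.
  apply: (@le_trans _ _ (ereal_sup (range (fun x : R => mu_ n `[(x - 1)%R, (x + 1)%R]%classic)))).
    by apply: ereal_sup_ubound; exists y.
  by apply: ereal_sup_ubound; exists n.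
have S0 : (0 <= S)%E by apply: le_trans (S2 0%N 0).
have Sf : S \is a fin_num by rewrite ge0_fin_numE.
exists (fine S); first exact: fine_ge0.
by move=> n y; rewrite fineK// -(approx_density apx).
Qed.

Variables (p D N1 l1 Q1 N2 l2 : R) (R0 : nat).
Hypotheses (p1 : 1 < p) (D0 : 0 < D) (D1 : D <= 1) (l10 : 0 < l1) (l20 : 0 < l2).
Hypothesis H1 : forall y, x - R0%:R - 1 <= y <= x + R0%:R + 1 ->
  (mu `[(y - 2 * D)%R, (y + 2 * D)%R]%classic < N1%:E)%E.
Hypothesis H2 : forall y, (mu `[(y - 2)%R, (y + 2)%R]%classic < N2%:E)%E.
Hypothesis G1 : green_ub e D (p * N1) l1 <= Q1.
Hypothesis G2 : green_ub e 1 (p / (p - 1) * N2) l2 <= 2^-1.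

(* The density is cut into a near part (|z - x| < R0), where the atoms of mu rule,
   an intermediate part, whose Green function at x is small, and a far part,
   negligible in mean, which the approximant simply drops. *)
Lemma local_time_moment_le m :
  (\int[P]_w (`|L w| ^+ m.+1)%:E <= (m.+1`!%:R * (expR (l1 * t) * Q1 * Q1 ^+ m
     + expR (l2 * t) * tail_ub e (p / (p - 1) * N2) l2 R0 * 2^-1 ^+ m))%:E)%E.
Proof.
have p0 : 0 <= p by rewrite ltW// (lt_trans _ p1).
have q0 : 0 <= p / (p - 1) by rewrite divr_ge0// subr_ge0 ltW.
have N10 : 0 <= N1.
  have h : x - R0%:R - 1 <= x <= x + R0%:R + 1.
    by have := ler0n R R0; move=> ?; apply/andP; split; lra.
  by rewrite -lee_fin; apply: le_trans (ltW (H1 h)).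
have N20 : 0 <= N2 by rewrite -lee_fin; apply: le_trans (ltW (H2 x)).
have [M M0 HM] := approx_mass_bound.
apply: moment_limit_le => // eta eta0.
have et0 : 0 < eta / 2 / expR t by rewrite !divr_gt0 ?expR_gt0.
(* The cutoff [j] depends on [eta], but the moment bound does not: it involves only [R0], whatever
   the outer radius of the intermediate part. *)
have [j [j1 j2]] : exists j, (R0 <= j)%N /\ tail_ub e M 1 j < eta / 2 / expR t.
  have F : \forall j \near \oo, (R0 <= j)%N /\ tail_ub e M 1 j < eta / 2 / expR t.
    by apply: filterI; [exact: nbhs_infty_ge|exact: tail_ub_cvg].
  exact: filter_ex F.
have mk := approx_density_measurable apx; have k0 := approx_density_ge0 apx.
(* By [integral_l1_l2] this mean-square error costs eta / 2 in mean; the dropped far part takes the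
   other half. *)
have c0 : 0 < (eta / 4) ^+ 2 by rewrite exprn_gt0// divr_gt0.
have F1 := @addf_l2 _ _ _ _ _ hB x e t k L mk k0 cv _ c0.
have DD : D < 2 * D by rewrite ltr_pMl ?ltr1n.
have F2 := vague_uniform_lt apx D0 DD H1.
have l12 : 1 < 2 :> R by rewrite ltr1n.
have F3 := @vague_uniform_lt _ _ _ _ apx (x - j%:R - 1) (x + j%:R + 1) 1 2 N2%:E ltr01 l12
  (fun y _ => H2 y).
have [n [[n1 n2] n3]] := filter_ex (filterI (filterI F1 F2) F3).
pose C1 := [pred z : R | `|z - x| < R0%:R].
pose C2 := [pred z : R | R0%:R <= `|z - x| < j%:R].
pose C3 := [pred z : R | j%:R <= `|z - x|].
have md : measurable_fun setT (fun z : R => `|z - x|).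
  by apply: measurableT_comp => //; exact: measurable_funB.
have mC1 : measurable_fun setT C1 by apply: measurable_fun_ltr.
have mC3 : measurable_fun setT C3 by apply: measurable_fun_ler.
have mC2 : measurable_fun setT C2.
  by apply: measurable_and; [exact: measurable_fun_ler|exact: measurable_fun_ltr].
pose cut (C : pred R) z := if C z then k n z else 0.
have cut0 C z : 0 <= cut C z by rewrite /cut; case: ifP.
have mcut C : measurable_fun setT C -> measurable_fun setT (cut C).
  by move=> mC; apply: measurable_fun_ifT.
have kE : k n = ((cut C1 \+ cut C2) \+ cut C3)%R.
  apply/funext => z /=; rewrite /cut /C1 /C2 /C3 /=.
  have jR : R0%:R <= j%:R :> R by rewrite ler_nat.
  case: (ltP `|z - x| R0%:R) => /= h.
    by rewrite leNgt (lt_le_trans h jR)/= !addr0.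
  by case: (ltP `|z - x| j%:R) => h2; rewrite ?addr0 ?add0r.
pose A w := (addf B x e (cut C1) t w + addf B x e (cut C2) t w)%E.
have mA1 := measurable_addfE hB x e (mcut _ mC1) (cut0 C1) t.
have mA2 := measurable_addfE hB x e (mcut _ mC2) (cut0 C2) t.
have mA3 := measurable_addfE hB x e (mcut _ mC3) (cut0 C3) t.
have a0 C w : (0 <= addf B x e (cut C) t w)%E by apply: addf_ge0.
have A0 w : (0 <= A w)%E by rewrite adde_ge0.
have Amea : measurable_fun setT A by exact: emeasurable_funD.
have AE w : (addf B x e (k n) t w = A w + addf B x e (cut C3) t w)%E.
  have m12 : measurable_fun setT (cut C1 \+ cut C2)%R.
    by apply: measurable_funD; exact: mcut.
  have c12 z : 0 <= (cut C1 \+ cut C2)%R z by rewrite addr_ge0.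
  rewrite kE (addfD hB _ _ _ w m12 (mcut _ mC3) c12 (cut0 C3)).
  by rewrite (addfD hB _ _ _ w (mcut _ mC1) (mcut _ mC2) (cut0 C1) (cut0 C2)).
have mL : measurable_fun setT (fun w => (L w)%:E) by exact/measurable_EFinP.
have mE : measurable_fun setT (fun w => `|addf B x e (k n) t w - (L w)%:E|)%E.
  by apply: measurableT_comp => //; apply: emeasurable_funB => //; exact: measurable_addfE.
exists A; split => //.
- apply: (@le_trans _ _ (\int[P]_w (`|addf B x e (k n) t w - (L w)%:E| + addf B x e (cut C3) t w))%E).
    apply: ge0_le_integralT => //.
    + by apply: measurableT_comp => //; exact: emeasurable_funB.
    + exact: emeasurable_funD.
    by move=> w; rewrite AE; exact: abse_leD.
  rewrite (ge0_integralD P measurableT (fun w _ => abse_ge0 _) mE (fun w _ => a0 C3 w) mA3).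
  have -> : eta = 2 * (eta / 4) + eta / 2 by lra.
  rewrite EFinD; apply: leeD.
    apply: integral_l1_l2 n1 => //; by rewrite divr_gt0.
  have mass y : (\int[leb]_(z in `[(y - 1)%R, (y + 1)%R]) (cut C3 z)%:E <= M%:E)%E.
    apply: le_trans (HM n y).
    apply: ge0_le_integral => //.
    + by move=> z _; rewrite lee_fin.
    + by apply: measurable_funTS; apply/measurable_EFinP; exact: mcut.
    + by apply: measurable_funTS; apply/measurable_EFinP; exact: mk.
    + by move=> z _; rewrite lee_fin /cut; case: ifP.
  have supp z : cut C3 z != 0 -> j%:R <= `|z - x|.
    by rewrite /cut /C3 /=; case: ifP => // _; rewrite eqxx.
  apply: le_trans (addf_mean_tail hB _ e0 (mcut _ mC3) (cut0 C3) M0 mass supp) _.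
  by rewrite lee_fin mulrC -ler_pdivlMr ?expR_gt0// ltW.
have pN1 : 0 <= p * N1 by rewrite mulr_ge0.
have qN2 : 0 <= p / (p - 1) * N2 by rewrite mulr_ge0.
have mass1 y : (\int[leb]_(z in `[(y - D)%R, (y + D)%R]) (p * cut C1 z)%:E <= (p * N1)%:E)%E.
  apply: (@mass_cut _ _ _ x R0%:R) => //.
  - by rewrite D0.
  - by move=> z /ltW.
  by move=> y' hy; rewrite -(approx_density apx)// ltW// n2.
have mass2 y : (\int[leb]_(z in `[(y - 1)%R, (y + 1)%R]) (p / (p - 1) * cut C2 z)%:E
    <= (p / (p - 1) * N2)%:E)%E.
  apply: (@mass_cut _ _ _ x j%:R) => //.
  - by rewrite ltr01 lexx.
  - by move=> z /andP[_ /ltW].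
  by move=> y' hy; rewrite -(approx_density apx)// ltW// n3.
have supp z : cut C2 z != 0 -> R0%:R <= `|z - x|.
  by rewrite /cut /C2 /=; case: ifP => [/andP[]//|]; rewrite eqxx.
have := two_scale_moment hB t e0 m (mcut _ mC1) (cut0 C1) (mcut _ mC2) (cut0 C2) p1 D0
  pN1 l10 qN2 l20 mass1 G1 mass2 G2 supp.
by [].
Qed.

(** Dividing by the factorials leaves two geometric series, of ratios [Q1] and 1/2, plus the term 1
    of order 0. *)
Lemma exp_moment_upper : Q1 < 1 ->
  (\int[P]_w (expR `|L w|)%:E <= (1 + expR (l1 * t) * Q1 / (1 - Q1)
     + 2 * expR (l2 * t) * tail_ub e (p / (p - 1) * N2) l2 R0)%:E)%E.
Proof.
move=> Q11.
have p0 : 0 <= p by rewrite ltW// (lt_trans _ p1).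
have q0 : 0 <= p / (p - 1) by rewrite divr_ge0// subr_ge0 ltW.
have N10 : 0 <= N1.
  have h : x - R0%:R - 1 <= x <= x + R0%:R + 1.
    by have := ler0n R R0; move=> ?; apply/andP; split; lra.
  by rewrite -lee_fin; apply: le_trans (ltW (H1 h)).
have N20 : 0 <= N2 by rewrite -lee_fin; apply: le_trans (ltW (H2 x)).
have Q10 : 0 <= Q1 by apply: le_trans G1; rewrite green_ub_ge0// mulr_ge0.
have T0 := tail_ub_ge0 R0 e0 (mulr_ge0 q0 N20) l20.
set a := expR (l1 * t) * Q1; set b := expR (l2 * t) * tail_ub e (p / (p - 1) * N2) l2 R0.
have a0 : 0 <= a by rewrite mulr_ge0 ?expR_ge0.
have b0 : 0 <= b by rewrite mulr_ge0 ?expR_ge0.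
have mL : measurable_fun setT (fun w => `|L w|) by exact: measurableT_comp.
rewrite (integral_expR_series P mL (fun w => normr_ge0 (L w))).
have u0 m : (0 <= \int[P]_w (`|L w| ^+ m / m`!%:R)%:E)%E.
  by apply: integral_ge0 => w _; rewrite lee_fin divr_ge0// exprn_ge0.
have uS m : (\int[P]_w (`|L w| ^+ m.+1 / m.+1`!%:R)%:E <= (a * Q1 ^+ m + b * 2^-1 ^+ m)%:E)%E.
  have i0 : (0 <= (m.+1`!%:R^-1)%:E :> \bar R)%E by rewrite lee_fin invr_ge0.
  have mLm : measurable_fun setT (fun w => (`|L w| ^+ m.+1)%:E).
    by apply/measurable_EFinP; exact: measurable_funX.
  have -> : (\int[P]_w (`|L w| ^+ m.+1 / m.+1`!%:R)%:E =
      (m.+1`!%:R^-1)%:E * \int[P]_w (`|L w| ^+ m.+1)%:E)%E.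
    have n0 w : (0 <= (`|L w| ^+ m.+1)%:E)%E by rewrite lee_fin exprn_ge0.
    rewrite -(ge0_integralZlT P mLm n0 i0).
    by apply: eq_integral => w _; rewrite -EFinM mulrC.
  apply: le_trans (lee_wpmul2l i0 (local_time_moment_le m)) _.
  by rewrite -EFinM mulKf// pnatr_eq0 -lt0n fact_gt0.
apply: lime_le; first by apply: is_cvg_nneseries.
apply: nearW => n.
(* One more nonnegative term, so that the sum is nonempty and its term of order 0 can be split
   off. *)
apply: (@le_trans _ _ (\sum_(0 <= m < n.+1) \int[P]_w (`|L w| ^+ m / m`!%:R)%:E)%E).
  by rewrite [leRHS]big_nat_recr//= leeDl.
have z0 : (\int[P]_w (`|L w| ^+ 0 / 0`!%:R)%:E = 1)%E.
  rewrite (eq_integral (fun _ => 1%E)); last by move=> w _; rewrite expr0 fact0 invr1 mulr1.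
  by rewrite integral_cst//= probability_setT mule1.
rewrite big_nat_recl// z0 -addrA EFinD; apply: leeD2l.
apply: (@le_trans _ _ (\sum_(0 <= m < n) (a * Q1 ^+ m + b * 2^-1 ^+ m)%:E)%E).
  by apply: lee_sum => m _; exact: uS.
rewrite sumEFin lee_fin big_split/=; apply: lerD.
  by apply: partial_geometric => //; rewrite Q10.
have h2 : 0 <= (2^-1 : R) < 1 by apply/andP; split; lra.
apply: le_trans (partial_geometric n b0 h2) _.
by rewrite /b le_eqVlt; apply/orP; left; apply/eqP; field.
Qed.

End UpperMoments.

Lemma lee_expe (R : realDomainType) (a b : \bar R) n : (0 <= a)%E -> (a <= b)%E -> (a ^+ n <= b ^+ n)%E.
Proof.
move=> a0 ab; elim: n => [|n IH]; first by rewrite !expe0.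
by rewrite !expeS lee_pmul// expe_ge0.
Qed.

Lemma cvg_gaussk0 (R : realType) (e r : R) :
  gaussk e r (2 * n.+1%:R^-1) @[n --> \oo] --> gaussk e r 0.
Proof.
rewrite /gaussk; case: ifPn => r0; last exact: cvg_cst.
apply: cvgM; first exact: cvg_cst.
have c : continuous (fun w : R => expR (- w ^+ 2 * r `^ (-1) / (e ^+ 2 *+ 2))).
  move=> w; apply: continuous_comp; last exact: continuous_expR.
  apply: cvgM; last exact: cvg_cst.
  apply: cvgM; last exact: cvg_cst.
  by apply: cvgN; exact: exprn_continuous.
have h : 2 * n.+1%:R^-1 @[n --> \oo] --> (0 : R).
  rewrite -[X in _ --> X](mulr0 (2 : R)); apply: cvgM; first exact: cvg_cst.
  exact: cvg_harmonic.
exact: (cvg_comp _ _ h (c 0)).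
Qed.

(** * Lower bound for the local time at an atom *)

Section LowerMoments.
Context d (Omega : measurableType d) (R : realType) (P : probability Omega R).
Variables (B : R -> {RV P >-> R}) (hB : wiener_process P B).
Local Notation leb := (@lebesgue_measure R).
Variables (x e t : R) (e0 : 0 < e) (t0 : 0 < t).
Variables (mu : {measure set R -> \bar R}) (mu_ : nat -> {measure set R -> \bar R}).
Variable k : nat -> R -> R.
Hypothesis apx : approximating_measures mu mu_ k.
Variable L : {RV P >-> R}.
Hypothesis cv : Lnorm P 2%:E (fun w => integral_functional (fun s w => (x + e * B s w)%R) (k n) t w
     - (L w)%:E)%E @[n --> \oo] --> 0%E.

Let mk := approx_density_measurable apx.
Let k0 := approx_density_ge0 apx.
Let mL : measurable_fun setT L.
Proof. exact: measurable_funPT. Qed.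

Lemma local_time_ge0 : {ae P, forall w, 0 <= L w}.
Proof.
apply: ae_ge0_limit => // eta eta0.
have [n hn] := filter_ex (@addf_l2 _ _ _ _ _ hB x e t k L mk k0 cv _ eta0).
exists (addf B x e (k n) t); split => //; first exact: measurable_addfE.
by move=> w; exact: addf_ge0.
Qed.

(* Only even moments are bounded below: the iterated convolutions of the kernel
   are elementary for an even number of factors, and these moments suffice. *)
Lemma local_time_moment_ge j a b : 0 < a < b -> (b%:E < mu [set x])%E ->
  ((j.*2.+2`!%:R * (a ^+ 2 * (t / (2 * e ^+ 2))) ^+ j.+1 / j.+1`!%:R)%:E <=
   \int[P]_w (Num.max (L w) 0 ^+ j.*2.+2)%:E)%E.
Proof.
move=> /andP[a0 ab] bmu; have b0 : 0 < b by rewrite (lt_trans a0).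
set m := j.*2.+1; pose I : R := (t / (2 * e ^+ 2)) ^+ j.+1 / j.+1`!%:R.
have s0 : 0 < t / (2 * e ^+ 2) by rewrite divr_gt0// mulr_gt0// exprn_gt0.
have I0 : 0 < I by rewrite divr_gt0 ?exprn_gt0 ?ltr0n ?fact_gt0.
(* Chosen so that b^(m+1) c = a^(m+1) I: the gap between [a] and [b] pays for replacing distance 0
   by a small positive one. *)
pose c := (a / b) ^+ m.+1 * I.
have cI : c < I.
  by rewrite /c gtr_pMl// exprn_ilt1 ?divr_ge0 ?(ltW a0) ?(ltW b0)// ltr_pdivrMr ?mul1r.
pose f_ n r := gaussk e r (2 * n.+1%:R^-1).
have C : (\int[leb]_u (if (u < t)%R then iconv (f_ n) m u else 0))%E @[n --> \oo] -->
    I%:E.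
  rewrite /I -(integral_iconv_gaussk e0 j t0); apply: cvg_integral_iconv.
  - by move=> n; apply: measurable_gaussk.
  - by move=> n r; exact: gaussk_ge0.
  - move=> r n1 n2 n12; apply: gaussk_le.
    rewrite ger0_norm ?mulr_ge0 ?invr_ge0//.
    by rewrite ler_wpM2l// lef_pV2 ?posrE ?ltr0n// ler_nat.
  - by move=> r; exact: cvg_gaussk0.
have N : \forall n \near \oo, (c%:E < \int[leb]_u (if (u < t)%R then iconv (f_ n) m u else 0))%E.
  by apply: C (open_ereal_gt' _); rewrite lte_fin.
(* A ball so small that the iterated convolution at distance 2 delta already exceeds [c]. *)
have [N0 hN] := filter_ex N; pose delta : R := N0.+1%:R^-1.
have dl0 : 0 < delta by rewrite invr_gt0 ltr0n.
have [M M0 HM] := approx_mass_bound apx.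
(* A crude bound, uniform in [n], on the moments of order 2m that [moment_limit_ge] asks for. *)
pose q := green_ub e 1 M 1.
have q0 : 0 <= q by apply: green_ub_ge0.
pose Dm : R := (j.*2 + m).+1`!%:R * expR (1 * t) * q ^+ (j.*2 + m) * q.
have Dm0 : 0 <= Dm by rewrite !mulr_ge0 ?expR_ge0 ?exprn_ge0.
apply: (@moment_limit_ge _ _ _ _ L mL m Dm) => // eta eta0.
have F1 := @addf_l2 _ _ _ _ _ hB x e t k L mk k0 cv _ eta0.
have F2 := vague_gt apx dl0 bmu.
have [n [n1 n2]] := filter_ex (filterI F1 F2).
exists (addf B x e (k n) t); split => //.
- exact: measurable_addfE.
- by move=> w; exact: addf_ge0.
- have g y := green_cells e0 (mk n) (k0 n) ltr01 M0 (HM n) y ltr01.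
  apply: le_trans (addf_moment_le hB x e0 (mk n) (k0 n) ler01 g t (j.*2 + m)) _.
  rewrite /Dm [leRHS]EFinM; apply: lee_wpmul2l (g x).
  by rewrite lee_fin !mulr_ge0 ?expR_ge0 ?exprn_ge0.
pose k' z := if `|z - x| <= delta then k n z else 0.
have k'0 z : 0 <= k' z by rewrite /k'; case: ifP.
have mk' : measurable_fun setT k'.
  apply: measurable_fun_ifT => //; apply: measurable_fun_ler => //.
  by apply: measurableT_comp => //; exact: measurable_funB.
have supp z : k' z != 0 -> `|z - x| <= delta by rewrite /k'; case: ifP => //; rewrite eqxx.
have mass : (b%:E <= \int[leb]_z (k' z)%:E)%E.
  apply: (le_trans (ltW n2)); rewrite (approx_density apx)// [leLHS]integral_mkcond.
  rewrite le_eqVlt; apply/orP; left; apply/eqP/eq_integral => z _.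
  by rewrite patchE mem_setE in_itv/= /k' ler_distl; case: ifP.
have G := addf_moment_ge hB e0 mk' k'0 (ltW dl0) (ltW b0) supp mass t m.
apply: (@le_trans _ _ (\int[P]_w (addf B x e k' t w ^+ m.+1))%E).
  apply: le_trans G.
  have z0 : (0 <= (m.+1`!%:R * b ^+ m.+1)%:E)%E by rewrite lee_fin mulr_ge0 ?exprn_ge0 ?(ltW b0).
  apply: le_trans (lee_wpmul2l z0 (ltW hN)).
  rewrite -EFinM lee_fin le_eqVlt; apply/orP; left; apply/eqP.
  have E1 : b ^+ m.+1 * (a / b) ^+ m.+1 = a ^+ m.+1.
    by rewrite -exprMn mulrCA mulfV ?mulr1// gt_eqF.
  have E2 : (a ^+ 2 * (t / (2 * e ^+ 2))) ^+ j.+1 = a ^+ m.+1 * (t / (2 * e ^+ 2)) ^+ j.+1.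
    by rewrite exprMn -exprM mul2n.
  by rewrite E2 -E1 /c /I; ring.
apply: ge0_le_integralT.
- by apply: measurable_expe; exact: measurable_addfE.
- by apply: measurable_expe; exact: measurable_addfE.
- by move=> w; rewrite expe_ge0// addf_ge0.
move=> w; apply: lee_expe; first exact: addf_ge0.
by apply: (le_addf hB) => // z; rewrite /k'; case: ifP.
Qed.

(** The term of order 2j + 2 of the exponential series of [L] dominates the term of order j + 1 of
    exp c; the odd orders are dropped. *)
Lemma exp_moment_lower a b : 0 < a < b -> (b%:E < mu [set x])%E ->
  ((expR (a ^+ 2 * (t / (2 * e ^+ 2))))%:E <= \int[P]_w (expR (L w))%:E)%E.
Proof.
move=> ab bmu; set c := a ^+ 2 * _; pose g w := Num.max (L w) 0.
have c0 : 0 <= c by rewrite mulr_ge0 ?sqr_ge0// divr_ge0 ?(ltW t0)// mulr_ge0 ?sqr_ge0.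
have mg : measurable_fun setT g by apply: measurable_maxr.
have g0 w : 0 <= g w by rewrite le_max lexx orbT.
(* [L] is nonnegative only almost surely; with its positive part every term of the series is
   nonnegative. *)
have -> : (\int[P]_w (expR (L w))%:E = \int[P]_w (expR (g w))%:E)%E.
  apply: ge0_ae_eq_integral => //.
  - by apply/measurable_EFinP; exact: measurableT_comp.
  - by apply/measurable_EFinP; exact: measurableT_comp.
  have := local_time_ge0; apply: filterS => w Lw _; by rewrite /g max_l.
have cE : ((expR c)%:E = \sum_(m <oo) (c ^+ m / m`!%:R)%:E)%E.
  have := @integral_expR_series _ Omega R P (fun _ => c) (measurable_cst _) (fun _ => c0).
  rewrite integral_cst//= probability_setT mule1 => ->.
  by apply: eq_eseriesr => m _; rewrite integral_cst//= probability_setT mule1.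
rewrite cE (integral_expR_series P mg g0).
pose u m := (\int[P]_w (g w ^+ m / m`!%:R)%:E)%E.
have u0 m : (0 <= u m)%E.
  by apply: integral_ge0 => w _; rewrite lee_fin divr_ge0// exprn_ge0.
have uS j : ((c ^+ j.+1 / j.+1`!%:R)%:E <= u j.*2.+2)%E.
  have i0 : (0 <= (j.*2.+2`!%:R^-1)%:E :> \bar R)%E by rewrite lee_fin invr_ge0.
  have mgm : measurable_fun setT (fun w => (g w ^+ j.*2.+2)%:E).
    by apply/measurable_EFinP; exact: measurable_funX.
  have -> : (u j.*2.+2 = (j.*2.+2`!%:R^-1)%:E * \int[P]_w (g w ^+ j.*2.+2)%:E)%E.
    have n0 w : (0 <= (g w ^+ j.*2.+2)%:E)%E by rewrite lee_fin exprn_ge0.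
    rewrite -(ge0_integralZlT P mgm n0 i0).
    by apply: eq_integral => w _; rewrite -EFinM mulrC.
  apply: le_trans (lee_wpmul2l i0 (local_time_moment_ge j ab bmu)).
  have F0 : j.*2.+2`!%:R != 0 :> R by rewrite pnatr_eq0 -lt0n fact_gt0.
  by rewrite -EFinM -(mulrA j.*2.+2`!%:R) mulKf.
apply: lime_le.
  by apply: is_cvg_nneseries => m _ _; rewrite lee_fin divr_ge0// exprn_ge0.
apply: nearW => n.
have S m : (\sum_(0 <= i < m.+1) (c ^+ i / i`!%:R)%:E <= \sum_(0 <= i < m.*2.+1) u i)%E.
  elim: m => [|m IH].
    rewrite !big_nat1 /u (eq_integral (fun _ => 1%E)); last first.
      by move=> w _; rewrite expr0 fact0 invr1 mulr1.
    by rewrite integral_cst//= probability_setT mule1 expr0 fact0 invr1 mulr1.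
  rewrite big_nat_recr//= doubleS [leRHS]big_nat_recr//=; apply: leeD => //.
  by rewrite [leRHS]big_nat_recr//=; apply: le_trans IH _; rewrite leeDl.
apply: (@le_trans _ _ (\sum_(0 <= i < n.+1) (c ^+ i / i`!%:R)%:E)%E).
  by rewrite [leRHS]big_nat_recr//= leeDl// lee_fin divr_ge0// exprn_ge0.
by apply: le_trans (S n) _; exact: nneseries_lim_ge.
Qed.

End LowerMoments.

(** * Small-noise asymptotics *)

Section SmallBalls.
Context (R : realType) (mu : {measure set R -> \bar R}).

Lemma ball_lt (y : R) (M : \bar R) : (mu `[(y - 1)%R, (y + 1)%R]%classic < +oo)%E ->
  (mu [set y] < M)%E ->
  exists2 r, 0 < r & (mu `[(y - r)%R, (y + r)%R]%classic < M)%E.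
Proof.
move=> fin lt; pose F (n : nat) : set R := `[(y - n.+1%:R^-1)%R, (y + n.+1%:R^-1)%R]%classic.
have FI : \bigcap_n F n = [set y].
  apply/seteqP; split => [z Fz|z -> n _] /=; last first.
    by rewrite /F /= in_itv/=; apply/andP; split; rewrite ?gerBl ?lerDl invr_ge0 ler0n.
  apply/eqP; rewrite -subr_eq0 -normr_le0; apply/ler_addgt0Pr => h h0; rewrite add0r.
  have [n _ /= hn] := near_infty_natSinv_lt (PosNum h0).
  have := Fz n Logic.I; rewrite /F /= in_itv/= => /andP[z1 z2].
  have := hn n (leqnn n) => /ltW; apply: le_trans; rewrite ler_norml.
  have hd (q : R) : y - q <= z -> z <= y + q -> - q <= z - y <= q by move=> *; apply/andP; split; lra.
  exact: hd z1 z2.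
have C : mu (F n) @[n --> \oo] --> mu [set y].
  rewrite -FI; apply: nonincreasing_cvg_mu => //.
  - by rewrite /F invr1.
  - by move=> n; exact: measurable_itv.
  - by rewrite FI.
  move=> n1 n2 n12; apply/subsetPset; apply: subset_itv; rewrite bnd_simp.
    by rewrite lerB// lef_pV2 ?posrE ?ltr0n// ler_nat.
  by rewrite lerD2l lef_pV2 ?posrE ?ltr0n// ler_nat.
have N : \forall n \near \oo, (mu (F n) < M)%E by exact: C (open_ereal_lt' lt).
by have [n hn] := filter_ex N; exists n.+1%:R^-1.
Qed.

(** Each point has a ball of mass below [M] by continuity from above, and compactness makes the
    radius common. *)
Lemma small_balls c1 c2 (M : \bar R) :
  (forall y : R, mu `[(y - 1)%R, (y + 1)%R]%classic < +oo)%E ->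
  (forall y, mu [set y] < M)%E ->
  exists2 D : R, 0 < D <= 1 & forall y, c1 <= y <= c2 ->
    (mu `[(y - 2 * D)%R, (y + 2 * D)%R]%classic < M)%E.
Proof.
move=> fin lt.
have K := @segment_compact R c1 c2; move/compact_near_coveringP in K.
pose Q D y := (mu `[(y - 2 * D)%R, (y + 2 * D)%R]%classic < M)%E.
have N : \forall D \near 0^'+, `[c1, c2]%classic `<=` Q D.
  apply: K => y _.
  have [r r0 hr] := ball_lt (fin y) (lt y).
  (* With D < r / 4 and the centre moved by less than r / 4, radius 2 D stays inside the ball of
     radius r. *)
  have r4 : 0 < r / 4 by rewrite divr_gt0.
  exists (ball y (r / 4), [set D | 0 < D < r / 4]) => /=.
    split; first exact: nbhsx_ballx.
    by near=> D; apply/andP; split.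
  move=> [y' D] /= [yy' /andP[D0 D1]]; apply: le_lt_trans hr.
  move: yy'; rewrite /ball/= ltr_norml => /andP[h1 h2].
  apply: le_measure; rewrite ?inE//; apply: subset_itv; rewrite bnd_simp; lra.
have N2 : \forall D \near 0^'+, (0 : R) < D <= 1.
  by near=> D; apply/andP; split => //; near: D; exact: nbhs_right_le.
have [D [D1 D2]] := filter_ex (filterI N N2).
by exists D => // y yc; apply: D1; rewrite /= in_itv.
Unshelve. all: end_near. Qed.

End SmallBalls.

(** A finite measure has mass below [M] outside some [-n, n], so only centres in a compact set
    matter. *)
Lemma small_balls_finite (R : realType) (mu : {finite_measure set R -> \bar R}) (M : \bar R) :
  (forall y, mu [set y] < M)%E ->
  exists2 D : R, 0 < D <= 1 & forall y : R,
    (mu `[(y - 2 * D)%R, (y + 2 * D)%R]%classic < M)%E.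
Proof.
move=> lt.
have fin (A : set R) : measurable A -> (mu A < +oo)%E.
  by move=> mA; rewrite ltey_eq fin_num_measure.
pose F (n : nat) : set R := ~` `[(- n%:R)%R, n%:R%R]%classic.
have C : mu (F n) @[n --> \oo] --> mu (\bigcap_n F n).
  apply: nonincreasing_cvg_mu.
  - by apply: fin; apply: measurableC.
  - by move=> n; apply: measurableC.
  - by apply: bigcapT_measurable => n; apply: measurableC.
  move=> n1 n2 n12; apply/subsetPset; apply: subsetC; apply: subset_itv; rewrite bnd_simp.
    by rewrite lerN2 ler_nat.
  by rewrite ler_nat.
have F0 : \bigcap_n F n = set0.
  apply/seteqP; split => // z Fz.
  apply: (Fz (Num.truncn `|z|).+1 Logic.I) => /=; rewrite in_itv/= -ler_norml ltW//.
  by have /andP[] := truncn_itv (normr_ge0 z).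
have M0 : (0 < M)%E by apply: le_lt_trans (lt 0).
rewrite F0 measure0 in C.
have N : \forall n \near \oo, (mu (F n) < M)%E by exact: C (open_ereal_lt' M0).
have [n hn] := filter_ex N.
(* The margin 3 exceeds 2 D <= 2, so a ball centred beyond it lies outside [-n, n]. *)
have [D D01 HD] := @small_balls R mu (- (n%:R + 3)) (n%:R + 3) M (fun y => fin _ (measurable_itv _)) lt.
exists D => // y; have /andP[D0 D1] := D01.
have [yn|yn] := boolP (- (n%:R + 3) <= y <= n%:R + 3); first exact: HD.
apply: le_lt_trans hn; apply: le_measure; rewrite ?inE//; first by apply: measurableC.
move=> z /=; rewrite !in_itv/= => /andP[z1 z2] /andP[z3 z4].
move: yn; clear F0 C N M0; rewrite !bnd_simp in z3 z4; rewrite negb_and -!ltNge.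
by move: (n%:R : R) z3 z4 => q z3 z4; case/orP => ?; lra.
Qed.

(** * The bounds at rates of order 1 / e^2 *)

Section Asymptotics.
Context (R : realType).

Lemma expR_inv_sqr_lt (a h : R) : 0 < a -> 0 < h ->
  \forall e \near 0^'+, expR (- (a / e ^+ 2)) < h.
Proof.
move=> a0 h0; near=> e.
have e0 : 0 < e by [].
have e1 : e < 1 by near: e; exact: nbhs_right_lt.
have e2 : e < h * a by near: e; apply: nbhs_right_lt; rewrite mulr_gt0.
have ee : e ^+ 2 < h * a.
  by apply: lt_trans e2; rewrite expr2 gtr_pMl.
have p0 : 0 < a / e ^+ 2 by rewrite divr_gt0// exprn_gt0.
rewrite expRN; apply: (@le_lt_trans _ _ (a / e ^+ 2)^-1).
  rewrite lef_pV2 ?posrE ?expR_gt0//; apply: le_trans (expR_ge1Dx _).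
  by rewrite lerDr.
by rewrite invf_div ltr_pdivrMr.
Unshelve. all: end_near. Qed.

Lemma sqrt_scale (e c : R) : 0 < e -> 0 <= c -> Num.sqrt (c / e ^+ 2) = Num.sqrt c / e.
Proof.
by move=> e0 c0; rewrite sqrtrM// sqrtrV ?sqr_ge0// sqrtr_sqr ger0_norm// ltW.
Qed.

Lemma geometric_ratio_le (th : R) : 0 <= th <= 2^-1 -> th / (1 - th) <= 2 * th.
Proof.
by move=> /andP[h1 h2]; rewrite ler_pdivrMr; [nra|lra].
Qed.

(** At rate c / e^2 the main term is N / sqrt (2 c) for every [e], while the rest is of order exp (-
    D sqrt c / e^2). *)
Lemma green_ub_small (D N c Q : R) : 0 < D -> 0 <= N -> 0 < c -> N / Num.sqrt (2 * c) < Q ->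
  \forall e \near 0^'+, green_ub e D N (c / e ^+ 2) <= Q.
Proof.
move=> D0 N0 c0 NQ; have s0 : 0 < Num.sqrt c by rewrite sqrtr_gt0.
pose dl := Q - N / Num.sqrt (2 * c); have dl0 : 0 < dl by rewrite subr_gt0.
(* Once [th] is at most 1/2 the remainder is at most [th * K]. *)
pose K := 4 * N / Num.sqrt c + 1; have K0 : 0 < K.
  by rewrite ltr_wpDl// divr_ge0 ?mulr_ge0// ltW.
have a0 : 0 < D * Num.sqrt c by rewrite mulr_gt0.
near=> e; have e0 : 0 < e by [].
have h1 : expR (- (D * Num.sqrt c / e ^+ 2)) < 2^-1.
  by near: e; apply: expR_inv_sqr_lt.
have h2 : expR (- (D * Num.sqrt c / e ^+ 2)) < dl / K.
  by near: e; apply: expR_inv_sqr_lt => //; rewrite divr_gt0.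
have en0 : e != 0 by rewrite gt_eqF.
rewrite /green_ub (_ : 2 * (c / e ^+ 2) = (2 * c) / e ^+ 2); last by rewrite mulrA.
rewrite !sqrt_scale ?mulr_ge0 ?(ltW c0)// (mulrC e) divfK// (mulrC e) divfK//.
have -> : D * (Num.sqrt c / e / e) = D * Num.sqrt c / e ^+ 2 by rewrite expr2 invfM !mulrA.
set th := expR _ in h1 h2 *; have th0 : 0 <= th by exact: expR_ge0.
have g : th / (1 - th) <= 2 * th by apply: geometric_ratio_le; rewrite th0 ltW.
rewrite -lerBrDl -/dl -(mulrA _ th).
have A0 : 0 <= 2 * N / Num.sqrt c by rewrite divr_ge0 ?mulr_ge0// ltW.
apply: le_trans (ler_wpM2l A0 g) _.
move: h2; rewrite ltr_pdivlMr// /K => h2.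
apply: ltW; apply: le_lt_trans h2; rewrite mulrDr mulr1.
have -> : 2 * N / Num.sqrt c * (2 * th) = th * (4 * N / Num.sqrt c) by ring.
by rewrite lerDl.
Unshelve. all: end_near. Qed.

(** At distance [j] the decay exp (- j sqrt c / e^2) beats the growth exp (c t / e^2) as soon as j
    >= t sqrt c. *)
Lemma tail_ub_small (N c t : R) j : 0 <= N -> 0 < c -> c * t <= Num.sqrt c * j%:R ->
  \forall e \near 0^'+, expR (c / e ^+ 2 * t) * tail_ub e N (c / e ^+ 2) j <= 4 * N / Num.sqrt c.
Proof.
move=> N0 c0 ctj; have s0 : 0 < Num.sqrt c by rewrite sqrtr_gt0.
near=> e; have e0 : 0 < e by [].
have h1 : expR (- (Num.sqrt c / e ^+ 2)) < 2^-1.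
  by near: e; apply: expR_inv_sqr_lt.
have en0 : e != 0 by rewrite gt_eqF.
rewrite /tail_ub !sqrt_scale ?(ltW c0)// (mulrC e) divfK//.
have -> : Num.sqrt c / e / e = Num.sqrt c / e ^+ 2 by rewrite expr2 invfM !mulrA.
set th := expR (- _) in h1 *; have th0 : 0 <= th by exact: expR_ge0.
have E : expR (c / e ^+ 2 * t) * th ^+ j <= 1.
  rewrite /th -expRM_natl -expRD -[leRHS]expR0 ler_expR mulrN subr_le0.
  rewrite (mulrAC c) mulrA ler_wpM2r ?invr_ge0 ?sqr_ge0//.
  by rewrite [leRHS]mulrC.
have A0 : 0 <= 2 * N / Num.sqrt c by rewrite divr_ge0 ?mulr_ge0// ltW.
have i2 : (1 - th)^-1 <= 2.
  rewrite -[leRHS]invrK lef_pV2 ?posrE; lra.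
have i0 : 0 <= (1 - th)^-1 by rewrite invr_ge0; lra.
have -> : expR (c / e ^+ 2 * t) * (2 * N / Num.sqrt c * th ^+ j / (1 - th)) =
  2 * N / Num.sqrt c * ((expR (c / e ^+ 2 * t) * th ^+ j) * (1 - th)^-1) by ring.
have -> : 4 * N / Num.sqrt c = 2 * N / Num.sqrt c * 2 by ring.
apply: ler_wpM2l => //; rewrite -[leRHS]mul1r; apply: ler_pM => //.
by rewrite mulr_ge0 ?expR_ge0 ?exprn_ge0.
Unshelve. all: end_near. Qed.

End Asymptotics.

Lemma le_lne (R : realType) (v : R) (I : \bar R) : ((expR v)%:E <= I)%E -> (v%:E <= lne I)%E.
Proof.
move=> vI; rewrite -[X in (X%:E <= _)%E]expRK -lne_EFin ?expR_gt0//.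
have v0 : (0 <= (expR v)%:E)%E by rewrite lee_fin expR_ge0.
by rewrite lee_lne ?in_itv/= ?v0 ?(le_trans v0 vI) ?leey.
Qed.

Lemma lne_le (R : realType) (v : R) (I : \bar R) :
  (0 <= I)%E -> (I <= (expR v)%:E)%E -> (lne I <= v%:E)%E.
Proof.
move=> I0 Iv; rewrite -[X in (_ <= X%:E)%E]expRK -lne_EFin ?expR_gt0//.
have v0 : (0 <= (expR v)%:E)%E by rewrite lee_fin expR_ge0.
by rewrite lee_lne ?in_itv/= ?v0 ?I0 ?leey.
Qed.

(** * Two-sided bounds for the logarithm *)

Section LogMoments.
Context d (Omega : measurableType d) (R : realType) (P : probability Omega R).
Variables (B : R -> {RV P >-> R}) (hB : wiener_process P B).
Variables (t : R) (t0 : 0 < t).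
Variable mu : {measure set R -> \bar R}.
Local Notation X e x := (fun s w => (x + e * B s w)%R).

Lemma measurable_expRV (L : {RV P >-> R}) : measurable_fun setT (fun w => (expR (L w))%:E).
Proof.
by apply/measurable_EFinP; apply: (measurableT_comp (@measurable_expR R)); exact: measurable_funPT.
Qed.

Lemma exp_moment_unfold (L : {RV P >-> R}) :
  ('E_P[fun w => expR (L w)] = \int[P]_w (expR (L w))%:E)%E.
Proof. by rewrite unlock. Qed.

Lemma log_exp_moment_lower e y r (L : {RV P >-> R}) : 0 < e ->
  is_local_time P (X e y) mu t L -> mu [set y] = r%:E ->
  ((t / 2 * r ^+ 2)%:E <= (e ^+ 2)%:E * lne 'E_P[fun w => expR (L w)])%E.
Proof.
move=> e0 [mu_ [k [apx cv]]] mur; rewrite exp_moment_unfold.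
have ee0 : 0 < e ^+ 2 by rewrite exprn_gt0.
set I := (\int[P]_w _)%E.
(* It makes the logarithm nonnegative: this covers the case r = 0, where [low] is vacuous, and gives
   sense to the square root below. *)
have I1 : (1 <= I)%E.
  have -> : (1 = \int[P]_w (1%:E : \bar R))%E by rewrite integral_cst//= probability_setT mule1.
  apply: ae_ge0_le_integral => //.
  - exact: measurable_expRV.
  have := local_time_ge0 hB apx cv; apply: filterS => w Lw _.
  by rewrite lee_fin -expR0 ler_expR.
have I0 : (0 <= I)%E by apply: le_trans I1.
have X0 : (0 <= (e ^+ 2)%:E * lne I)%E by rewrite mule_ge0 ?lee_fin ?(ltW ee0)// lne_ge0.
have low a : 0 < a < r -> ((t / 2 * a ^+ 2)%:E <= (e ^+ 2)%:E * lne I)%E.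
  move=> /andP[a0 ar]; pose b := (a + r) / 2.
  have ab : 0 < a < b by rewrite a0/= /b; lra.
  have br : (b%:E < mu [set y])%E by rewrite mur lte_fin /b; lra.
  have H := exp_moment_lower hB e0 t0 apx cv ab br.
  have -> : t / 2 * a ^+ 2 = e ^+ 2 * (a ^+ 2 * (t / (2 * e ^+ 2))).
    by field; rewrite gt_eqF.
  rewrite EFinM; apply: lee_wpmul2l; first by rewrite lee_fin ltW.
  exact: le_lne.
move: X0 low; case: ((e ^+ 2)%:E * lne I)%E => [v| |]//; last by move=> _ _; rewrite leey.
rewrite lee_fin => v0 low; rewrite lee_fin leNgt; apply/negP => vr.
have r0 : 0 <= r by rewrite -lee_fin -mur.
(* The mass whose lower bound would be exactly [v]. If it were below [r], the midpoint of [u] and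
   [r] would contradict [low]. *)
pose u := Num.sqrt (2 * v / t).
have u0 : 0 <= u by exact: sqrtr_ge0.
have uu : u ^+ 2 = 2 * v / t by rewrite sqr_sqrtr// divr_ge0 ?mulr_ge0 ?(ltW t0).
have vE : v = t / 2 * u ^+ 2 by rewrite uu; field; rewrite gt_eqF.
have ur : u < r.
  rewrite ltNge; apply/negP => ru; move: vr; rewrite ltNge => /negP; apply.
  by rewrite vE ler_pM2l ?divr_gt0// ler_sqr ?nnegrE.
have ar : 0 < (u + r) / 2 < r by apply/andP; split; lra.
have t20 : 0 < t / 2 by rewrite divr_gt0.
have := low _ ar; rewrite lee_fin vE ler_pM2l// ler_sqr ?nnegrE//; lra.

Qed.

Hypothesis mulb : locally_bounded_measure mu.

Lemma locally_bounded_two : exists2 N2 : R, 0 <= N2 &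
  forall y : R, (mu `[(y - 2)%R, (y + 2)%R]%classic < N2%:E)%E.
Proof.
have := mulb; rewrite /locally_bounded_measure; set S := ereal_sup _ => S1.
have S2 y : (mu `[(y - 1)%R, (y + 1)%R]%classic <= S)%E by apply: ereal_sup_ubound; exists y.
have S0 : (0 <= S)%E by apply: le_trans (S2 0).
have Sf : S \is a fin_num by rewrite ge0_fin_numE.
exists (fine S + fine S + 1); first by rewrite !addr_ge0// fine_ge0.
move=> y; apply: (@le_lt_trans _ _ (S + S)%E); last first.
  by rewrite -(fineK Sf) -EFinD lte_fin ltrDl.
apply: (@le_trans _ _ (mu (`[(y - 1 - 1)%R, (y - 1 + 1)%R]%classic `|`
    `[(y + 1 - 1)%R, (y + 1 + 1)%R]%classic))).
  apply: le_measure; rewrite ?inE//; first exact: measurableU.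
  move=> z /=; rewrite !in_itv/= => /andP[z1 z2].
  by have [h|h] := leP z y; [left|right]; apply/andP; split; lra.
apply: le_trans (leeD (S2 (y - 1)) (S2 (y + 1))); exact: measureU2.
Qed.

(** The order of quantifiers serves both halves of the theorem: [N1] and [R0] do not depend on [x],
    and neither does the range of [e] once [D] is given. A finite measure admits one [D] for all
    [x]; in general [D] is chosen for a fixed [x]. *)
Lemma log_exp_moment_upper (q eta : R) : 0 <= q -> 0 < eta ->
  (forall y, mu [set y] ^+ 2 <= q%:E)%E ->
  exists N1 R0, (forall y, mu [set y] < N1%:E)%E /\
  forall D, 0 < D <= 1 -> \forall e \near 0^'+, forall x (L : {RV P >-> R}),
    is_local_time P (X e x) mu t L ->
    (forall y, x - R0%:R - 1 <= y <= x + R0%:R + 1 ->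
      (mu `[(y - 2 * D)%R, (y + 2 * D)%R]%classic < N1%:E)%E) ->
    (lne 'E_P[fun w => expR (L w)] <= ((t / 2 * q + eta) / e ^+ 2)%:E)%E.
Proof.
move=> q0 eta0 muq; have [N2 N20 HN2] := locally_bounded_two.
(* So c t = t q / 2 + eta / 2; the other eta / 2 will absorb the constant [C]. Moreover 2 c > q. *)
pose c := q / 2 + eta / (2 * t).
have c0 : 0 < c by rewrite ltr_wpDl ?divr_ge0// divr_gt0// mulr_gt0.
pose s := Num.sqrt q; pose S := Num.sqrt (2 * c).
have s0 : 0 <= s by exact: sqrtr_ge0.
have sS : s < S.
  rewrite ltr_sqrt ?mulr_gt0// /c mulrDr mulrCA mulfV ?mulr1// ltrDl mulr_gt0//.
  by rewrite divr_gt0 ?mulr_gt0.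
(* Then s < N1 < p N1 < S: atoms have mass at most s, and even after the factor [p] the small balls
   stay below the critical mass S. *)
pose N1 := (s + S) / 2; pose p := ((N1 + S) / 2) / N1.
have N10 : 0 < N1 by rewrite /N1; lra.
have p1 : 1 < p by rewrite /p ltr_pdivlMr// mul1r /N1; lra.
have pN1 : p * N1 = (N1 + S) / 2 by rewrite divfK// gt_eqF.
pose N2' := p / (p - 1) * N2.
have N2'0 : 0 <= N2' by rewrite mulr_ge0// divr_ge0 ?subr_ge0 ?(ltW p1)// ltW// (lt_trans _ p1).
(* Large enough for N2' / sqrt c2 < 1/2, so the intermediate part has ratio at most 1/2 already at
   the scale of unit balls. *)
pose c2 := (4 * N2' + 1) ^+ 2.
have c20 : 0 < c2 by rewrite exprn_gt0//; lra.
have sc2 : Num.sqrt c2 = 4 * N2' + 1 by rewrite sqrtr_sqr ger0_norm//; lra.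
(* The distance beyond which [tail_ub_small] neutralizes the rate c2 / e^2. *)
pose R0 := (Num.truncn (Num.sqrt c2 * t)).+1.
exists N1, R0; split.
  move=> y; apply: (@le_lt_trans _ _ s%:E); last by rewrite lte_fin /N1; lra.
  have := muq y; have : (0 <= mu [set y])%E by []; case: (mu [set y]) => [v| |]//.
  rewrite -EFin_expe !lee_fin => v0 vq.
  by rewrite -(ger0_norm v0) -sqrtr_sqr ler_sqrt.
move=> D /andP[D0 D1].
have S0 : 0 < S by rewrite (le_lt_trans s0).
pose Q := (p * N1 / S + 1) / 2.
have pNS : p * N1 / S < 1 by rewrite ltr_pdivrMr// mul1r pN1 /N1; lra.
have Q1 : Q < 1 by rewrite /Q; lra.
have Q0 : 0 < Q.
  have : 0 <= p * N1 / S by rewrite pN1 divr_ge0 ?(ltW S0)//; lra.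
  by rewrite /Q; lra.
(* All contributions together are at most C exp (c t / e^2), and C <= exp (eta / (2 e^2)) for small
   [e]. *)
pose C := 1 + Q / (1 - Q) + 2 * (4 * N2' / Num.sqrt c2).
have C0 : 0 < C.
  have A1 : 0 <= Q / (1 - Q) by rewrite divr_ge0 ?(ltW Q0)// subr_ge0 ltW.
  have A2 : 0 <= 2 * (4 * N2' / Num.sqrt c2).
    by rewrite mulr_ge0// divr_ge0 ?sqrtr_ge0// mulr_ge0.
  by rewrite /C; lra.
near=> e => x L [mu_ [k [apx cv]]] H1.
have e0 : 0 < e by [].
have G1 : green_ub e D (p * N1) (c / e ^+ 2) <= Q.
  near: e; apply: green_ub_small => //; first by rewrite pN1; lra.
  by rewrite -/S /Q; lra.
have G2 : green_ub e 1 N2' (c2 / e ^+ 2) <= 2^-1.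
  near: e; apply: green_ub_small => //.
  apply: (@le_lt_trans _ _ (N2' / Num.sqrt c2)); last first.
    by rewrite sc2 ltr_pdivrMr; lra.
  have hs : Num.sqrt c2 <= Num.sqrt (2 * c2) by apply: ler_wsqrtr; lra.
  have c3 : 0 < 2 * c2 by apply: mulr_gt0.
  by apply: ler_wpM2l => //; rewrite lef_pV2 // posrE sqrtr_gt0.
have T : expR (c2 / e ^+ 2 * t) * tail_ub e N2' (c2 / e ^+ 2) R0 <= 4 * N2' / Num.sqrt c2.
  near: e; apply: tail_ub_small => //.
  rewrite -{1}(sqr_sqrtr (ltW c20)) expr2 -mulrA ler_wpM2l ?sqrtr_ge0//.
  have s2 : 0 <= Num.sqrt c2 * t by rewrite mulr_ge0 ?sqrtr_ge0 ?ltW.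
  by have /andP[_ /ltW] := truncn_itv s2.
have CE : expR (- (eta / 2 / e ^+ 2)) < C^-1.
  by near: e; apply: expR_inv_sqr_lt; rewrite ?invr_gt0 ?divr_gt0.
have ee0 : 0 < e ^+ 2 by rewrite exprn_gt0.
have U := exp_moment_upper hB e0 apx cv p1 D0 D1 (divr_gt0 c0 ee0) (divr_gt0 c20 ee0)
  H1 HN2 G1 G2 Q1.
rewrite exp_moment_unfold.
have b1 : (\int[P]_w (expR (L w))%:E <= (expR ((t / 2 * q + eta) / e ^+ 2))%:E)%E.
  apply: (@le_trans _ _ (\int[P]_w (expR `|L w|)%:E)%E).
    apply: ge0_le_integralT; [exact: measurable_expRV| | |].
    - apply/measurable_EFinP; apply: (measurableT_comp (@measurable_expR R)).
      by apply: measurableT_comp => //; exact: measurable_funPT.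
    - by move=> w; rewrite lee_fin expR_ge0.
    by move=> w; rewrite lee_fin ler_expR ler_norm.
  apply: (le_trans U); rewrite lee_fin.
  have -> : (t / 2 * q + eta) / e ^+ 2 = eta / 2 / e ^+ 2 + c / e ^+ 2 * t.
    by rewrite /c; field; rewrite !gt_eqF.
  rewrite expRD; apply: (@le_trans _ _ (C * expR (c / e ^+ 2 * t))); last first.
    rewrite ler_wpM2r ?expR_ge0//.
    by move: CE; rewrite expRN ltf_pV2 ?posrE ?expR_gt0// => /ltW.
  have E1 : 1 <= expR (c / e ^+ 2 * t).
    by rewrite -[leLHS]expR0 ler_expR mulr_ge0 ?divr_ge0 ?(ltW c0) ?(ltW ee0) ?(ltW t0).
  set E := expR (c / e ^+ 2 * t) in E1 *.
  rewrite /C (mulrDl _ _ E) (mulrDl _ _ E) mul1r; apply: lerD; first apply: lerD => //.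
    by rewrite le_eqVlt; apply/orP; left; apply/eqP; ring.
  have T' : 2 * expR (c2 / e ^+ 2 * t) * tail_ub e N2' (c2 / e ^+ 2) R0
      <= 2 * (4 * N2' / Num.sqrt c2) by rewrite -mulrA ler_wpM2l.
  apply: le_trans T' _; rewrite ler_peMr//.
  by rewrite mulr_ge0// divr_ge0 ?sqrtr_ge0// mulr_ge0.
apply: lne_le b1; by apply: integral_ge0 => w _; rewrite lee_fin expR_ge0.
Unshelve. all: end_near. Qed.

End LogMoments.

(** * The two limits *)

Section Assembly.
Context d (Omega : measurableType d) (R : realType) (P : probability Omega R).
Variables (B : R -> {RV P >-> R}) (hB : wiener_process P B).
Variables (t : R) (t0 : 0 < t).

Lemma atom_le_ball (mu : {measure set R -> \bar R}) (y : R) :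
  (mu [set y] <= mu `[(y - 1)%R, (y + 1)%R]%classic)%E.
Proof.
apply: le_measure; rewrite ?inE//.
by move=> z /= ->; rewrite in_itv/= gerBl lerDl ler01.
Qed.

Lemma sup_sqr_atoms (mu : {measure set R -> \bar R}) : locally_bounded_measure mu ->
  exists2 q : R, 0 <= q & ereal_sup (range (fun y : R => mu [set y] ^+ 2)%E) = q%:E.
Proof.
move=> lb; have [N N0 HN] := locally_bounded_two lb.
set S := ereal_sup _.
have S0 : (0 <= S)%E.
  have h : (mu [set 0%R] ^+ 2 <= S)%E by apply: ereal_sup_ubound; exists 0%R.
  by apply: le_trans h; apply: expe_ge0.
have SN : (S <= (N ^+ 2)%:E)%E.
  apply: ge_ereal_sup => _ [y _ <-]; rewrite EFin_expe; apply: lee_expe => //.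
  apply: (le_trans (atom_le_ball mu y)); apply: le_trans (ltW (HN y)).
  apply: le_measure; rewrite ?inE//; apply: subset_itv; rewrite bnd_simp; lra.
have Sf : S \is a fin_num by rewrite ge0_fin_numE// (le_lt_trans SN)// ltey.
by exists (fine S); [exact: fine_ge0|rewrite fineK].
Qed.

Lemma finite_locally_bounded (mu : {finite_measure set R -> \bar R}) : locally_bounded_measure mu.
Proof.
rewrite /locally_bounded_measure; apply: (@le_lt_trans _ _ (mu setT)).
  by apply: ge_ereal_sup => _ [y _ <-]; apply: le_measure; rewrite ?inE.
by rewrite ltey_eq fin_num_measure.
Qed.

Lemma atom_scaled_le (mu : {measure set R -> \bar R}) (L : R -> R -> {RV P >-> R}) e y :
  locally_bounded_measure mu -> local_time_family P B mu t L -> 0 < e ->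
  ((t / 2)%:E * mu [set y] ^+ 2 <= (e ^+ 2)%:E * log_exp_moment P L e y)%E.
Proof.
move=> lb hL e0; have [N N0 HN] := locally_bounded_two lb.
have fin : mu [set y] \is a fin_num.
  rewrite ge0_fin_numE//; apply: le_lt_trans (atom_le_ball mu y) _.
  apply: (@le_lt_trans _ _ N%:E); last exact: ltey.
  apply: le_trans (ltW (HN y)).
  apply: le_measure; rewrite ?inE//; apply: subset_itv; rewrite bnd_simp; lra.
have h : mu [set y] = (fine (mu [set y]))%:E by rewrite fineK.
rewrite [in leLHS]h -EFin_expe -EFinM.
exact: (log_exp_moment_lower hB t0 e0 (hL e y e0) h).
Qed.

Lemma scaled_sup_le (mu : {measure set R -> \bar R}) (X : \bar R) :
  (forall y, (t / 2)%:E * mu [set y] ^+ 2 <= X)%E ->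
  ((t / 2)%:E * ereal_sup (range (fun y : R => mu [set y] ^+ 2)) <= X)%E.
Proof.
move=> H; have t2 : 0 < t / 2 by rewrite divr_gt0.
rewrite -lee_pdivlMl//; apply: ge_ereal_sup => _ [y _ <-].
by rewrite lee_pdivlMl.
Qed.

Lemma finite_measure_limit (mu : {finite_measure set R -> \bar R}) (L : R -> R -> {RV P >-> R}) :
  local_time_family P B mu t L ->
  ((e ^+ 2)%:E * ereal_sup (range (fun x : R => log_exp_moment P L e x)))%E
       @[e --> 0^'+] -->
     ((t / 2)%:E * ereal_sup (range (fun y : R => mu [set y] ^+ 2)))%E.
Proof.
move=> hL; have lb := finite_locally_bounded mu.
have [q q0 qE] := sup_sqr_atoms lb.
pose f e := ((e ^+ 2)%:E * ereal_sup (range (fun x : R => log_exp_moment P L e x)))%E.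
have low e : 0 < e -> ((t / 2 * q)%:E <= f e)%E.
  move=> e0; rewrite EFinM -qE; apply: scaled_sup_le => y.
  apply: le_trans (atom_scaled_le y lb hL e0) _; apply: lee_wpmul2l.
    by rewrite lee_fin sqr_ge0.
  by apply: ereal_sup_ubound; exists y.
have up eta : 0 < eta -> \forall e \near 0^'+, (f e <= (t / 2 * q + eta)%:E)%E.
  move=> eta0.
  have muq y : (mu [set y] ^+ 2 <= q%:E)%E by rewrite -qE; apply: ereal_sup_ubound; exists y.
  have [N1 [R0 [HN1 H]]] := log_exp_moment_upper hB t0 lb q0 eta0 muq.
  have [D D01 HD] := small_balls_finite HN1.
  have {}H := H D D01.
  near=> e; have e0 : 0 < e by [].
  have ee0 : 0 < e ^+ 2 by rewrite exprn_gt0.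
  rewrite /f -lee_pdivlMl//; apply: ge_ereal_sup => _ [x _ <-].
  rewrite -EFinM mulrC.
  (* The range of [e] is obtained for all [x] at once, which allows the supremum inside the
     limit. *)
  have He : forall x (L : {RV P >-> R}),
    is_local_time P (fun s w => (x + e * B s w)%R) mu t L ->
    (forall y, x - R0%:R - 1 <= y <= x + R0%:R + 1 ->
      (mu `[(y - 2 * D)%R, (y + 2 * D)%R]%classic < N1%:E)%E) ->
    (lne 'E_P[fun w => expR (L w)] <= ((t / 2 * q + eta) / e ^+ 2)%:E)%E by near: e.
  by apply: He => //; exact: hL.
rewrite qE -EFinM; apply/fine_cvgP; split.
  near=> e; have e0 : 0 < e by [].
  have h : (f e <= (t / 2 * q + 1)%:E)%E by near: e; exact: up.
  rewrite fin_numE; apply/andP; split.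
    by rewrite -ltNye (lt_le_trans _ (low e e0))// ltNyr.
  by rewrite -ltey (le_lt_trans h)// ltry.
apply/cvgrPdist_le => eta eta0; near=> e; have e0 : 0 < e by [].
have h : (f e <= (t / 2 * q + eta)%:E)%E by near: e; exact: up.
have l := low e e0; rewrite /= -/(f e).
move: h l; case: (f e) => [v| |]//; rewrite !lee_fin /= => h l.
by rewrite ler_norml; apply/andP; split; lra.
Unshelve. all: end_near. Qed.

Lemma locally_bounded_limsup (mu : {measure set R -> \bar R}) (L : R -> R -> {RV P >-> R}) :
  locally_bounded_measure mu -> local_time_family P B mu t L ->
  ereal_sup (range (fun x : R =>
       limf_esup (fun e : R => ((e ^+ 2)%:E * log_exp_moment P L e x)%E) 0^'+)) =
     ((t / 2)%:E * ereal_sup (range (fun y : R => mu [set y] ^+ 2)))%E.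
Proof.
move=> lb hL; have [q q0 qE] := sup_sqr_atoms lb.
have muq y : (mu [set y] ^+ 2 <= q%:E)%E by rewrite -qE; apply: ereal_sup_ubound; exists y.
apply/eqP; rewrite eq_le; apply/andP; split.
  apply: ge_ereal_sup => _ [x _ <-].
  rewrite qE; apply/lee_addgt0Pr => eta eta0; rewrite -EFinM -EFinD.
  have [N1 [R0 [HN1 H]]] := log_exp_moment_upper hB t0 lb q0 eta0 muq.
  have fin y : (mu `[(y - 1)%R, (y + 1)%R]%classic < +oo)%E.
    by apply: le_lt_trans lb; apply: ereal_sup_ubound; exists y.
  (* Here [D] depends on [x], which is harmless since [x] is fixed before [e] tends to 0. *)
  have [D D01 HD] := small_balls (x - R0%:R - 1) (x + R0%:R + 1) fin HN1.
  have V : \forall e \near 0^'+, ((e ^+ 2)%:E * log_exp_moment P L e x <= (t / 2 * q + eta)%:E)%E.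
    have {}H := H D D01.
    near=> e; have e0 : 0 < e by [].
    have ee0 : 0 < e ^+ 2 by rewrite exprn_gt0.
    rewrite -lee_pdivlMl// -EFinM mulrC.
    have He : forall x (L : {RV P >-> R}),
      is_local_time P (fun s w => (x + e * B s w)%R) mu t L ->
      (forall y, x - R0%:R - 1 <= y <= x + R0%:R + 1 ->
        (mu `[(y - 2 * D)%R, (y + 2 * D)%R]%classic < N1%:E)%E) ->
      (lne 'E_P[fun w => expR (L w)] <= ((t / 2 * q + eta) / e ^+ 2)%:E)%E by near: e.
    by apply: He; [exact: hL|exact: HD].
  (* The upper limit is an infimum over neighbourhoods of suprema; the set where the bound holds is
     one of them. *)
  apply: (@le_trans _ _ (ereal_sup ((fun e : R => ((e ^+ 2)%:E * log_exp_moment P L e x)%E) @`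
    [set e | ((e ^+ 2)%:E * log_exp_moment P L e x <= (t / 2 * q + eta)%:E)%E]))).
    by apply: ereal_inf_lbound; exists [set e | ((e ^+ 2)%:E * log_exp_moment P L e x <= (t / 2 * q + eta)%:E)%E].
  by apply: ge_ereal_sup => _ [e /= he <-].
apply: scaled_sup_le => y.
apply: (@le_trans _ _ (limf_esup (fun e : R => ((e ^+ 2)%:E * log_exp_moment P L e y)%E) 0^'+)).
  apply: le_ereal_inf_tmp => _ [V V0 <-].
  (* The lower bound holds for every positive [e], so one such point in each neighbourhood
     suffices. *)
  have N : \forall e \near 0^'+, V e /\ 0 < e.
    by near=> e; split => //; near: e.
  have [e [Ve e0]] := filter_ex N.
  by apply: le_trans (atom_scaled_le y lb hL e0) _; apply: ereal_sup_ubound; exists e.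
by apply: ereal_sup_ubound; exists y.
Unshelve. all: end_near. Qed.

End Assembly.

Theorem theorem1 (R : realType) (d : measure_display) (Omega : measurableType d)
    (P : probability Omega R) (B : R -> {RV P >-> R}) (hB : wiener_process P B)
    (t : R) (ht : 0 < t) :
  (forall (mu : {finite_measure set R -> \bar R}) (L : R -> R -> {RV P >-> R}),
     local_time_family P B mu t L ->
     ((e ^+ 2)%:E * ereal_sup (range (fun x : R => log_exp_moment P L e x)))%E
       @[e --> 0^'+] -->
     ((t / 2)%:E * ereal_sup (range (fun y : R => mu [set y] ^+ 2)))%E)
  /\
  (forall (mu : {sigma_finite_measure set R -> \bar R})
     (L : R -> R -> {RV P >-> R}),
     locally_bounded_measure mu ->
     local_time_family P B mu t L ->
     ereal_sup (range (fun x : R =>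
       limf_esup (fun e : R => ((e ^+ 2)%:E * log_exp_moment P L e x)%E) 0^'+)) =
     ((t / 2)%:E * ereal_sup (range (fun y : R => mu [set y] ^+ 2)))%E).
Proof.
split; first by move=> mu L; exact: (finite_measure_limit hB ht).
by move=> mu L; exact: (locally_bounded_limsup hB ht).
Qed.
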